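(* Let $k$ be a field, $H$ a Hopf algebra over $k$, and let $A$ be a right Noetherian $H$-semiprime $H$-module algebra such that the action of $H$ on $A$ is locally finite. Then $A$ has a right Artinian classical right quotient ring.
   Context: All algebras are associative and unital over the field $k$; no restriction is imposed on $H$. Write $\Delta(h)=\sum h_{(1)}\otimes h_{(2)}$. An $H$-module algebra $A$ is an algebra with a left $H$-module structure such that $h(ab)=\sum (h_{(1)}a)(h_{(2)}b)$ for all $h\in H$, $a,b\in A$. $A$ is $H$-semiprime if it contains no nonzero nilpotent $H$-stable (two-sided) ideals. The action of $H$ on $A$ is locally finite if $\dim_k Ha<\infty$ for all $a\in A$. An element $s$ of a ring $R$ is regular if its left and right annihilators in $R$ are both zero. A ring $Q$ containing $R$ as a subring is a classical right quotient ring of $R$ if all regular elements of $R$ are invertible in $Q$ and each element of $Q$ can be written as $as^{-1}$ with $a,s\in R$ and $s$ regular in $R$. *)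

(* Defs.v *)
From HB Require Import structures.
From mathcomp Require Import all_boot all_algebra.
From mathcomp Require Import boolp classical_sets.

Set Implicit Arguments.
Unset Strict Implicit.
Unset Printing Implicit Defensive.

Import GRing.Theory.
Local Open Scope ring_scope.
Local Open Scope quotient_scope.
Local Open Scope classical_set_scope.

(* Unital associative algebras, the zero algebra included: MathComp's [algType]
   requires 1 != 0. *)

Record unitalAlgebra (k : fieldType) := UnitalAlgebra {
  ua_lmod : lmodType k;
  ua_one : ua_lmod;
  ua_mul : {bilinear ua_lmod -> ua_lmod -> ua_lmod};
  ua_mulA : associative ua_mul;
  ua_mul1 : left_id ua_one ua_mul;
  ua_mulr1 : right_id ua_one ua_mul
}.

Definition ua_sort (k : fieldType) (A : unitalAlgebra k) : Type := ua_lmod A.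
Coercion ua_sort : unitalAlgebra >-> Sortclass.

Section UnitalAlgebraTheory.
Variables (k : fieldType) (A : unitalAlgebra k).

HB.instance Definition _ := GRing.Lmodule.copy (ua_sort A) (ua_lmod A).

Let mulDl : left_distributive (@ua_mul k A) +%R.
Proof. by move=> x y z; rewrite linearDl. Qed.

Let mulDr : right_distributive (@ua_mul k A) +%R.
Proof. by move=> x y z; rewrite linearDr. Qed.

HB.instance Definition _ := GRing.Zmodule_isPzRing.Build (ua_sort A)
  (@ua_mulA k A) (@ua_mul1 k A) (@ua_mulr1 k A) mulDl mulDr.

Lemma ua_scalerAl (c : k) (x y : A) : c *: (x * y) = (c *: x) * y.
Proof. by symmetry; exact: (linearZl_LR (@ua_mul k A)). Qed.

Lemma ua_scalerAr (c : k) (x y : A) : c *: (x * y) = x * (c *: y).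
Proof. by symmetry; exact: (linearZr_LR (@ua_mul k A)). Qed.

End UnitalAlgebraTheory.

(* The tensor product of U and V is the quotient of the formal finite sums of
   pairs by the congruence generated by biadditivity and balancedness. A formal
   sum is a list; scalars are absorbed in the first component. *)

Section TensorDef.
Variables (k : comNzRingType) (U V : lmodType k).

Inductive tensor_eq : seq (U * V) -> seq (U * V) -> Prop :=
| TensorRefl s : tensor_eq s s
| TensorSym s t : tensor_eq s t -> tensor_eq t s
| TensorTrans s t r : tensor_eq s t -> tensor_eq t r -> tensor_eq s r
| TensorCat s s' t t' :
    tensor_eq s s' -> tensor_eq t t' -> tensor_eq (s ++ t) (s' ++ t')
| TensorCatC s t : tensor_eq (s ++ t) (t ++ s)
| TensorZero v : tensor_eq [:: (0, v)] [::]
| TensorDl u u' v : tensor_eq [:: (u + u', v)] [:: (u, v); (u', v)]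
| TensorDr u v v' : tensor_eq [:: (u, v + v')] [:: (u, v); (u, v')]
| TensorZ (c : k) u v : tensor_eq [:: (c *: u, v)] [:: (u, c *: v)].

Definition tensor_rel : rel (seq (U * V)) := fun s t => `[< tensor_eq s t >].

Lemma tensor_rel_refl : reflexive tensor_rel.
Proof. by move=> s; apply/asboolP; exact: TensorRefl. Qed.

Lemma tensor_rel_sym : symmetric tensor_rel.
Proof. by move=> s t; apply/asboolP/asboolP; exact: TensorSym. Qed.

Lemma tensor_rel_trans : transitive tensor_rel.
Proof.
by move=> t s r /asboolP st /asboolP tr; apply/asboolP; exact: TensorTrans tr.
Qed.

Canonical tensor_equiv :=
  EquivRel tensor_rel tensor_rel_refl tensor_rel_sym tensor_rel_trans.

Definition tensor : Type := {eq_quot tensor_equiv}.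

HB.instance Definition _ := Choice.on tensor.
HB.instance Definition _ := EqQuotient.on tensor.

Implicit Types (x y z : tensor) (s t : seq (U * V)).

Lemma tensor_piP s t : \pi_tensor s = \pi_tensor t <-> tensor_eq s t.
Proof.
by split=> [/eqmodP/asboolP | st] //; apply/eqmodP/asboolP.
Qed.

Lemma tensor_reprK s : tensor_eq (repr (\pi_tensor s)) s.
Proof. by apply/tensor_piP; rewrite reprK. Qed.

Definition pure_tensor (u : U) (v : V) : tensor := \pi_tensor [:: (u, v)].

Definition scale_sum (c : k) s := [seq (c *: p.1, p.2) | p <- s].

Lemma scale_sum_eq c s t : tensor_eq s t ->
  tensor_eq (scale_sum c s) (scale_sum c t).
Proof.
elim=> {s t} [s|s t _|s t r _ st _ tr|s s' t t' _ ss _ tt|s t|v|u u' v|u v v'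
             |d u v].
- exact: TensorRefl.
- exact: TensorSym.
- exact: TensorTrans tr.
- by rewrite /scale_sum !map_cat; exact: TensorCat.
- by rewrite /scale_sum !map_cat; exact: TensorCatC.
- by rewrite /= scaler0; exact: TensorZero.
- by rewrite /= scalerDr; exact: TensorDl.
- exact: TensorDr.
- by rewrite /= scalerA mulrC -scalerA; exact: TensorZ.
Qed.

Definition tensor_zero : tensor := \pi_tensor [::].
Definition tensor_add x y : tensor := \pi_tensor (repr x ++ repr y).
Definition tensor_scale (c : k) x : tensor := \pi_tensor (scale_sum c (repr x)).
Definition tensor_opp x := tensor_scale (-1) x.

Lemma tensor_addE s t :
  tensor_add (\pi s) (\pi t) = \pi_tensor (s ++ t).
Proof. by apply/tensor_piP; apply: TensorCat; exact: tensor_reprK. Qed.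

Lemma tensor_scaleE c s : tensor_scale c (\pi s) = \pi_tensor (scale_sum c s).
Proof. by apply/tensor_piP; apply: scale_sum_eq; exact: tensor_reprK. Qed.

Lemma tensor_piE x : exists s, x = \pi_tensor s.
Proof. by exists (repr x); rewrite reprK. Qed.

Lemma tensor_addA : associative tensor_add.
Proof.
move=> x y z; have [[s ->] [t ->] [r ->]] :=
  And3 (tensor_piE x) (tensor_piE y) (tensor_piE z).
by rewrite (tensor_addE t r) (tensor_addE s t) !tensor_addE catA.
Qed.

Lemma tensor_addC : commutative tensor_add.
Proof.
move=> x y; have [[s ->] [t ->]] := conj (tensor_piE x) (tensor_piE y).
by rewrite !tensor_addE; apply/tensor_piP; exact: TensorCatC.
Qed.

Lemma tensor_add0 : left_id tensor_zero tensor_add.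
Proof. by move=> x; have [s ->] := tensor_piE x; rewrite tensor_addE. Qed.

Lemma tensor_scaleDl x :
  {morph tensor_scale^~ x : a b / a + b >-> tensor_add a b}.
Proof.
move=> a b; have [s ->] := tensor_piE x; rewrite !tensor_scaleE tensor_addE.
apply/tensor_piP; elim: s => [|p s IHs]; first exact: TensorRefl.
have /= aux := TensorCat (TensorDl (a *: p.1) (b *: p.1) p.2) IHs.
rewrite /= scalerDl; apply: TensorTrans aux _.
apply: (@TensorCat [:: _] [:: _]); first exact: TensorRefl.
rewrite -cat1s -[X in tensor_eq _ (_ ++ X)]cat1s !catA.
by apply: TensorCat; [exact: TensorCatC | exact: TensorRefl].
Qed.

Lemma tensor_scale0 x : tensor_scale 0 x = tensor_zero.
Proof.
have [s ->] := tensor_piE x; rewrite tensor_scaleE; apply/tensor_piP.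
elim: s => [|p s IHs]; first exact: TensorRefl.
rewrite /= scale0r.
exact: (@TensorCat [:: _] [::] _ [::] (TensorZero p.2) IHs).
Qed.

Lemma tensor_scale1 : left_id 1 tensor_scale.
Proof.
move=> x; have [s ->] := tensor_piE x; rewrite tensor_scaleE /scale_sum.
by under eq_map => p do rewrite scale1r -surjective_pairing; rewrite map_id.
Qed.

Lemma tensor_addN : left_inverse tensor_zero tensor_opp tensor_add.
Proof.
move=> x; rewrite -{2}[x]tensor_scale1 -tensor_scaleDl addNr.
exact: tensor_scale0.
Qed.

HB.instance Definition _ := GRing.isZmodule.Build tensor
  tensor_addA tensor_addC tensor_add0 tensor_addN.

Lemma tensor_piD s t : \pi_tensor (s ++ t) = \pi_tensor s + \pi_tensor t.
Proof. by symmetry; exact: tensor_addE. Qed.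

Lemma tensor_scaleA a b x :
  tensor_scale a (tensor_scale b x) = tensor_scale (a * b) x.
Proof.
have [s ->] := tensor_piE x; rewrite (tensor_scaleE b) !tensor_scaleE.
rewrite /scale_sum -map_comp; congr \pi_tensor; apply: eq_map => p /=.
by rewrite scalerA.
Qed.

Lemma tensor_scaleDr : right_distributive tensor_scale +%R.
Proof.
move=> a x y; have [[s ->] [t ->]] := conj (tensor_piE x) (tensor_piE y).
by rewrite -tensor_piD !tensor_scaleE -tensor_piD /scale_sum map_cat.
Qed.

HB.instance Definition _ := GRing.Zmodule_isLmodule.Build k tensor
  tensor_scaleA tensor_scale1 tensor_scaleDr tensor_scaleDl.

Lemma tensor_piZ c s : \pi_tensor (scale_sum c s) = c *: \pi_tensor s.
Proof. by symmetry; exact: tensor_scaleE. Qed.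

Lemma pure_tensor_bilinear : bilinear_for *:%R *:%R pure_tensor.
Proof.
split=> [v c u u' | u c v v']; rewrite /= /pure_tensor -tensor_piZ -tensor_piD.
  by apply/tensor_piP; exact: TensorDl.
apply/tensor_piP; apply: TensorTrans (TensorDr _ _ _) _.
apply: (@TensorCat [:: _] [:: _] [:: _] [:: _]); last exact: TensorRefl.
by apply: TensorSym; exact: TensorZ.
Qed.

HB.instance Definition _ :=
  bilinear_isBilinear.Build k U V tensor *:%R *:%R pure_tensor
    pure_tensor_bilinear.

Lemma tensor_sumE x : x = \sum_(p <- repr x) pure_tensor p.1 p.2.
Proof.
rewrite -[LHS]reprK; elim: (repr x) => [|p s IHs]; first by rewrite big_nil.
by rewrite big_cons -IHs -cat1s tensor_piD /pure_tensor -surjective_pairing.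
Qed.

End TensorDef.

Notation "U \ox V" := (tensor U V)
  (at level 40, left associativity) : type_scope.
Notation "u \ot v" := (pure_tensor u v)
  (at level 40, left associativity) : ring_scope.

(* [tlift f (\sum_i u_i \ot v_i) = \sum_i f u_i v_i] when f is bilinear (see
   [tlift_sum]), whatever the decomposition: this renders Sweedler sums. If f
   is not bilinear the value depends on a chosen representative. *)
Definition tlift (k : comNzRingType) (U V W : lmodType k) (f : U -> V -> W)
    (x : U \ox V) : W :=
  \sum_(p <- repr x) f p.1 p.2.

Section Lift.
Variables (k : comNzRingType) (U V W : lmodType k) (f : U -> V -> W).
Hypothesis f_bilin : bilinear_for *:%R *:%R f.

Let fDl u u' v : f (u + u') v = f u v + f u' v.
Proof. by have := f_bilin.1 v 1 u u'; rewrite /= !scale1r. Qed.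
Let fDr u v v' : f u (v + v') = f u v + f u v'.
Proof. by have := f_bilin.2 u 1 v v'; rewrite /= !scale1r. Qed.
Let f0l v : f 0 v = 0.
Proof. by apply: (addIr (f 0 v)); rewrite -fDl !add0r. Qed.
Let f0r u : f u 0 = 0.
Proof. by apply: (addIr (f u 0)); rewrite -fDr !add0r. Qed.
Let fZl c u v : f (c *: u) v = c *: f u v.
Proof. by have := f_bilin.1 v c u 0; rewrite /= addr0 f0l addr0. Qed.
Let fZr c u v : f u (c *: v) = c *: f u v.
Proof. by have := f_bilin.2 u c v 0; rewrite /= addr0 f0r addr0. Qed.

Lemma tlift_pi (s : seq (U * V)) :
  tlift f (\pi s) = \sum_(p <- s) f p.1 p.2.
Proof.
pose S t := \sum_(p <- t) f p.1 p.2.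
suff eqS t t' : tensor_eq t t' -> S t = S t' by exact/eqS/tensor_reprK.
elim=> {t t'} [//|t t' _ -> //|t t' r _ -> _ -> //|t1 t2 u1 u2 _ e1 _ e2||v
               |u u' v|u v v'|c u v].
- by move: e1 e2; rewrite /S !big_cat /= => -> ->.
- by move=> t t'; rewrite /S !big_cat /= addrC.
- by rewrite /S big_seq1 big_nil f0l.
- by rewrite /S big_seq1 big_cons big_seq1 fDl.
- by rewrite /S big_seq1 big_cons big_seq1 fDr.
- by rewrite /S !big_seq1 fZl fZr.
Qed.

Lemma tlift_pure u v : tlift f (u \ot v) = f u v.
Proof. by rewrite tlift_pi big_seq1. Qed.

Lemma tlift_linear : linear (tlift f).
Proof.
move=> c x y; have [[s ->] [t ->]] := conj (tensor_piE x) (tensor_piE y).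
rewrite -tensor_piZ -tensor_piD !tlift_pi big_cat big_map scaler_sumr; congr (_ + _).
by apply: eq_bigr => p _; rewrite fZl.
Qed.

Lemma tlift_sum (I : Type) (r : seq I) (P : pred I) (u : I -> U) (v : I -> V) :
  tlift f (\sum_(i <- r | P i) u i \ot v i) = \sum_(i <- r | P i) f (u i) (v i).
Proof.
have tD x y : tlift f (x + y) = tlift f x + tlift f y.
  by have := tlift_linear 1 x y; rewrite !scale1r.
have t0 : tlift f 0 = 0 by apply: (addIr (tlift f 0)); rewrite -tD !add0r.
rewrite (big_morph _ tD t0); apply: eq_bigr => i _; exact: tlift_pure.
Qed.

End Lift.

Lemma tensor_ext (k : comNzRingType) (U V W : lmodType k) (f g : U \ox V -> W) :
  linear f -> linear g -> (forall u v, f (u \ot v) = g (u \ot v)) -> f =1 g.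
Proof.
move=> fl gl fg x.
have D (h : U \ox V -> W) : linear h -> {morph h : y z / y + z}.
  by move=> hl y z; have := hl 1 y z; rewrite /= !scale1r.
have Z (h : U \ox V -> W) : linear h -> h 0 = 0.
  by move=> hl; apply: (addIr (h 0)); rewrite -(D _ hl) !add0r.
rewrite (tensor_sumE x) (big_morph _ (D _ fl) (Z _ fl)).
by rewrite (big_morph _ (D _ gl) (Z _ gl)); apply: eq_bigr => p _.
Qed.

Definition tensor_map (k : comNzRingType) (U U' V V' : lmodType k)
    (f : U -> U') (g : V -> V') : U \ox V -> U' \ox V' :=
  tlift (fun u v => f u \ot g v).

Definition tensor_assoc (k : comNzRingType) (U V W : lmodType k) :
    (U \ox V) \ox W -> U \ox (V \ox W) :=
  tlift (fun x w => tlift (fun u v => u \ot (v \ot w)) x).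

(* Only a [pzRingType]: over a general base ring the tensor product of two
   nonzero algebras may be zero. *)

Section TensorAlgebra.
Variables (k : comNzRingType) (A B : algType k).

Definition tensor_one : A \ox B := 1 \ot 1.

Definition tensor_mul (x y : A \ox B) : A \ox B :=
  tlift (fun a b => tlift (fun c d => (a * c) \ot (b * d)) y) x.

Let mul_pure_bilin a b :
  bilinear_for *:%R *:%R (fun (c : A) (d : B) => (a * c) \ot (b * d)).
Proof.
split=> [d c u v | d c u v] /=; rewrite mulrDr -scalerAr.
  by rewrite linearPl.
by rewrite linearPr.
Qed.

Lemma tensor_mul_bilin : bilinear_for *:%R *:%R tensor_mul.
Proof.
have inner y : bilinear_for *:%R *:%R
    (fun a b => tlift (fun c d => (a * c) \ot (b * d)) y : A \ox B).
  split=> [b c a a' | a c b b'] /=; rewrite /tlift scaler_sumr -big_split /=;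
    apply: eq_bigr => p _; rewrite mulrDl -scalerAl.
    by rewrite linearPl.
  by rewrite linearPr.
split=> [y | x c y y'] /=; first exact: tlift_linear.
rewrite /tensor_mul {1 2 3}/tlift scaler_sumr -big_split /=.
by apply: eq_bigr => p _; exact: tlift_linear.
Qed.

Lemma tensor_mulE a b c d :
  tensor_mul (a \ot b) (c \ot d) = (a * c) \ot (b * d).
Proof.
have E x : tensor_mul x (c \ot d) = tlift (fun a b => (a * c) \ot (b * d)) x.
  rewrite /tensor_mul /tlift; apply: eq_bigr => p _.
  exact: tlift_pure (mul_pure_bilin _ _) _ _.
rewrite E tlift_pure //.
split=> [v e u u' | v e u u'] /=; rewrite mulrDl -scalerAl.
  by rewrite linearPl.
by rewrite linearPr.
Qed.

Let mulDl : left_distributive tensor_mul +%R.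
Proof.
by move=> x y z; have := tensor_mul_bilin.1 z 1 x y; rewrite /= !scale1r.
Qed.

Let mulDr : right_distributive tensor_mul +%R.
Proof.
by move=> z x y; have := tensor_mul_bilin.2 z 1 x y; rewrite /= !scale1r.
Qed.

Let mulPl c u v y : tensor_mul (c *: u + v) y
  = c *: tensor_mul u y + tensor_mul v y.
Proof. exact: tensor_mul_bilin.1. Qed.

Let mulPr c u v x : tensor_mul x (c *: u + v)
  = c *: tensor_mul x u + tensor_mul x v.
Proof. exact: tensor_mul_bilin.2. Qed.

Let mulA : associative tensor_mul.
Proof.
move=> x y z; move: x; apply: tensor_ext => [c u v|c u v|a b] /=.
- by rewrite mulPl.
- by rewrite (mulPl c u) mulPl.
move: y; apply: tensor_ext => [c u v|c u v|a' b'] /=.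
- by rewrite (mulPl c u) mulPr.
- by rewrite (mulPr c u) mulPl.
move: z; apply: tensor_ext => [c u v|c u v|a'' b''] /=.
- by rewrite (mulPr c u) mulPr.
- by rewrite mulPr.
by rewrite !tensor_mulE !mulrA.
Qed.

Let mul1 : left_id tensor_one tensor_mul.
Proof.
apply: tensor_ext => [c u v|//|a b]; first by rewrite mulPr.
by rewrite tensor_mulE !mul1r.
Qed.

Let mulr1 : right_id tensor_one tensor_mul.
Proof.
apply: tensor_ext => [c u v|//|a b]; first by rewrite mulPl.
by rewrite tensor_mulE !mulr1.
Qed.

HB.instance Definition _ := GRing.Zmodule_isPzRing.Build (A \ox B)
  mulA mul1 mulr1 mulDl mulDr.

Lemma mul_pure_tensor (a c : A) (b d : B) :
  (a \ot b) * (c \ot d) = (a * c) \ot (b * d).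
Proof. exact: tensor_mulE. Qed.

End TensorAlgebra.

HB.mixin Record Algebra_isHopf (k : fieldType) H of GRing.Algebra k H := {
  comul : {lrmorphism H -> H \ox H};
  counit : {lrmorphism H -> k | *%R};
  antipode : {linear H -> H};
  comulA : forall h : H,
    tensor_assoc (tensor_map comul idfun (comul h))
      = tensor_map idfun comul (comul h);
  counit_comull : forall h : H, tlift (fun x y => counit x *: y) (comul h) = h;
  counit_comulr : forall h : H, tlift (fun x y => counit y *: x) (comul h) = h;
  antipode_comull : forall h : H,
    tlift (fun x y => antipode x * y) (comul h) = (counit h)%:A;
  antipode_comulr : forall h : H,
    tlift (fun x y => x * antipode y) (comul h) = (counit h)%:A
}.

#[short(type="hopfAlgType")]
HB.structure Definition HopfAlgebra (k : fieldType) :=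
  {H of GRing.Algebra k H & Algebra_isHopf k H}.

(* The law h 1 = counit h *: 1 is not required: it follows from the antipode. *)
Record moduleAlgebra (k : fieldType) (H : hopfAlgType k) (A : unitalAlgebra k) :=
  ModuleAlgebra {
    hact :> {bilinear H -> A -> A};
    hact1 : forall a, hact 1 a = a;
    hactM : forall g h a, hact (g * h) a = hact g (hact h a);
    hact_mul : forall h a b,
      hact h (a * b) = tlift (fun x y => hact x a * hact y b) (comul h)
  }.

Section Ideals.
Variable R : pzRingType.
Implicit Types I J : set R.

Definition right_ideal I : Prop :=
  [/\ I 0, forall x y, I x -> I y -> I (x + y) & forall x a, I x -> I (x * a)].

Definition two_sided_ideal I : Prop :=
  right_ideal I /\ forall a x, I x -> I (a * x).

Definition right_noetherian : Prop :=
  forall I : nat -> set R, (forall n, right_ideal (I n)) ->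
    (forall n, I n `<=` I n.+1) ->
    exists N, forall n, (N <= n)%N -> I n = I N.

Definition right_artinian : Prop :=
  forall I : nat -> set R, (forall n, right_ideal (I n)) ->
    (forall n, I n.+1 `<=` I n) ->
    exists N, forall n, (N <= n)%N -> I n = I N.

Definition ideal_mul I J : set R :=
  [set z | exists2 s : seq (R * R), (forall p, p \in s -> I p.1 /\ J p.2)
                                  & z = \sum_(p <- s) p.1 * p.2].

Definition ideal_exp I (n : nat) : set R := iter n (ideal_mul I) setT.

Definition nilpotent_ideal I : Prop := exists n, ideal_exp I n = [set 0].

Definition regular (s : R) : Prop :=
  (forall x, x * s = 0 -> x = 0) /\ (forall x, s * x = 0 -> x = 0).

End Ideals.

Definition two_sided_inverse (Q : pzRingType) (q q' : Q) : Prop :=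
  q * q' = 1 /\ q' * q = 1.

(* R is a subring of Q by way of the embedding i. *)
Definition classical_right_quotient_ring (R Q : pzRingType)
    (i : {rmorphism R -> Q}) : Prop :=
  [/\ injective i,
      forall s, regular s -> exists t, two_sided_inverse (i s) t
    & forall q, exists a s t,
        [/\ regular s, two_sided_inverse (i s) t & q = i a * t]].

Definition finite_dimensional (k : fieldType) (V : lmodType k) (W : set V) :
    Prop :=
  exists n (e : 'I_n -> V),
    W = [set v | exists c : 'I_n -> k, v = \sum_i c i *: e i].

Section Action.
Variables (k : fieldType) (H : hopfAlgType k) (A : unitalAlgebra k).
Variable act : moduleAlgebra H A.

Definition H_stable (I : set A) : Prop := forall h a, I a -> I (act h a).

Definition H_semiprime : Prop :=
  forall I : set A, two_sided_ideal I -> H_stable I -> nilpotent_ideal I ->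
    I = [set 0].

Definition locally_finite_action : Prop :=
  forall a : A, finite_dimensional [set act h a | h in setT].

End Action.

(* Main.v *)
From HB Require Import structures.
Require Import Defs.
From mathcomp Require Import all_boot all_algebra.
From mathcomp Require Import boolp classical_sets.

Set Implicit Arguments.
Unset Strict Implicit.
Unset Printing Implicit Defensive.

Import GRing.Theory.
Local Open Scope ring_scope.
Local Open Scope classical_set_scope.

(** Why the theorem holds. Let R be the right noetherian ring A, N its largest
    nilpotent ideal and C the set of elements which are left cancellable modulo
    N. Goldie's theory modulo N gives the right Ore condition for C modulo N and
    the finiteness of the rank. By the argument of Small
    ([artinian_quotient_ring]) the quotient ring exists and is right artinian as
    soon as R has no nonzero right ideal whose elements are all killed on the
    right by elements of C, and c x = 0 implies x = 0 for c in C.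

    Semiprimeness is used through one principle ([core0]): an element whose orbit
    under H stays in N is zero, because such elements form a nilpotent H-stable
    ideal. The torsion right ideal lies in N and is H-stable, hence zero
    ([act_torsion_free]). For the second condition take c0 in C, let J be its
    right annihilator and E = HJ, an H-stable right ideal. It suffices to prove
    that E is contained in N ([coordinates_sub_N]), since then J = 0.

    A comatrix t in H (a finite family of elements comultiplying like matrix
    entries) defines an exact functor Phi on right modules which sends V to V^d
    with R acting through the matrix of operators t_ij, and Phi R is free of rank
    d. Additive rank functions can be composed with Phi. Let alpha_0 be the rank
    in which both C-torsion modules and modules killed by E are negligible, and
    let alpha_n be alpha_0 composed with the n-th iterate of Phi, so that
    alpha_n(R) = d^n alpha_0(R). Choose a chain of two-sided ideals from R
    through N down to 0 each layer Z / Z' of which is either good (elements of C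
    act on it injectively from the left) or bad (it is killed from the left by
    an ideal meeting C), and let b_n be the total alpha_n-rank of the bad layers.
    If c in C multiplies a submodule W of Phi R from the left into W', then
    W / W' is accounted for by the bad layers ([layersum_bad]), as the good ones
    contribute no more to W than to W'. In Phi R this applies to the d-fold copy of
    every bad layer, and to J^d, which is killed by c0. With y_n the contribution
    of J^d modulo the d-fold copy of N this reads
    b_(n+1) >= d b_n + y_n ([badsum_step]).
    On the other hand E is a sum of coordinates of J^d, and modules killed by E
    have no rank, so that alpha_n(R) is at most a constant times y_n. If
    alpha_0(R) were not zero, b_n / d^n would then grow linearly, although it is
    at most alpha_0(R). So alpha_0(R) = 0, and this forces E into N.

    Local finiteness enters when E is written with coordinates of J^d: for the
    twist at hand these are the operators S(t_ij), S the antipode, and local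
    finiteness gives H x = S(H) x for every x ([antipode_surj]), although S need
    not be surjective. The remaining Hopf algebra input is that every finite set
    of elements lies in the span of a comatrix ([exists_comatrix]) and that S
    reverses products ([antipodeM]), proved by comparing inverses of matrices. *)

(** * Right modules and their submodules *)

(** The action is bundled with the carrier because one carrier will receive
    several of them: twisting gives V^d a module structure other than the
    componentwise one. *)
Record rmod (R : pzRingType) := RMod {
  rmod_car :> zmodType;
  ract : rmod_car -> R -> rmod_car;
  ractDl : forall x y a, ract (x + y) a = ract x a + ract y a;
  ractDr : forall x a b, ract x (a + b) = ract x a + ract x b;
  ractM : forall x a b, ract x (a * b) = ract (ract x a) b;
  ract1 : forall x, ract x 1 = x
}.

Notation "x ** a" := (ract x a) (at level 40, left associativity).

Section Modules.
Variable R : pzRingType.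
Implicit Types (V W : rmod R) (a : R).

Lemma ract0l V a : (0 : V) ** a = 0.
Proof. by apply: (addIr ((0 : V) ** a)); rewrite -ractDl !add0r. Qed.

Lemma ractr0 V (x : V) : x ** 0 = 0.
Proof. by apply: (addIr (x ** 0)); rewrite -ractDr !add0r. Qed.

Lemma ractN1 V (x : V) : x ** (-1) = - x.
Proof. by apply: (addIr x); rewrite -{2}[x]ract1 -ractDr !addNr ractr0. Qed.

Lemma ract_suml V (I : Type) (r : seq I) (P : pred I) (F : I -> V) a :
  (\sum_(i <- r | P i) F i) ** a = \sum_(i <- r | P i) F i ** a.
Proof.
exact: (big_morph (fun x => x ** a) (fun x y => ractDl x y a) (ract0l V a)).
Qed.

Lemma ract_sumr V (I : Type) (r : seq I) (P : pred I) (F : I -> R) (x : V) :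
  x ** (\sum_(i <- r | P i) F i) = \sum_(i <- r | P i) x ** F i.
Proof. exact: (big_morph (fun a => x ** a) (ractDr x) (ractr0 x)). Qed.

Definition submod V (L : set V) : Prop :=
  [/\ L 0, forall x y, L x -> L y -> L (x + y) & forall x a, L x -> L (x ** a)].

Lemma submodN V (L : set V) x : submod L -> L x -> L (- x).
Proof. by case=> _ _ Lm Lx; rewrite -ractN1; exact: Lm. Qed.

Lemma submodB V (L : set V) x y : submod L -> L x -> L y -> L (x - y).
Proof. by move=> sL Lx Ly; case: (sL) => _ LD _; exact: LD Lx (submodN sL Ly). Qed.

Lemma submod_sum V (L : set V) (I : Type) (r : seq I) (P : pred I) (F : I -> V) :
  submod L -> (forall i, P i -> L (F i)) -> L (\sum_(i <- r | P i) F i).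
Proof. by case=> L0 LD _ LF; apply: big_ind. Qed.

Lemma submod0 V : submod [set (0 : V)].
Proof.
by split=> [|x y /= -> ->|x a /= ->]; rewrite ?addr0 ?ract0l.
Qed.

Lemma submodT V : submod [set: V]. Proof. by split. Qed.

Lemma submodI V (L M : set V) : submod L -> submod M -> submod (L `&` M).
Proof.
case=> L0 LD Lm [M0 MD Mm]; split=> [//|x y [? ?] [? ?]|x a [? ?]].
  by split; [apply: LD | apply: MD].
by split; [apply: Lm | apply: Mm].
Qed.

Definition addm V (L M : set V) : set V :=
  [set x | exists y z, [/\ L y, M z & x = y + z]].

Lemma submod_addm V (L M : set V) : submod L -> submod M -> submod (addm L M).
Proof.
case=> L0 LD Lm [M0 MD Mm]; split.
- by exists 0, 0; rewrite addr0.
- move=> _ _ [y [z [Ly Mz ->]]] [y' [z' [Ly' Mz' ->]]].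
  by exists (y + y'), (z + z'); rewrite addrACA; split=> //; [exact: LD | exact: MD].
move=> _ a [y [z [Ly Mz ->]]]; exists (y ** a), (z ** a).
by rewrite ractDl; split=> //; [exact: Lm | exact: Mm].
Qed.

Lemma addml V (L M : set V) : submod M -> L `<=` addm L M.
Proof. by case=> M0 _ _ x Lx; exists x, 0; rewrite addr0. Qed.

Lemma addmr V (L M : set V) : submod L -> M `<=` addm L M.
Proof. by case=> L0 _ _ x Lx; exists 0, x; rewrite add0r. Qed.

Lemma addm_sub V (L M K : set V) :
  submod K -> L `<=` K -> M `<=` K -> addm L M `<=` K.
Proof. by case=> _ KD _ LK MK _ [y [z [/LK Ky /MK Kz ->]]]; exact: KD. Qed.

Lemma addmS V (L L' M M' : set V) :
  L `<=` L' -> M `<=` M' -> addm L M `<=` addm L' M'.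
Proof. by move=> LL' MM' _ [y [z [/LL' Ly /MM' Mz ->]]]; exists y, z. Qed.

Definition cyc V (v : V) : set V := [set v ** a | a in [set: R]].

Lemma submod_cyc V (v : V) : submod (cyc v).
Proof.
split=> [|_ _ [a _ <-] [b _ <-]|_ b [a _ <-]].
- by exists 0; rewrite // ractr0.
- by exists (a + b); rewrite // ractDr.
- by exists (a * b); rewrite // ractM.
Qed.

Lemma mem_cyc V (v : V) : cyc v v.
Proof. by exists 1; rewrite // ract1. Qed.

Lemma cyc_sub V (v : V) (L : set V) : submod L -> L v -> cyc v `<=` L.
Proof. by case=> _ _ Lm Lv _ [a _ <-]; exact: Lm. Qed.

Definition spn V (s : seq V) : set V :=
  foldr (fun v L => addm (cyc v) L) [set 0] s.

Lemma submod_spn V (s : seq V) : submod (spn s).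
Proof.
elim: s => [|v s IHs] /=; first exact: submod0.
exact: submod_addm (submod_cyc v) IHs.
Qed.

Lemma mem_spn V (s : seq V) v : v \in s -> spn s v.
Proof.
elim: s => [//|w s IHs] /=; rewrite inE => /orP[/eqP->|/IHs vs].
  exact: (addml (submod_spn s) (mem_cyc w)).
exact: (addmr (submod_cyc w)).
Qed.

Lemma spn_sub V (s : seq V) (L : set V) :
  submod L -> (forall v, v \in s -> L v) -> spn s `<=` L.
Proof.
move=> sL; elim: s => [_ _ ->|v s IHs Ls] /=; first by case: sL.
apply: addm_sub => //; last by apply: IHs => w ws; apply: Ls; rewrite inE ws orbT.
by apply: cyc_sub => //; apply: Ls; rewrite inE eqxx.
Qed.

Definition fg V : Prop := exists s : seq V, spn s = setT.

Definition rlinear V W (f : V -> W) : Prop :=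
  (forall x y, f (x + y) = f x + f y) /\ (forall x a, f (x ** a) = f x ** a).

Lemma rlinear0 V W (f : V -> W) : rlinear f -> f 0 = 0.
Proof. by case=> fD _; apply: (addIr (f 0)); rewrite -fD !add0r. Qed.

Lemma rlinearB V W (f : V -> W) x y : rlinear f -> f (x - y) = f x - f y.
Proof. by case=> fD fm; rewrite fD -ractN1 fm ractN1. Qed.

Lemma submod_image V W (f : V -> W) (L : set V) :
  rlinear f -> submod L -> submod (f @` L).
Proof.
move=> fl; have [fD fm] := fl; case=> L0 LD Lm; split.
- by exists 0 => //; exact: rlinear0.
- by move=> _ _ [x Lx <-] [y Ly <-]; exists (x + y); [exact: LD | rewrite fD].
- by move=> _ a [x Lx <-]; exists (x ** a); [exact: Lm | rewrite fm].
Qed.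

Lemma submod_preimage V W (f : V -> W) (L : set W) :
  rlinear f -> submod L -> submod (f @^-1` L).
Proof.
move=> fl; have [fD fm] := fl; case=> L0 LD Lm; split.
- by rewrite /= rlinear0.
- by move=> x y /= Lx Ly; rewrite fD; exact: LD.
- by move=> x a /= Lx; rewrite fm; exact: Lm.
Qed.

Definition regm : rmod R := @RMod R R (fun x a => x * a)
  (fun x y a => mulrDl x y a) (fun x a b => mulrDr x a b) (fun x a b => mulrA x a b)
  (fun x => mulr1 x).

Lemma regmE (x : regm) (a : R) : x ** a = (x : R) * a. Proof. by []. Qed.

Lemma fg_regm : fg regm.
Proof.
exists [:: (1 : R)]; apply/seteqP; split=> // x _.
exists x, 0; split=> //; last by rewrite addr0.
by exists x => //; exact: mul1r.
Qed.

Lemma rlinear_ract V (v : V) : rlinear (fun a : regm => v ** a).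
Proof. by split=> [x y|x a]; [exact: ractDr | exact: ractM]. Qed.

(** * Torsion and lengths of chains *)

Section Torsion.
Variables C E : set R.

(** A subquotient is given by two subsets L' and L of an ambient module, and
    stands for L / (L' meet L). It is torsion when it is an iterated extension of
    modules in which every element is killed by an element of C and of modules
    killed by E. In the application C consists of the elements cancellable modulo
    the radical and E is the right ideal to be shown small. *)
Inductive tors V : set V -> set V -> Prop :=
| TorsC L' L : (forall x, L x -> exists2 c, C c & L' (x ** c)) -> tors L' L
| TorsE L' L : (forall x a e, L x -> E e -> L' (x ** a ** e)) -> tors L' L
| TorsT L' M L : tors L' M -> tors M L -> tors L' L.

Lemma tors_mono V (K' K L' L : set V) :
  K' `<=` L' -> L `<=` K -> tors K' K -> tors L' L.
Proof.
move=> + + H; elim: H L' L => {K' K}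
  [K' K H|K' K H|K' M K _ IH1 _ IH2] L' L KL' LK.
- by apply: TorsC => x /LK/H[c Cc /KL' ?]; exists c.
- by apply: TorsE => x a e /LK Kx Ee; exact/KL'/H.
- by apply: (@TorsT _ _ M); [exact: IH1 | exact: IH2].
Qed.

Lemma tors_addr V (L' L K : set V) :
  submod K -> tors L' L -> tors (addm L' K) (addm L K).
Proof.
move=> [_ _ Km]; elim=> {L' L} [L' L H|L' L H|L' M L _ IH1 _ IH2].
- apply: TorsC => _ [y [z [/H[c Cc L'y] Kz ->]]]; exists c => //.
  by exists (y ** c), (z ** c); rewrite ractDl; split=> //; apply: Km.
- apply: TorsE => _ a e [y [z [Ly Kz ->]]] Ee.
  exists (y ** a ** e), (z ** a ** e); rewrite !ractDl.
  by split=> //; [exact: H | exact: Km _ _ (Km _ _ Kz)].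
- exact: TorsT IH1 IH2.
Qed.

Lemma tors_capr V (L' L K : set V) :
  submod K -> tors L' L -> tors (L' `&` K) (L `&` K).
Proof.
move=> [_ _ Km]; elim=> {L' L} [L' L H|L' L H|L' M L _ IH1 _ IH2].
- by apply: TorsC => x [/H[c Cc L'y] Kz]; exists c => //; split=> //; exact: Km.
- by apply: TorsE => x a e [Lx Kx] Ee; split; [exact: H | exact: Km _ _ (Km _ _ Kx)].
- exact: TorsT IH1 IH2.
Qed.

Lemma tors_image V W (f : V -> W) (L' L : set V) :
  rlinear f -> tors L' L -> tors (f @` L') (f @` L).
Proof.
move=> [_ fm]; elim=> {L' L} [L' L H|L' L H|L' M L _ IH1 _ IH2].
- apply: TorsC => _ [x /H[c Cc L'x] <-]; exists c => //.
  by exists (x ** c); rewrite ?fm.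
- apply: TorsE => _ a e [x Lx <-] Ee; exists (x ** a ** e); rewrite ?fm //.
  exact: H.
- exact: TorsT IH1 IH2.
Qed.

Lemma tors_preimage V W (f : V -> W) (L' L : set W) :
  rlinear f -> tors L' L -> tors (f @^-1` L') (f @^-1` L).
Proof.
move=> [_ fm]; elim=> {L' L} [L' L H|L' L H|L' M L _ IH1 _ IH2].
- by apply: TorsC => x /= /H[c Cc L'x]; exists c; rewrite //= fm.
- by apply: TorsE => x a e Lx Ee /=; rewrite !fm; exact: H.
- exact: TorsT IH1 IH2.
Qed.

Lemma tors_id V (L' L : set V) : C 1 -> L `<=` L' -> tors L' L.
Proof. by move=> C1 LL'; apply: TorsC => x /LL' Lx; exists 1; rewrite ?ract1. Qed.

Lemma tors_addl V (P L : set V) :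
  submod P -> tors P L -> tors P (addm L P).
Proof.
move=> sP /(tors_addr sP); apply: tors_mono => //.
by apply: addm_sub.
Qed.

(** Heights of chains from L' to L with non-torsion steps. Counting such chains
    instead of composing uniform dimensions yields an additive rank without any
    localization. *)
Inductive ht V (L' : set V) : nat -> set V -> Prop :=
| Ht0 L : L' `<=` L -> ht L' 0 L
| HtS n M L : submod M -> M `<=` L -> ht L' n M -> ~ tors M L -> ht L' n.+1 L.

Lemma ht_sub V (L' L : set V) n : ht L' n L -> L' `<=` L.
Proof. by elim=> // {}n M {}L _ ML _ L'M _; exact: subset_trans ML. Qed.

Lemma ht_inv V (L' L : set V) n : ht L' n.+1 L ->
  exists M, [/\ submod M, M `<=` L, ht L' n M & ~ tors M L].
Proof.
by move=> H; inversion H as [|n' M L0 sM ML HM nt]; exists M.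
Qed.

Lemma ht_top V (L' M L : set V) n : M `<=` L -> ht L' n M -> ht L' n L.
Proof.
move=> ML H; case: H ML => [{}M L'M|{}n K {}M sK KM HK nt] ML.
  by apply: Ht0; exact: subset_trans ML.
apply: (@HtS _ _ _ K) => //; first exact: subset_trans ML.
by move=> t; apply: nt; apply: tors_mono t.
Qed.

Lemma ht_bot V (L'' L' L : set V) n : L'' `<=` L' -> ht L' n L -> ht L'' n L.
Proof.
move=> L''L'; elim=> [M L'M|{}n M {}L sM ML _ IH nt].
  by apply: Ht0; exact: subset_trans L'M.
exact: (HtS sM ML IH nt).
Qed.

Lemma ht_cat V (L'' L' L : set V) m n :
  ht L'' m L' -> ht L' n L -> ht L'' (m + n) L.
Proof.
move=> H; elim=> [M L'M|{}n M {}L sM ML _ IH nt]; first by rewrite addn0; exact: ht_top H.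
by rewrite addnS; exact: (HtS sM ML IH nt).
Qed.

(** Each step of a chain in L survives in the intersection with K or in the sum
    with K, since a step torsion in both is torsion: this is one half of the
    additivity of the rank. *)
Lemma ht_split V (L'' K L : set V) n :
  submod K -> submod L -> L'' `<=` K -> ht L'' n L ->
  exists p q, [/\ ht L'' p (L `&` K), ht K q (addm L K) & (n <= p + q)%N].
Proof.
move=> sK sL L''K H; elim: H sL => {n L} [L L''L|n M L sM ML _ IH nt] sL.
  exists 0, 0; split=> //; first by apply: Ht0 => x Lx; split; [exact: L''L|exact: L''K].
  by apply: Ht0; exact: addmr.
have [p [q [Hp Hq npq]]] := IH sM.
have [t1|nt1] := pselect (tors (M `&` K) (L `&` K)); last first.
  exists p.+1, q; split; last by rewrite addSn.
    apply: (HtS _ _ Hp nt1); first exact: submodI.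
    by move=> x [/ML ? ?].
  by apply: ht_top Hq; exact: addmS.
have [t2|nt2] := pselect (tors (addm M K) (addm L K)); last first.
  exists p, q.+1; split; last by rewrite addnS.
    by apply: ht_top Hp => x [/ML ? ?].
  by apply: (HtS _ _ Hq nt2); [exact: submod_addm | exact: addmS].
case: nt.
apply: (@TorsT _ _ (addm (L `&` K) M)).
  apply: (tors_mono _ _ (tors_addr sM t1)) => //.
  by apply: addm_sub => // x [].
apply: (tors_mono _ _ (tors_capr sL t2)).
  move=> _ [[m [k [Mm Kk ->]]] Lmk]; exists k, m; rewrite addrC; split=> //; split=> //.
  by rewrite -[k](addKr m) addrC; apply: submodB => //; exact: ML.
by move=> x Lx; split=> //; exact: addml.
Qed.

(** Pulling a chain back along a map which is onto modulo M' keeps its steps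
    non-torsion, because a torsion step upstairs has a torsion image. *)
Lemma ht_surj V W (f : V -> W) (L' L : set V) (M' M : set W) n :
  rlinear f -> submod L -> submod M' -> submod M -> 
  f @` L' `<=` M' -> L' `<=` L -> M `<=` addm (f @` L) M' ->
  ht M' n M -> ht L' n L.
Proof.
move=> fl sL sM' sM fL' L'L Mf H.
suff: ht L' n (L `&` f @^-1` M) by apply: ht_top => x [].
elim: H sM Mf => {n M} [M M'M|n P M sP PM HP IH nt] sM Mf.
  by apply: Ht0 => x Lx; split; [exact: L'L | apply/M'M/fL'; exists x].
have Pf : P `<=` addm (f @` L) M' by exact: subset_trans Mf.
have M'P := ht_sub HP.
apply: (HtS _ _ (IH sP Pf)) => [||t].
- by apply: submodI => //; exact: submod_preimage.
- by move=> x [Lx Px]; split=> //; exact: PM.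
apply: nt; have t1 : tors P (f @` (L `&` f @^-1` M)).
  by apply: tors_mono (tors_image fl t) => // _ [x [_ Px] <-].
apply: (tors_mono _ _ (tors_addl sP t1)) => //.
move=> y My; have [_ [m [[x Lx <-] Mm def_y]]] := Mf y My.
exists (f x), m; split=> //; last exact: M'P.
exists x => //; split=> //=.
by rewrite -(addrK m (f x)) -def_y; apply: submodB => //; exact/PM/M'P.
Qed.

(** Pushing a chain forward along a map injective modulo L' keeps its steps
    non-torsion, because their preimages are the original steps. *)
Lemma ht_inj V W (f : V -> W) (L' L : set V) (M' M : set W) n :
  rlinear f -> submod L' -> submod L -> submod M' -> submod M ->
  f @` L `<=` M -> M' `<=` M -> (forall x, L x -> M' (f x) -> L' x) ->
  ht L' n L -> ht M' n M.
Proof.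
move=> fl sL' sL sM' sM fL M'M inj H.
suff: ht M' n (addm (f @` L) M') by apply: ht_top; exact: addm_sub.
elim: H sL fL inj => {n L} [L L'L|n P L sP PL HP IH nt] sL fL inj.
  by apply: Ht0; apply: addmr; exact: submod_image.
have fP : f @` P `<=` M by move=> _ [x /PL Lx <-]; apply: fL; exists x.
have injP x : P x -> M' (f x) -> L' x by move=> /PL; exact: inj.
apply: (HtS _ _ (IH sP fP injP)) => [||t].
- by apply: submod_addm => //; exact: submod_image.
- by apply: addmS => // _ [x /PL Lx <-]; exists x.
apply: nt; apply: (tors_mono _ _ (tors_capr sL (tors_preimage fl t))).
  move=> x [[_ [m [[p Pp <-] Mm def_fx]]] Lx].
  rewrite -[x](subrK p); case: (sP) => _ PD _; apply: PD => //.
  apply: (ht_sub HP); apply: inj; first by apply: submodB => //; exact: PL.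
  by rewrite rlinearB // def_fx addrC addKr.
by move=> x Lx; split=> //; apply: addml => //; exists x.
Qed.

Definition bounded V (L' L : set V) : Prop :=
  exists b, forall n, ht L' n L -> (n <= b)%N.

Lemma bounded_cat V (L'' L' L : set V) :
  submod L' -> submod L -> L'' `<=` L' -> L' `<=` L ->
  bounded L'' L' -> bounded L' L -> bounded L'' L.
Proof.
move=> sL' sL L''L' L'L [b Hb] [b' Hb']; exists (b + b')%N => n H.
have [p [q [Hp Hq npq]]] := ht_split sL' sL L''L' H.
apply: (leq_trans npq); apply: leq_add.
  by apply: Hb; apply: ht_top Hp => x [].
by apply: Hb'; apply: ht_top Hq; exact: addm_sub.
Qed.

Lemma bounded_sub V (L'' L' L M : set V) :
  L'' `<=` L' -> L `<=` M -> bounded L'' M -> bounded L' L.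
Proof.
move=> L''L' LM [b Hb]; exists b => n /(ht_bot L''L')/(ht_top LM); exact: Hb.
Qed.

Lemma bounded_tors V (L' L : set V) : tors L' L -> bounded L' L.
Proof.
move=> t; exists 0%N => -[//|n] H.
have [M [_ _ HM []]] := ht_inv H.
exact: tors_mono (ht_sub HM) _ t.
Qed.

Lemma bounded_cyc V (v : V) (M : set V) : submod M ->
  bounded [set (0 : regm)] setT -> bounded M (addm (cyc v) M).
Proof.
move=> sM [b Hb]; exists b => n H; apply: Hb.
have fl := rlinear_ract v.
have sP := submod_preimage fl sM.
apply: (ht_bot (L' := (fun a : regm => v ** a) @^-1` M)).
  by move=> _ ->; case: sP.
apply: (ht_surj fl (submodT _) sM (submod_addm (submod_cyc v) sM)) H => //.
by move=> _ [a Ma <-].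
Qed.

Lemma bounded_fg V : C 1 -> bounded [set (0 : regm)] setT -> fg V ->
  bounded [set (0 : V)] setT.
Proof.
move=> C1 bR [s <-]; elim: s => [|v s IHs] /=; first exact/bounded_tors/tors_id.
apply: bounded_cat (IHs) (bounded_cyc v (submod_spn s) bR).
- exact: submod_spn.
- exact: submod_addm (submod_cyc v) (submod_spn s).
- by move=> _ ->; case: (submod_spn s).
- exact/addmr/submod_cyc.
Qed.

(** The maximal height; 0 is a junk value when heights are unbounded. *)
Definition rk V (L' L : set V) : nat :=
  match pselect (exists k, ht L' k L /\ forall n, ht L' n L -> (n <= k)%N) with
  | left H => sval (cid H)
  | right _ => 0
  end.

Lemma rkP V (L' L : set V) : L' `<=` L -> bounded L' L ->
  ht L' (rk L' L) L /\ forall n, ht L' n L -> (n <= rk L' L)%N.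
Proof.
move=> L'L [b Hb]; rewrite /rk; case: pselect => [H|[]]; first exact: (svalP (cid H)).
have exP : exists n, (fun n => `[< ht L' n L >]) n by exists 0; apply/asboolP; exact: Ht0.
have leP n : (fun n => `[< ht L' n L >]) n -> (n <= b)%N by move=> /asboolP/Hb.
case: (ex_maxnP exP leP) => k /asboolP Hk mk; exists k; split=> // n Hn.
by apply: mk; apply/asboolP.
Qed.

Lemma rk_tors V (L' L : set V) : tors L' L -> rk L' L = 0%N.
Proof.
move=> t; rewrite /rk; case: pselect => // H; case: (cid H) => /= k [Hk _].
case: k Hk => // n /ht_inv[M [_ _ HM []]].
exact: tors_mono (ht_sub HM) _ t.
Qed.

Lemma tors_rk V (L' L : set V) : submod L' -> L' `<=` L -> bounded L' L ->
  rk L' L = 0%N -> tors L' L.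
Proof.
move=> sL' L'L bL rk0; apply: contrapT => nt.
have [_ /(_ 1%N)] := rkP L'L bL; rewrite rk0 => H.
have: (1 <= 0)%N by apply: H; apply: (HtS sL' L'L _ nt); exact: Ht0.
by [].
Qed.

End Torsion.

(** * Rank functions *)

(** Additive functions on subquotients of finitely generated modules which grow
    along embeddings ([rf_inj]) and shrink along surjections ([rf_surj]) of
    subquotients. Abstracting these properties allows to replace a rank by its
    composition with a functor, and to do so repeatedly. *)
Record rankfun := RankFun {
  rf : forall V : rmod R, set V -> set V -> nat;
  rf_add : forall V (L'' L' L : set V), fg V ->
    submod L'' -> submod L' -> submod L -> L'' `<=` L' -> L' `<=` L ->
    rf L'' L = (rf L'' L' + rf L' L)%N;
  rf_inj : forall V W (f : V -> W) (L' L : set V) (M' M : set W),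
    rlinear f -> fg V -> fg W ->
    submod L' -> submod L -> submod M' -> submod M -> L' `<=` L -> M' `<=` M ->
    f @` L `<=` M -> (forall x, L x -> M' (f x) -> L' x) ->
    (rf L' L <= rf M' M)%N;
  rf_surj : forall V W (f : V -> W) (L' L : set V) (M' M : set W),
    rlinear f -> fg V -> fg W ->
    submod L' -> submod L -> submod M' -> submod M -> L' `<=` L -> M' `<=` M ->
    f @` L' `<=` M' -> M `<=` addm (f @` L) M' ->
    (rf M' M <= rf L' L)%N
}.

Section LengthRank.
Variables C E : set R.
Hypothesis C1 : C 1.
Hypothesis bR : bounded C E [set (0 : regm)] setT.

Lemma bounded_in V (L' L : set V) : fg V -> submod L' -> bounded C E L' L.
Proof.
move=> fV [L'0 _ _]; apply: bounded_sub (bounded_fg C1 bR fV) => //.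
by move=> _ ->.
Qed.

Lemma rk_add V (L'' L' L : set V) : fg V ->
    submod L'' -> submod L' -> submod L -> L'' `<=` L' -> L' `<=` L ->
  rk C E L'' L = (rk C E L'' L' + rk C E L' L)%N.
Proof.
move=> fV sL'' sL' sL L''L' L'L.
have [H1 m1] := rkP L''L' (bounded_in L' fV sL'').
have [H2 m2] := rkP L'L (bounded_in L fV sL').
have [H m] := rkP (subset_trans L''L' L'L) (bounded_in L fV sL'').
apply/eqP; rewrite eqn_leq; apply/andP; split; last exact/m/(ht_cat H1 H2).
have [p [q [Hp Hq /leq_trans]]] := ht_split sL' sL L''L' H; apply.
apply: leq_add; first by apply: m1; apply: ht_top Hp => x [].
by apply: m2; apply: ht_top Hq; exact: addm_sub.
Qed.

Definition length_rank : rankfun.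
Proof.
apply: (@RankFun (@rk C E)) => [|V W f L' L M' M fl fV fW sL' sL sM' sM L'L M'M fL H
                       |V W f L' L M' M fl fV fW sL' sL sM' sM L'L M'M fL' H].
- exact: rk_add.
- have [H1 _] := rkP L'L (bounded_in L fV sL').
  have [_ m2] := rkP M'M (bounded_in M fW sM').
  by apply: m2; exact: ht_inj H H1.
have [_ m1] := rkP L'L (bounded_in L fV sL').
have [H2 _] := rkP M'M (bounded_in M fW sM').
by apply: m1; exact: ht_surj H H2.
Defined.

End LengthRank.

Section RankTheory.
Variable r : rankfun.

Lemma rf_id V (L : set V) : fg V -> submod L -> rf r L L = 0%N.
Proof.
move=> fV sL; apply/eqP; rewrite -(eqn_add2l (rf r L L)) addn0 eq_sym.
by apply/eqP; exact: rf_add.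
Qed.

Lemma rf_le V (L' L M' M : set V) : fg V ->
    submod L' -> submod L -> submod M' -> submod M -> L' `<=` L -> M' `<=` M ->
    L `<=` M -> (forall x, L x -> M' x -> L' x) -> (rf r L' L <= rf r M' M)%N.
Proof.
move=> fV sL' sL sM' sM L'L M'M LM H; apply: (@rf_inj r _ _ id) => //.
by move=> _ [x /LM Mx <-].
Qed.

Lemma rf_ge V (L' L M' M : set V) : fg V ->
    submod L' -> submod L -> submod M' -> submod M -> L' `<=` L -> M' `<=` M ->
    L' `<=` M' -> M `<=` addm L M' -> (rf r M' M <= rf r L' L)%N.
Proof.
move=> fV sL' sL sM' sM L'L M'M LM H; apply: (@rf_surj r _ _ id) => //.
  by move=> _ [x /LM Mx <-].
by move=> x /H[y [z [Ly Mz ->]]]; exists y, z; split=> //; exists y.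
Qed.

End RankTheory.

(** * Twists *)

(** Both [itw] and the transpose of [tw] are ring morphisms from R to the d by d
    matrices over R; [twK] and [itwK] say that the matrices of operators [tw] and
    [itw] are inverse to each other. A comatrix of a Hopf algebra acting on R
    provides such data, one matrix being the image of the other by the
    antipode. *)
Record twist := Twist {
  td : nat;
  tw : 'I_td -> 'I_td -> R -> R;
  itw : 'I_td -> 'I_td -> R -> R;
  twD : forall i j a b, tw i j (a + b) = tw i j a + tw i j b;
  itwD : forall i j a b, itw i j (a + b) = itw i j a + itw i j b;
  tw1 : forall i j, tw i j 1 = 1 *+ (i == j);
  twM : forall k j a b, tw k j (a * b) = \sum_i tw i j a * tw k i b;
  itwM : forall i j a b, itw i j (a * b) = \sum_k itw i k a * itw k j b;
  twK : forall i j a, \sum_k itw i k (tw k j a) = a *+ (i == j);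
  itwK : forall i j a, \sum_k tw i k (itw k j a) = a *+ (i == j)
}.

Lemma sum_delta (V : zmodType) n (F : 'I_n -> V) i :
  \sum_j F j *+ (i == j) = F i.
Proof.
rewrite (bigD1 i) //= eqxx big1 ?addr0 // => j /negbTE; rewrite eq_sym => ->.
by [].
Qed.

Section Twist.
Variable t : twist.
Notation d := (td t).

Lemma tw0 i j : tw (t := t) i j 0 = 0.
Proof. by apply: (addIr (tw i j 0)); rewrite -twD !add0r. Qed.

Lemma itw0 i j : itw (t := t) i j 0 = 0.
Proof. by apply: (addIr (itw i j 0)); rewrite -itwD !add0r. Qed.

Lemma itw_sum i j (I : Type) (r : seq I) (P : pred I) (F : I -> R) :
  itw (t := t) i j (\sum_(x <- r | P x) F x) = \sum_(x <- r | P x) itw i j (F x).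
Proof. exact: (big_morph _ (itwD (t := t) i j) (itw0 i j)). Qed.

Lemma tw_sum i j (I : Type) (r : seq I) (P : pred I) (F : I -> R) :
  tw (t := t) i j (\sum_(x <- r | P x) F x) = \sum_(x <- r | P x) tw i j (F x).
Proof. exact: (big_morph _ (twD (t := t) i j) (tw0 i j)). Qed.

Section TwistModule.
Variable V : rmod R.

Definition twact (m : {ffun 'I_d -> V}) a : {ffun 'I_d -> V} :=
  [ffun i => \sum_j m j ** tw i j a].

Lemma twactDl m m' a : twact (m + m') a = twact m a + twact m' a.
Proof.
apply/ffunP => i; rewrite !ffunE -big_split; apply: eq_bigr => j _.
by rewrite ffunE ractDl.
Qed.

Lemma twactDr m a b : twact m (a + b) = twact m a + twact m b.
Proof.
apply/ffunP => i; rewrite !ffunE -big_split; apply: eq_bigr => j _.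
by rewrite twD ractDr.
Qed.

Lemma twactM m a b : twact m (a * b) = twact (twact m a) b.
Proof.
apply/ffunP => i; rewrite !ffunE.
transitivity (\sum_j \sum_k m j ** tw k j a ** tw i k b).
  by apply: eq_bigr => j _; rewrite twM ract_sumr; apply: eq_bigr => k _; rewrite ractM.
rewrite exchange_big; apply: eq_bigr => k _; rewrite ffunE ract_suml.
by apply: eq_bigr.
Qed.

Lemma twact1 m : twact m 1 = m.
Proof.
apply/ffunP => i; rewrite ffunE -[RHS](sum_delta (fun j => m j)).
by apply: eq_bigr => j _; rewrite tw1; case: (i == j); rewrite ?ract1 ?ractr0.
Qed.

Definition twm : rmod R := RMod twactDl twactDr twactM twact1.

(** The value of the twisting functor on a submodule. *)
Definition tws (L : set V) : set twm := [set m : twm | forall i, L (m i)].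

Lemma submod_tws (L : set V) : submod L -> submod (tws L).
Proof.
move=> sL; case: (sL) => L0 LD Lm; split=> [i|x y Lx Ly i|x a Lx i].
- by rewrite ffunE.
- by rewrite ffunE; exact: LD.
- by rewrite ffunE; apply: submod_sum => // j _; exact: Lm.
Qed.

Definition twdelta (i : 'I_d) (v : V) : twm := [ffun j => v *+ (i == j)].

Lemma twdelta_sum (m : twm) : m = \sum_i twdelta i (m i).
Proof.
apply/ffunP => j; rewrite sum_ffunE -[LHS](sum_delta (fun i => m i)).
by apply: eq_bigr => i _; rewrite ffunE eq_sym.
Qed.

(** The copies of V generate the twist: this is where [itw] being a right inverse
    of [tw] is used, and it makes the twist preserve finite generation. *)
Lemma twdeltaM i v a : twdelta i (v ** a) = \sum_k twdelta k v ** itw k i a.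
Proof.
apply/ffunP => l; rewrite sum_ffunE ffunE.
transitivity (\sum_k v ** tw l k (itw k i a)).
  by rewrite -ract_sumr itwK eq_sym; case: (l == i); rewrite // ractr0.
apply: eq_bigr => k _; rewrite ffunE (bigD1 k) //= ffunE eqxx big1 ?addr0 //.
by move=> j /negbTE; rewrite ffunE eq_sym => ->; rewrite ract0l.
Qed.

Lemma fg_twm : fg V -> fg twm.
Proof.
case=> s sV; pose g := [seq twdelta i v | v <- s, i <- enum 'I_d].
exists g; have sG := submod_spn g; case: (sG) => G0 GD Gm.
pose L : set V := [set v | forall i, spn g (twdelta i v)].
have sL : submod L.
  split=> [i|v w Lv Lw i|v a Lv i].
  - suff -> : twdelta i 0 = 0 by [].
    by apply/ffunP => j; rewrite !ffunE mul0rn.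
  - suff -> : twdelta i (v + w) = twdelta i v + twdelta i w by exact: GD.
    by apply/ffunP => j; rewrite !ffunE mulrnDl.
  - by rewrite twdeltaM; apply: submod_sum => // k _; exact: Gm.
apply/seteqP; split=> // m _; rewrite [m]twdelta_sum; apply: submod_sum => // i _.
suff: [set: V] `<=` L by apply.
rewrite -sV; apply: spn_sub => // v vs k; apply: mem_spn.
by apply: allpairs_f; rewrite ?mem_enum.
Qed.

End TwistModule.

Definition twf V W (f : V -> W) (m : twm V) : twm W := [ffun i => f (m i)].

Lemma rlinear_twf V W (f : V -> W) : rlinear f -> rlinear (twf f).
Proof.
move=> fl; have [fD fm] := fl; split=> [x y|x a]; apply/ffunP => i.
  by rewrite !ffunE fD.
rewrite !ffunE (big_morph f fD (rlinear0 fl)); apply: eq_bigr => j _.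
by rewrite fm ffunE.
Qed.

(** Twisting is an exact functor, so ranks may be composed with it. *)
Definition rf_tw (r : rankfun) : rankfun.
Proof.
apply: (@RankFun (fun V L' L => rf r (tws L') (tws L)))
  => [V L'' L' L fV sL'' sL' sL L''L' L'L
     |V W f L' L M' M fl fV fW sL' sL sM' sM L'L M'M fL H
     |V W f L' L M' M fl fV fW sL' sL sM' sM L'L M'M fL' H].
- apply: rf_add; [exact: fg_twm|exact: submod_tws..| |].
    by move=> m Lm i; exact: L''L'.
  by move=> m Lm i; exact: L'L.
- apply: (@rf_inj r _ _ (twf f)); [exact: rlinear_twf|exact: fg_twm..|exact: submod_tws
    |exact: submod_tws|exact: submod_tws|exact: submod_tws| | | |].
  + by move=> m Lm i; exact: L'L.
  + by move=> m Lm i; exact: M'M.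
  + by move=> _ [m Lm <-] i; rewrite ffunE; apply: fL; exists (m i).
  + by move=> m Lm Mm i; apply: H => //; have := Mm i; rewrite ffunE.
- apply: (@rf_surj r _ _ (twf f)); [exact: rlinear_twf|exact: fg_twm..|exact: submod_tws
    |exact: submod_tws|exact: submod_tws|exact: submod_tws| | | |].
  + by move=> m Lm i; exact: L'L.
  + by move=> m Lm i; exact: M'M.
  + by move=> _ [m Lm <-] i; rewrite ffunE; apply: fL'; exists (m i).
  + move=> m Mm; have /choice[g Hg] : forall i, exists x, L x /\ M' (m i - f x).
      move=> i; have [_ [z [[x Lx <-] M'z ->]]] := H _ (Mm i).
      by exists x; rewrite addrC addKr.
    exists (twf f [ffun i => g i]), (m - twf f [ffun i => g i]).
    split; last by rewrite addrC subrK.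
      by exists [ffun i => g i] => // i; rewrite ffunE; case: (Hg i).
    by move=> i; rewrite !ffunE; case: (Hg i).
Defined.

(** The twist of the regular module is free of rank d, with coordinates
    [twcoord j] and basis given by the [twfrom j]. *)
Definition twcoord (j : 'I_d) (m : twm regm) : regm := \sum_i itw j i (m i).

Lemma rlinear_twcoord j : rlinear (twcoord j).
Proof.
split=> [x y|x a].
  by rewrite /twcoord -big_split; apply: eq_bigr => i _; rewrite ffunE itwD.
rewrite /twcoord regmE mulr_suml.
transitivity (\sum_i \sum_k \sum_l itw j l (x k : R) * itw l i (tw i k a)).
  apply: eq_bigr => i _; rewrite ffunE itw_sum; apply: eq_bigr => k _.
  by rewrite itwM.
rewrite exchange_big; apply: eq_bigr => k _; rewrite exchange_big.
rewrite -[RHS](sum_delta (fun l => itw j l (x k : R) * a)).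
apply: eq_bigr => l _.
by rewrite -mulr_sumr twK mulrnAr eq_sym.
Qed.

Definition twfrom (j : 'I_d) (a : regm) : twm regm := [ffun i => tw i j a].

Lemma rlinear_twfrom j : rlinear (twfrom j).
Proof.
split=> [x y|x a]; apply/ffunP => i; rewrite !ffunE ?twD // twM.
by apply: eq_bigr => k _; rewrite ffunE.
Qed.

Lemma twcoord_from i j a : twcoord i (twfrom j a) = a *+ (i == j).
Proof. by rewrite -twK; apply: eq_bigr => k _; rewrite ffunE. Qed.

(** Left multiplications are endomorphisms of the regular module; these are
    their images by the twist. In coordinates they act through the matrix [itw]. *)
Definition lmul (c : R) (m : twm regm) : twm regm := [ffun i => c * m i].

Lemma rlinear_lmul c : rlinear (lmul c).
Proof.
split=> [x y|x a]; apply/ffunP => i; rewrite !ffunE ?mulrDr // mulr_sumr.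
by apply: eq_bigr => j _; rewrite ffunE /= mulrA.
Qed.

Lemma twcoord_lmul j c m :
  twcoord j (lmul c m) = \sum_k itw j k c * (twcoord k m : R).
Proof.
transitivity (\sum_i \sum_k itw j k c * itw k i (m i)).
  by apply: eq_bigr => i _; rewrite ffunE itwM.
by rewrite exchange_big; apply: eq_bigr => k _; rewrite mulr_sumr.
Qed.

Lemma twcoord_ext m m' : (forall j, twcoord j m = twcoord j m') -> m = m'.
Proof.
move=> H; apply/ffunP => i.
have E (x : twm regm) : x i = \sum_k tw i k (twcoord k x).
  transitivity (\sum_j \sum_k tw i k (itw k j (x j))).
    by rewrite -[LHS](sum_delta (fun j => x j)); apply: eq_bigr => j _; rewrite itwK.
  by rewrite exchange_big; apply: eq_bigr => k _; rewrite tw_sum.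
by rewrite !E; apply: eq_bigr => k _; rewrite H.
Qed.

(** In the free module, [cub A] is the copy of A^d described by coordinates,
    while [tws A] is the twist of A. The argument rests on comparing the two. *)
Definition cub (A : set regm) : set (twm regm) := [set m | forall j, A (twcoord j m)].

Lemma submod_cub A : submod A -> submod (cub A).
Proof.
case=> A0 AD Am; split=> [j|x y Ax Ay j|x a Ax j].
- by rewrite (rlinear0 (rlinear_twcoord j)).
- by rewrite (rlinear_twcoord j).1; exact: AD.
- by rewrite (rlinear_twcoord j).2; exact: Am.
Qed.

Lemma cubS A B : A `<=` B -> cub A `<=` cub B.
Proof. by move=> AB m Am j; exact: AB. Qed.

Lemma cub_tws (A B : set regm) (c : R) :
  (forall (j k : 'I_d) x, A x -> B (itw j k c * (x : R))) -> submod B ->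
  forall m, cub A m -> cub B (lmul c m).
Proof.
by move=> H sB m Am j; rewrite twcoord_lmul; apply: (submod_sum _ sB) => k _; exact: H.
Qed.

Section CubRank.
Variables (r : rankfun) (A' A : set regm).
Hypotheses (sA' : submod A') (sA : submod A) (A'A : A' `<=` A).

(** A flag between [cub A'] and [cub A] with subquotients A / A'. *)
Definition cubi (l : nat) : set (twm regm) :=
  [set m | forall j : 'I_d, if (j < l)%N then A (twcoord j m) else A' (twcoord j m)].

Lemma submod_cubi l : submod (cubi l).
Proof.
case: (sA) (sA') => A0 AD Am [A'0 A'D A'm].
split=> [j|x y Lx Ly j|x a Lx j].
- by rewrite (rlinear0 (rlinear_twcoord j)); case: ifP.
- have := Ly j; have := Lx j; rewrite (rlinear_twcoord j).1.
  by case: ifP => _; [exact: AD | exact: A'D].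
- have := Lx j; rewrite (rlinear_twcoord j).2.
  by case: ifP => _; [exact: Am | exact: A'm].
Qed.

Lemma cubi_leq l l' : (l <= l')%N -> cubi l `<=` cubi l'.
Proof.
move=> ll' m Lm j; have := Lm j; case: ltnP => [jl|_]; first by rewrite (leq_trans jl).
by case: ifP => // _; exact: A'A.
Qed.

Lemma cubi_step (l : 'I_d) : rf r (cubi l) (cubi l.+1) = rf r A' A.
Proof.
have fR := fg_regm; have fP := fg_twm fR.
apply/eqP; rewrite eqn_leq; apply/andP; split.
  apply: (@rf_inj r _ _ (twcoord l)) => //; do ?exact: submod_cubi.
  - exact: rlinear_twcoord.
  - exact: cubi_leq.
  - by move=> _ [m /(_ l) + <-]; rewrite ltnSn.
  - move=> m Lm A'm j; have := Lm j; rewrite ltnS leq_eqVlt.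
    by case: eqP => [/val_inj -> _|_ //]; rewrite ltnn.
apply: (@rf_inj r _ _ (twfrom l)) => //; do ?exact: submod_cubi.
- exact: rlinear_twfrom.
- exact: cubi_leq.
- move=> _ [a Aa <-] j; rewrite twcoord_from.
  case: eqP => [->|/eqP jl]; first by rewrite ltnSn.
  by case: ifP => _; [case: sA | case: sA'].
- by move=> a _ /(_ l); rewrite ltnn twcoord_from eqxx.
Qed.

Lemma cub_rank : rf r (cub A') (cub A) = (d * rf r A' A)%N.
Proof.
have -> : cub A' = cubi 0 by apply/seteqP; split=> m H j; have := H j.
have -> : cub A = cubi d by apply/seteqP; split=> m H j; have := H j; rewrite ltn_ord.
have fP := fg_twm fg_regm.
suff: forall l, (l <= d)%N -> rf r (cubi 0) (cubi l) = (l * rf r A' A)%N by apply.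
elim=> [_|l IHl ld]; first by rewrite rf_id //; exact: submod_cubi.
rewrite (rf_add r fP (submod_cubi 0) (submod_cubi l)); do ?exact: cubi_leq.
  by rewrite IHl ?(ltnW ld) // (cubi_step (Ordinal ld)) mulSn addnC.
exact: submod_cubi.
Qed.

End CubRank.

Lemma cubT : cub setT = setT.
Proof. by apply/seteqP; split. Qed.

Lemma rank_twm_regm (r : rankfun) :
  rf (rf_tw r) [set (0 : regm)] setT = (d * rf r [set (0%R : regm)] setT)%N.
Proof.
rewrite -cub_rank; [|exact: submod0|exact: submodT|by []].
rewrite cubT /=; congr (rf r _ _); last exact/seteqP.
apply/seteqP; split=> [m m0 j|m m0 i] /=.
  suff -> : m = 0 by rewrite (rlinear0 (rlinear_twcoord j)).
  by apply/ffunP => i; rewrite ffunE; exact: m0.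
suff -> : m = 0 by rewrite ffunE.
by apply: twcoord_ext => j; rewrite (rlinear0 (rlinear_twcoord j)); exact: m0.
Qed.

End Twist.
End Modules.

Arguments regm {R}.

(** * Right noetherian rings *)

Section Noetherian.
Variable R : pzRingType.
Hypothesis noeth : right_noetherian R.
Implicit Types (I J L M : set (@regm R)).

Lemma noeth_max (P : set (@regm R) -> Prop) :
  (exists I, submod I /\ P I) ->
  exists M, [/\ submod M, P M & forall I, submod I -> P I -> M `<=` I -> I = M].
Proof.
move=> [I0 PI0]; apply: contrapT => nomax.
pose T := {I : set (@regm R) | submod I /\ P I}.
have next (u : T) : exists v : T, sval u `<=` sval v /\ sval v <> sval u.
  apply: contrapT => no; apply: nomax; exists (sval u).
  case: (svalP u) => sM PM; split=> // I sI PI MI; apply: contrapT => IM.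
  by apply: no; exists (exist _ I (conj sI PI)).
have [g Hg] := choice next.
pose u n := iter n g (exist _ I0 PI0 : T).
have [|n|N HN] := noeth (I := fun n => sval (u n)).
- by move=> n; case: (svalP (u n)).
- by case: (Hg (u n)).
by case: (Hg (u N)) => _; apply; exact: HN (leqnSn N).
Qed.

Lemma noeth_fg I : submod I -> exists s : seq R, (forall x, x \in s -> I x) /\
  spn (V := regm) s = I.
Proof.
move=> sI.
pose P (M : set (@regm R)) :=
  exists s : seq (@regm R), (forall x, x \in s -> I x) /\ spn s = M.
have [|M [_ [s [sI' <-]] mM]] := @noeth_max P.
  by exists [set 0]; split; [exact: submod0 | exists [::]].
exists s; split=> //; apply/seteqP; split; first exact: spn_sub.
move=> x Ix; pose t := (x :: s : seq regm).
have <- : spn t = spn (V := regm) s.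
  apply: mM; first exact: submod_spn.
    by exists t; split=> // y; rewrite inE => /orP[/eqP->|/sI'].
  exact/addmr/submod_cyc.
by apply: mem_spn; rewrite inE eqxx.
Qed.

End Noetherian.

Definition cmul (R : pzRingType) (c : R) (G : set (@regm R)) : set (@regm R) :=
  [set x | exists2 u, G u & x = c * u].

Lemma submod_cmul (R : pzRingType) (c : R) (G : set (@regm R)) :
  submod G -> submod (cmul c G).
Proof.
case=> G0 GD Gm; split=> [|_ _ [x Gx ->] [y Gy ->]|_ a [x Gx ->]].
- by exists 0; rewrite ?mulr0.
- by exists (x + y); rewrite ?mulrDr //; exact: GD.
- by exists (x ** a); rewrite ?regmE ?mulrA //; exact: Gm.
Qed.

Definition mulI (R : pzRingType) (N M : set (@regm R)) : set (@regm R) :=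
  ideal_mul N M.

Lemma submod_mulI (R : pzRingType) (N M : set (@regm R)) :
  submod M -> submod (mulI N M).
Proof.
move=> [M0 MD Mm]; split.
- by exists [::] => //; rewrite big_nil.
- move=> _ _ [s Hs ->] [t Ht ->]; exists (s ++ t); last by rewrite big_cat.
  by move=> p; rewrite mem_cat => /orP[/Hs|/Ht].
- move=> _ a [s Hs ->]; exists [seq (p.1, p.2 * a) | p <- s].
    by move=> _ /mapP[p /Hs[Np Ip] ->]; split=> //; exact: Mm.
  rewrite big_map regmE mulr_suml; apply: eq_bigr => p _.
  by rewrite mulrA.
Qed.

Lemma mulI_sub (R : pzRingType) (N M L : set (@regm R)) : submod L ->
  (forall n x, N n -> M x -> L (n * x)) -> mulI N M `<=` L.
Proof.
move=> sL H _ [s Hs ->]; rewrite big_seq; apply: (submod_sum (V := regm)) => //.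
by move=> p /Hs[]; exact: H.
Qed.

Lemma mem_mulI (R : pzRingType) (N M : set (@regm R)) n x :
  N n -> M x -> mulI N M (n * x).
Proof.
move=> Nn Mx; exists [:: (n, x)]; last by rewrite big_seq1.
by move=> p; rewrite inE => /eqP ->.
Qed.

Section Radical.
Variable R : pzRingType.
Implicit Types (I J M N : set (@regm R)).

Lemma submod_exp I n : submod I -> submod (ideal_exp I n : set (@regm R)).
Proof.
by move=> sI; elim: n => [|n IHn]; [exact: submodT | exact: submod_mulI].
Qed.

Lemma ideal_exp_sub I J n : submod I -> submod J -> I `<=` J -> ideal_exp I n `<=` ideal_exp J n.
Proof.
move=> sI sJ IJ; elim: n => [//|n IHn]; apply: mulI_sub; first exact: (submod_exp n.+1 sJ).
by move=> x y Ix /IHn; apply: mem_mulI; exact: IJ.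
Qed.

Lemma nilpotent_sub I N : submod I -> submod N -> I `<=` N -> nilpotent_ideal N ->
  nilpotent_ideal I.
Proof.
move=> sI sN IN [n Nn]; exists n; apply/seteqP; split=> [x /(ideal_exp_sub sI sN IN)|_ ->].
  by rewrite Nn.
by case: (submod_exp n sI).
Qed.

Lemma nilpotent_sq I N : submod I -> submod N ->
  (forall x y, I x -> I y -> N (x * y)) -> nilpotent_ideal N -> nilpotent_ideal I.
Proof.
move=> sI sN IIN [n Nn]; exists n.*2.
suff H : ideal_exp I n.*2 `<=` ideal_exp N n.
  apply/seteqP; split=> [x /H|_ ->]; first by rewrite Nn.
  by case: (submod_exp n.*2 sI).
elim: {Nn} n => [//|n IHn]; rewrite doubleS.
have [L0 LD Lm] := submod_exp n.+1 sN.
apply: mulI_sub => // x z Ix; apply: (mulI_sub (L := [set z | ideal_exp N n.+1 (x * z)])).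
  split=> [|y w Hy Hw|y b Hy] /=; first by rewrite mulr0.
    by rewrite mulrDr; exact: LD.
  by rewrite mulrA; exact: Lm.
move=> y w Iy /IHn Hw; rewrite /= mulrA; apply: mem_mulI => //; exact: IIN.
Qed.

(** A maximal nilpotent ideal N is semiprime: if a R a is contained in N, the
    square of N + R a R is contained in N, so that this ideal is nilpotent and
    equal to N. *)
Lemma exists_radical : right_noetherian R -> exists N, [/\ two_sided_ideal N,
  (forall a, (forall b, N (a * b * a)) -> N a) & nilpotent_ideal N].
Proof.
move=> noeth.
have [|N [sN [idN nilN] maxN]] := @noeth_max R noeth
    (fun M => two_sided_ideal M /\ nilpotent_ideal M).
  have s0 := submod0 (@regm R); exists [set 0]; split=> //; split.
    by split=> // a _ ->; rewrite mulr0.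
  exists 1%N; apply/seteqP; split; last by case: (submod_exp 1 s0) => + _ _ _ ->.
  by apply: mulI_sub => // _ x -> _; rewrite mul0r.
exists N; split=> // a aN; pose B : set (@regm R) := mulI setT (cyc (V := regm) a).
have sB : submod B := submod_mulI setT (submod_cyc _).
have idB r x : B x -> B (r * x).
  move=> [s Hs ->]; exists [seq (r * p.1, p.2) | p <- s].
    by move=> _ /mapP[p /Hs[_ Bp] ->].
  by rewrite big_map mulr_sumr; apply: eq_bigr => p _; rewrite mulrA.
have [N0 ND Nm] := sN; have [_ Nl] := idN.
have sI : submod (addm N B) := submod_addm sN sB.
have BB x y : B x -> B y -> N (x * y).
  move=> Bx; apply: (mulI_sub (L := [set y | N (x * y)])).
    split=> [|y' w Hy Hw|y' b Hy] /=; first by rewrite mulr0.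
      by rewrite mulrDr; exact: ND.
    by rewrite mulrA; exact: Nm.
  move=> r _ _ [b _ <-] /=; rewrite mulrA.
  move: Bx => [s Hs ->]; rewrite !mulr_suml big_seq.
  apply: (@submod_sum _ (@regm R)) => // p /Hs[_ [b' _ <-]].
  by have := Nm _ b (Nl p.1 _ (aN (b' * r))); rewrite /= !mulrA.
suff <- : addm N B = N.
  apply: (addmr sN); rewrite -[a]mul1r; apply: mem_mulI => //.
  by exists 1; rewrite ?ract1.
apply: maxN => //; last exact: addml.
split; last first.
  apply: (nilpotent_sq sI sN _ nilN) => _ _ [n [x [Nn Bx ->]]] [n' [x' [Nn' Bx' ->]]].
  rewrite mulrDr; apply: (ND); first exact: Nl.
  by rewrite mulrDl; apply: ND; [exact: Nm | exact: BB].
split=> // r _ [n [x [Nn Bx ->]]].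
by rewrite mulrDr; exists (r * n), (r * x); split; [exact: Nl | exact: idB |].
Qed.

End Radical.

(** * Goldie's theory modulo a semiprime ideal *)

Section Goldie.
Variable R : pzRingType.
Hypothesis noeth : right_noetherian R.
Implicit Types (a b c x y : R) (I J L M U V W : set (@regm R)).

Variable N : set (@regm R).
Hypothesis idN : two_sided_ideal N.
Hypothesis spN : forall a, (forall b, N (a * b * a)) -> N a.

Let sN : submod N. Proof. by case: idN. Qed.
Let ND x y : N x -> N y -> N (x + y). Proof. by case: sN => _ + _; apply. Qed.
Let Nr x a : N x -> N (x * a). Proof. by case: sN => _ _; apply. Qed.
Let Nl a x : N x -> N (a * x). Proof. by case: idN => _; apply. Qed.
Let NB x y : N x -> N y -> N (x - y). Proof. exact: (@submodB _ (@regm R)). Qed.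

Lemma Nadd x y : N (x + y) -> N y -> N x.
Proof. by move=> Nxy Ny; rewrite -(addrK y x); exact: NB. Qed.

Definition ann a : set (@regm R) := [set x | N (a * x)].

Lemma submod_ann a : submod (ann a).
Proof.
split=> [|x y|x b]; rewrite /ann /=.
- by rewrite mulr0; case: sN.
- by rewrite mulrDr; exact: ND.
- by rewrite mulrA; exact: Nr.
Qed.

(** Elements left cancellable modulo N. They turn out to be right cancellable as
    well ([N_cancel]). *)
Definition regN : set (@regm R) := [set c | forall x, N (c * x) -> N x].

Lemma regN1 : regN 1. Proof. by move=> x; rewrite mul1r. Qed.

Lemma regNM c c' : regN c -> regN c' -> regN (c * c').
Proof. by move=> Cc Cc' x; rewrite -mulrA => /Cc/Cc'. Qed.

(** The image of L in R / N is an essential right ideal. *)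
Definition ess L : Prop :=
  forall V, submod V -> ~ V `<=` N -> exists x, [/\ V x, L x & ~ N x].

Lemma ess_colon a L : submod L -> N `<=` L -> ess L -> ess [set b | L (a * b)].
Proof.
move=> sL NL eL V sV VN.
have sW : submod ((fun x : @regm R => a * x : @regm R) @` V).
  by apply: submod_image sV; split=> [x y|x b]; rewrite /= ?mulrDr ?mulrA.
have [WN|WN] := pselect ((fun x => a * x) @` V `<=` N).
  have [x [Vx Nx]] : exists x, V x /\ ~ N x.
    by apply: contrapT => no; apply: VN => x Vx; apply: contrapT => Nx; apply: no; exists x.
  by exists x; split=> //; apply/NL/WN; exists x.
have [_ [[x Vx <-] Lx Nx]] := eL _ sW WN.
by exists x; split=> // Nx'; apply/Nx/Nl.
Qed.

(** Utumi's argument. Otherwise some a outside N has all b a nilpotent modulo N;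
    choose it with a maximal annihilator. A power of b a just short of lying in
    N has the same annihilator as a, which contains b a; so a b a lies in N for
    all b, and semiprimeness puts a into N. *)
Lemma not_nil L : submod L -> ~ L `<=` N ->
  exists2 a, L a & forall k, ~ N (a ^+ k.+1).
Proof.
move=> sL LN; apply: contrapT => no.
pose nl a := ~ N a /\ forall b, exists k, N ((b * a) ^+ k.+1).
have [a0 [La0 Na0]] : exists x, L x /\ ~ N x.
  by apply: contrapT => no'; apply: LN => x Vx; apply: contrapT => Nx; apply: no'; exists x.
have nl0 : nl a0.
  split=> // b; have [k Nk] : exists k, N ((a0 * b) ^+ k.+1).
    apply: contrapT => nok; apply: no; exists (a0 * b); first by case: sL => _ _; apply.
    by move=> k Nk; apply: nok; exists k.
  exists k.+1; rewrite exprS.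
  have -> : b * a0 * (b * a0) ^+ k.+1 = b * (a0 * b) ^+ k.+1 * a0.
    elim: (k.+1) => [|m IH]; first by rewrite !expr0 !mulr1.
    by rewrite exprSr mulrA IH exprSr !mulrA.
  exact/Nr/Nl.
have [_ [_ [a [na <-]] ma]] := @noeth_max _ noeth (fun M => exists a, nl a /\ ann a = M)
  (ex_intro _ _ (conj (submod_ann a0) (ex_intro _ a0 (conj nl0 erefl)))).
case: (na) => Na nila; apply: Na; apply: spN => b.
have [Nba|Nba] := pselect (N (b * a)); first by rewrite -mulrA; exact: Nl.
have [k Nk mk] : exists2 k, N ((b * a) ^+ k.+2) & ~ N ((b * a) ^+ k.+1).
  have [k] := nila b; elim: k => [|k IHk] Nk; first by rewrite expr1 in Nk.
  by have [/IHk|?] := pselect (N ((b * a) ^+ k.+1)) => //; exists k.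
have E : ann ((b * a) ^+ k.+1) = ann a.
  apply: ma; first exact: submod_ann.
    exists ((b * a) ^+ k.+1); split=> //; split=> // b'.
    have [m Nm] := nila (b' * (b * a) ^+ k * b); exists m.
    by move: Nm; rewrite (exprSr (b * a) k) !mulrA.
  by move=> x Nax; rewrite /ann /= exprSr -2!mulrA; do 2 apply: Nl.
have : ann ((b * a) ^+ k.+1) (b * a) by rewrite /ann /= -exprSr.
by rewrite E /ann /= mulrA.
Qed.

Lemma ann_expS a k : ann (a ^+ k) `<=` ann (a ^+ k.+1).
Proof. by move=> x Nx; rewrite /ann /= exprS -mulrA; exact: Nl. Qed.

(** Fitting: the annihilators of the powers of a form an ascending chain. *)
Lemma ann_fitting a : exists2 k, (0 < k)%N & ann (a ^+ k * a ^+ k) = ann (a ^+ k).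
Proof.
have [] := noeth (I := fun n => ann (a ^+ n)) => [n|n|k Hk].
- exact: submod_ann.
- exact: ann_expS.
exists k.+1 => //; rewrite -exprD (Hk (k.+1 + k.+1)%N) ?(Hk k.+1) //.
by rewrite addSn (leq_trans (leq_addr k.+1 k)).
Qed.

(** Goldie: sum up independent elements of L. Among the right ideals independent
    of ann(c) for some c in L with ann(c c) = ann(c) take a maximal one, M. If
    ann(c) is not zero modulo N, a power of a non-nilpotent element of its
    intersection with L provides a, with ann(a a) = ann(a), and the larger right
    ideal M + a R is independent of ann(c + a). *)
Lemma ess_reg L : submod L -> N `<=` L -> ess L -> exists2 c, regN c & L c.
Proof.
move=> sL NL eL.
pose P M := N `<=` M /\ exists c, [/\ L c, (forall x, N (c * (c * x)) -> N (c * x))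
  & M `&` ann c `<=` N].
have [|M [sM [NM [c [Lc Hc Mc]]] mM]] := @noeth_max _ noeth P.
  exists N; split=> //; split=> //; exists 0; split; first by case: sL.
    by move=> x; rewrite !mul0r.
  by move=> x [].
have [cN|cN] := pselect (ann c `<=` N); first by exists c => // x /cN.
have sLc : submod (L `&` ann c) by apply: submodI => //; exact: submod_ann.
have LcN : ~ L `&` ann c `<=` N.
  by have [x [Nx Lx Nx' /(_ x (conj Lx Nx))]] := eL _ (submod_ann c) cN.
have [a0 [La0 ca0] a0nil] := not_nil sLc LcN.
have [k k0 Hk] := ann_fitting a0.
have [a [La ca Na Ha]] : exists a, [/\ L a, N (c * a), ~ N a
    & forall x, N (a * (a * x)) -> N (a * x)].
  exists (a0 ^+ k); case: k k0 Hk => // k _ Hk.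
  have [La ca] : (L `&` ann c) (a0 ^+ k.+1).
    by case: sLc => _ _ Lm; rewrite exprS; apply: Lm.
  split=> //; move=> x; rewrite mulrA => Nx.
  by have : ann (a0 ^+ k.+1 * a0 ^+ k.+1) x by []; rewrite Hk.
have key x : N ((c + a) * x) -> N (c * x) /\ N (a * x).
  rewrite mulrDl => Nx; have Ncx : N (c * x).
    apply: Hc; rewrite -[_ * _]addr0 -[X in N (_ + X)](subrr (c * (a * x))) addrA -mulrDr.
    by apply: NB; [exact: Nl | rewrite mulrA; exact: Nr].
  by split=> //; apply: (Nadd _ Ncx); rewrite addrC.
have E : addm M (cyc (V := regm) a) = M.
  apply: mM.
  - exact: submod_addm sM (submod_cyc _).
  - split; first exact: subset_trans (addml (submod_cyc _)).
    exists (c + a); split; first by case: sL => _ + _; apply.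
      move=> x /key[Nc2 Na2]; rewrite mulrDl; apply: ND.
        apply: Hc; move: Nc2; rewrite mulrDl mulrDr => /Nadd; apply.
        by rewrite mulrA; exact: Nr.
      apply: Ha; move: Na2; rewrite mulrDl mulrDr addrC => /Nadd; apply.
      apply/Nl/Hc; move: Nc2; rewrite mulrDl mulrDr => /Nadd; apply.
      by rewrite mulrA; exact: Nr.
    move=> _ [[m [_ [Mm [b _ <-] ->]]] /key[]]; rewrite /= !mulrDr => Ncm Nam.
    have Nm : N m.
      apply: Mc; split=> //; apply: (Nadd Ncm).
      by rewrite mulrA; exact: Nr.
    apply: ND => //; apply: Ha; move: Nam; rewrite addrC => /Nadd; apply.
    exact: Nl.
  - exact: addml (submod_cyc _).
case: Na; apply: Mc; split=> //; rewrite -E.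
by apply: (addmr sM); exact: mem_cyc.
Qed.

Definition princ c : set (@regm R) := addm (cyc (V := regm) c) N.

Lemma submod_princ c : submod (princ c).
Proof. exact: submod_addm (submod_cyc _) sN. Qed.

(** If V meets c R only in N, the sum of V, c V, c^2 V and so on is direct modulo
    N, which contradicts the ascending chain condition unless V is in N. *)
Lemma ess_princ c : regN c -> ess (princ c).
Proof.
move=> Cc V sV VN; apply: contrapT => no.
have VP v : V v -> princ c v -> N v.
  by move=> Vv Pv; apply: contrapT => Nv; apply: no; exists v.
pose F k := iter k (fun G => addm V (addm (cmul c G) N)) N.
have sF k : submod (F k).
  by elim: k => [//|k IHk]; do !apply: submod_addm => //; exact: submod_cmul.
have NF k : N `<=` F k.
  case: k => [//|k]; apply: subset_trans (addmr sV).
  exact/addmr/submod_cmul.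
have FS k : F k `<=` F k.+1.
  elim: k => [|k IHk]; first exact: NF 1%N.
  by apply: addmS => //; apply: addmS => // _ [x /IHk Fx ->]; exists x.
have [k Hk] := noeth sF FS.
have powF n v : V v -> F n.+1 (c ^+ n * v).
  move=> Vv; elim: n => [|n IHn].
    by rewrite mul1r; apply: addml Vv; apply: submod_addm => //; exact: submod_cmul.
  apply: (addmr sV); apply: addml => //.
  by exists (c ^+ n * v); rewrite ?exprS ?mulrA.
have cancelF n v : V v -> F n (c ^+ n * v) -> N v.
  elim: n v => [|n IHn] v Vv; first by rewrite mul1r.
  move=> [v0 [_ [Vv0 [_ [x [[u Fu ->] Nx ->]] E]]]].
  rewrite exprS -mulrA in E.
  have Nv0 : N v0.
    apply: VP => //; exists (c * (c ^+ n * v - u)), (- x); split.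
    - by exists (c ^+ n * v - u).
    - exact: submodN.
    - by rewrite mulrBr E [c * u + x]addrC addrA !addrK.
  apply: IHn => //; have Nd : N (c ^+ n * v - u).
    by apply: Cc; rewrite mulrBr E [c * u + x]addrC addrA addrK; exact: ND.
  by rewrite -[_ * v](subrK u); case: (sF n) => _ + _; apply=> //; exact: NF.
apply: VN => v Vv; apply: (cancelF k) => //.
by rewrite -(Hk k.+1) //; exact: powF.
Qed.

(** The set of b with a b in c R + N is essential, hence contains a cancellable
    element. *)
Lemma ore_mod a c : regN c ->
  exists c' a', regN c' /\ N (a * c' - c * a').
Proof.
move=> Cc; have eP := ess_princ Cc.
have NP : N `<=` princ c by exact/addmr/submod_cyc.
have [||c' Cc' [_ [n [[a' _ <-] Nn E]]]] := ess_reg _ _ (ess_colon a (submod_princ c) NP eP).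
- have [P0 PD Pm] := submod_princ c; split=> [|x y|x b]; rewrite /= ?mulr0 // ?mulrDr.
    exact: PD.
  by rewrite mulrA; exact: Pm.
- by move=> x Nx; apply/NP/Nl.
by exists c', a'; split=> //; rewrite E regmE addrAC subrr add0r.
Qed.

(** The right singular ideal of R / N vanishes: a power z of a non-nilpotent
    element of x R with ann(z z) = ann(z) has an essential annihilator meeting
    z R trivially. *)
Lemma sing_ess x : ess (ann x) -> N x.
Proof.
move=> ex; apply: contrapT => Nx.
have [|z0 [b _ <-] z0nil] := not_nil (submod_cyc (V := regm) x).
  by move=> sub; apply/Nx/sub; exact: (mem_cyc (V := regm)).
rewrite regmE in z0nil.
have ess_annM y u : ess (ann y) -> ess (ann (y * u)).
  move=> ey; have := ess_colon u (submod_ann y) _ ey.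
  have -> : [set b | ann y (u * b)] = ann (y * u).
    by apply/seteqP; split=> w; rewrite /ann /= mulrA.
  by apply=> w Nw; exact: Nl.
have [k k0 Hk] := ann_fitting (x * b); set z := (x * b) ^+ k in Hk.
have ez : ess (ann z).
  by rewrite /z; case: k k0 {Hk z} => // k _; rewrite exprS -mulrA; exact: ess_annM.
have Nz : ~ N z by rewrite /z; case: k k0 {Hk z ez} => // k _.
have [|_ [[y _ <-] Nzzy Nzy]] := ez _ (submod_cyc (V := regm) z).
  by move=> sub; apply/Nz/sub; exact: (mem_cyc (V := regm)).
apply: Nzy; rewrite regmE; have : ann (z * z) y by rewrite /ann /= -mulrA.
by rewrite Hk.
Qed.

Lemma ess_super L M : L `<=` M -> ess L -> ess M.
Proof. by move=> LM eL V sV VN; have [x [? /LM ? ?]] := eL V sV VN; exists x. Qed.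

Lemma N_cancel x c : regN c -> N (x * c) -> N x.
Proof.
move=> Cc Nxc; apply: sing_ess; apply: ess_super (ess_princ Cc).
move=> _ [_ [n [[a _ <-] Nn ->]]]; rewrite /ann /= mulrDr mulrA.
by apply: ND; [exact: Nr | exact: Nl].
Qed.

(** Right ideals whose quotient is torsion, stated for elements. *)
Definition dense I : Prop := forall x, exists2 c, regN c & I (x * c).

Definition colon (I : set (@regm R)) a : set (@regm R) := [set b | I (a * b)].

Lemma submod_colon I a : submod I -> submod (colon I a).
Proof.
case=> I0 ID Im; split=> [|x y|x b]; rewrite /colon /= ?mulr0 // ?mulrDr.
  exact: ID.
by rewrite mulrA; exact: Im.
Qed.

Lemma ess_dense L : submod L -> N `<=` L -> ess L -> dense L.
Proof.
move=> sL NL eL x; apply: (@ess_reg (colon L x)) => //.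
- exact: submod_colon.
- by move=> y Ny; exact/NL/Nl.
- exact: ess_colon.
Qed.

Lemma tors_dense (E : set R) I : dense I -> tors regN E I setT.
Proof. by move=> dI; apply: TorsC => x _; exact: dI. Qed.

Lemma torsT_elt (V : rmod R) (L' L : set V) : tors regN setT L' L ->
  forall x : V, L x -> exists2 c, regN c & L' (x ** c).
Proof.
elim=> {L' L} [L' L H //|L' L H|L' M L _ IH1 _ IH2] x Lx.
  by exists 1; [exact: regN1 | rewrite -[x ** 1]ract1; exact: H].
have [c Cc /IH1[c' Cc' L'x]] := IH2 x Lx.
by exists (c * c'); [exact: regNM | rewrite ractM].
Qed.

(** ** Finiteness of the rank *)

Section Nilpotent.
Hypothesis nilN : nilpotent_ideal N.

Definition npow k : set (@regm R) := ideal_exp N k.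

Lemma ideal_exp_mulr k y n : npow k y -> N n -> npow k.+1 (y * n).
Proof.
elim: k y => [|k IHk] y /=.
  move=> _ Nn; exists [:: (y * n, 1)]; last by rewrite big_seq1 /= mulr1.
  by move=> p; rewrite inE => /eqP->; split=> //; exact: Nl.
move=> [s Hs ->] Nn; exists [seq (p.1, p.2 * n) | p <- s].
  by move=> _ /mapP[p /Hs[Np Ip] ->]; split=> //; exact: IHk.
by rewrite big_map mulr_suml; apply: eq_bigr => p _; rewrite mulrA.
Qed.

Lemma ideal_expS k : npow k.+1 `<=` npow k.
Proof.
have il : forall a y, npow k y -> npow k (a * y).
  case: k => [//|k] a y [s Hs ->]; exists [seq (a * p.1, p.2) | p <- s].
    by move=> _ /mapP[p /Hs[Np Ip] ->]; split=> //; exact: Nl.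
  by rewrite big_map mulr_sumr; apply: eq_bigr => p _; rewrite mulrA.
apply: mulI_sub; first exact: submod_exp.
by move=> n x _; exact: il.
Qed.

(** Induction along the powers of N: the successive quotients of R are built from
    cyclic modules killed by N, on which Goldie's theory applies. *)
Lemma nil_filtration (P : set (@regm R) -> set (@regm R) -> Prop) I : submod I ->
  (forall L, submod L -> P L L) ->
  (forall L'' L' L, submod L'' -> submod L' -> submod L -> L'' `<=` L' -> L' `<=` L ->
    P L'' L' -> P L' L -> P L'' L) ->
  (forall M y, submod M -> I `<=` M -> (forall n, N n -> M (y * n)) ->
    P M (addm (cyc (V := regm) y) M)) ->
  P I setT.
Proof.
move=> sI P0 Pcat Pcyc; case: nilN => p Np.
have sG k : submod (addm (npow k) I).
  by apply: submod_addm => //; exact: submod_exp.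
have IG k : I `<=` addm (npow k) I by exact/addmr/submod_exp.
suff H k : P (addm (npow k) I) setT.
  have -> : I = addm (npow p) I; last exact: H.
  apply/seteqP; split=> //; apply: addm_sub => //.
  by rewrite /npow Np => _ ->; case: sI.
elim: k => [|k IHk].
  have -> : addm (npow 0) I = setT; last exact/P0/submodT.
  by apply/seteqP; split=> // x _; apply: addml.
have GS : addm (npow k.+1) I `<=` addm (npow k) I.
  by apply: addmS => //; exact: ideal_expS.
apply: (Pcat _ _ _ (sG _) (sG _) (submodT _) GS) => //.
have [s [sN' def_s]] := noeth_fg noeth (submod_exp k sN).
have -> : addm (npow k) I = addm (spn (V := regm) s) (addm (npow k.+1) I).
  rewrite def_s; apply/seteqP; split.
    by apply: addmS => //; exact/addmr/submod_exp.
  apply: addm_sub => //; exact/addml.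
elim: s sN' {def_s} => [_|y s IHs sN'].
  have -> : addm (spn (V := regm) [::]) (addm (npow k.+1) I) = addm (npow k.+1) I.
    apply/seteqP; split; last exact/addmr/submod0.
    by apply: addm_sub => // _ ->; case: (sG k.+1).
  exact: P0.
have ss : submod (addm (spn (V := regm) s) (addm (npow k.+1) I)).
  by apply: submod_addm => //; exact: submod_spn.
have -> : addm (spn (V := regm) (y :: s)) (addm (npow k.+1) I)
    = addm (cyc (V := regm) y) (addm (spn (V := regm) s) (addm (npow k.+1) I)).
  apply/seteqP; split=> [_ [_ [c [[a [b [ya sb ->]]] Gc ->]]]|
                         _ [a [_ [ya [b [c [sb Gc ->]]] ->]]]].
    by exists a, (b + c); rewrite addrA; split=> //; exists b, c.
  by exists (a + b), c; rewrite addrA; split=> //; exists a, b.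
have Gss := addmr (submod_spn (V := regm) s) (M := addm (npow k.+1) I).
apply: (Pcat _ _ _ (sG k.+1) ss) => //.
- by apply: submod_addm => //; exact: submod_cyc.
- exact/addmr/submod_cyc.
- by apply: IHs => x xs; apply: sN'; rewrite inE xs orbT.
- apply: Pcyc => // [x Ix|n Nn]; first by apply/Gss/IG.
  apply/Gss/addml => //; apply: ideal_exp_mulr => //.
  by apply: sN'; rewrite inE eqxx.
Qed.

Lemma bounded_step (E : set R) M y : submod M -> (forall n, N n -> M (y * n)) ->
  bounded regN E N setT -> bounded regN E M (addm (cyc (V := regm) y) M).
Proof.
move=> sM yNM [b Hb]; exists b => n H; apply: Hb.
have fl := rlinear_ract (y : regm).
apply: (ht_bot (L' := (fun a : regm => (y : regm) ** a) @^-1` M)) => [//|].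
apply: (ht_surj fl (submodT _) sM (submod_addm (submod_cyc _) sM)) H => //.
by move=> _ [a Ma <-].
Qed.

(** U / N is a uniform right ideal of R / N. *)
Definition uniform U : Prop := [/\ submod U, N `<=` U, ~ U `<=` N
  & forall V W, submod V -> submod W -> V `<=` U -> W `<=` U ->
      N `<=` V -> N `<=` W -> ~ V `<=` N -> ~ W `<=` N ->
      exists x, [/\ V x, W x & ~ N x]].

Lemma not_subP (A B : set (@regm R)) : ~ A `<=` B -> exists x, A x /\ ~ B x.
Proof.
move=> AB; apply: contrapT => no; apply: AB => x Ax.
by apply: contrapT => Bx; apply: no; exists x.
Qed.

(** Let M be maximal among the right ideals which some nonzero W inside V meets
    trivially, modulo N. Then W is uniform: of two independent parts of W, one
    could be added to M and the other take the place of W. *)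
Lemma exists_uniform V : submod V -> N `<=` V -> ~ V `<=` N ->
  exists2 U, uniform U & U `<=` V.
Proof.
move=> sV NV VN.
pose P M := exists W, [/\ submod W, W `<=` V, N `<=` W, ~ W `<=` N & M `&` W `<=` N].
have [|M [sM [W [sW WV NW WN MW]] mM]] := noeth_max noeth (P := P).
  by exists N; split=> //; exists V; split=> // x [].
exists W => //; split=> // W1 W2 sW1 sW2 W1W W2W NW1 NW2 W1N W2N.
apply: contrapT => no.
have W12 x : W1 x -> W2 x -> N x by move=> ? ?; apply: contrapT => ?; apply: no; exists x.
have E : addm W1 M = M.
  apply: mM; [exact: submod_addm| |exact: addmr].
  exists W2; split=> //; first exact: subset_trans WV.
  move=> _ [[w1 [m [W1w Mm ->]]] W2w].
  have Nm : N m.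
    apply: MW; split=> //; rewrite -[m](addKr w1) addrC; apply: submodB => //.
      exact: W2W.
    exact: W1W.
  by apply: W12 => //; case: sW1 => _ + _; apply=> //; exact: NW1.
apply: W1N => x W1x; apply: MW; split; last exact: W1W.
by rewrite -E; exact: addml.
Qed.

(** Proper quotients of uniform right ideals are torsion: the set of b with u b in
    P is essential, as every nonzero u X meets P inside U. *)
Lemma uniform_dense U P u : uniform U -> submod P -> N `<=` P ->
  (exists x, [/\ P x, U x & ~ N x]) -> U u -> exists2 c, regN c & P (u * c).
Proof.
move=> [sU NU UN uU] sP NP [x0 [Px0 Ux0 Nx0]] Uu.
apply: (@ess_reg (colon P u)); first exact: submod_colon.
  by move=> n Nn; exact/NP/Nl.
move=> X sX XN; have [uXN|] := pselect (cmul u X `<=` N).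
  have [x [Xx Nx]] := not_subP XN; exists x; split=> //; apply/NP/uXN.
  by exists x.
have suX := submod_cmul u sX; move=> uXN.
have [| | | | | |||y [[Py Uy] [_ [n [[x Xx ->] Nn E]]] Ny]] :=
    uU (P `&` U) (addm (cmul u X) N).
- exact: submodI.
- exact: submod_addm.
- by move=> y [].
- apply: addm_sub => // _ [x Xx ->]; case: sU => _ _; exact.
- by move=> n Nn; split; [exact: NP|exact: NU].
- exact: addmr.
- by move/(_ x0 (conj Px0 Ux0)).
- by move=> H; apply: uXN; apply: subset_trans H; exact: addml.
exists x; split=> //.
  by rewrite /colon /= -(addrK n (u * x)) -E; apply: submodB => //; exact: NP.
by move=> Nx; apply: Ny; rewrite E; apply: ND => //; exact: Nl.
Qed.

(** A right ideal of bounded rank, as large as possible, is essential; otherwise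
    a uniform right ideal independent of it could be added at the cost of one
    step. Essential right ideals have a torsion quotient. *)
Lemma bounded_RN : bounded regN setT N setT.
Proof.
pose P L := N `<=` L /\ bounded regN setT N L.
have [|L [sL [NL bL] mL]] := noeth_max noeth (P := P).
  by exists N; split=> //; split=> //; apply/bounded_tors/tors_id => //; exact: regN1.
have [eL|] := pselect (ess L).
  apply: (bounded_cat (L' := L)) => //.
  by apply/bounded_tors/tors_dense/ess_dense.
move=> neL.
have [V [sV NV VN VL]] : exists V, [/\ submod V, N `<=` V, ~ V `<=` N & V `&` L `<=` N].
  apply: contrapT => no; apply: neL => V sV VN; apply: contrapT => nox.
  apply: no; exists (addm V N); split; first exact: submod_addm.
  - exact: addmr.
  - by move=> H; apply/VN/(subset_trans _ H)/addml.
  move=> _ [[v [n [Vv Nn ->]]] Lvn]; apply: ND => //.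
  apply: contrapT => Nv; apply: nox; exists v; split=> //.
  by rewrite -(addrK n v); apply: submodB => //; exact: NL.
have [U uU UV] := exists_uniform sV NV VN; have [sU NU UN _] := uU.
have sLU := submod_addm sL sU; have LLU := addml (L := L) sU.
suff E : addm L U = L.
  case: UN => x Ux; apply: VL; split; first exact: UV.
  by rewrite -E; exact: addmr.
apply: mL => //; split; first exact: subset_trans LLU.
apply: bounded_cat bL _ => //; exists 1%N => -[//|[//|n]] H.
have [M [sM MT HM nt]] := ht_inv H; have [K [sK KM HK nt']] := ht_inv HM.
have [p [Mp Lp]] : exists p, M p /\ ~ L p.
  apply: contrapT => no; apply: nt'; apply: tors_id; first exact: regN1.
  move=> x Mx; apply: (ht_sub HK); apply: contrapT => Lx; apply: no; by exists x.
have [l [u [Ll Uu Ep]]] := MT _ Mp.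
have LM : L `<=` M by apply: subset_trans KM; exact: (ht_sub HK).
have Mu : M u by rewrite -[u](addKr l) -Ep addrC; apply: submodB => //; exact: LM.
have Nu : ~ N u.
  by move=> Nu; apply: Lp; rewrite Ep; case: sL => _ + _; apply=> //; exact: NL.
case: nt; apply: TorsC => _ [l' [u' [Ll' Uu' ->]]].
have [||c Cc Mc] := uniform_dense uU sM _ _ Uu'; first exact: subset_trans LM.
  by exists u.
exists c => //; rewrite ractDl; case: (sM) => _ MD _; apply: MD => //.
by apply: LM; case: sL => _ _; apply.
Qed.

Lemma tors_sub_E (E : set R) (V : rmod R) (L' L : set V) : tors regN setT L' L -> tors regN E L' L.
Proof. by move=> /torsT_elt H; apply: TorsC. Qed.

Lemma ht_sub_E (E : set R) (V : rmod R) (L' L : set V) n : ht regN E L' n L -> ht regN setT L' n L.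
Proof.
elim=> {n L} [L L'L|n M L sM ML _ IH nt]; first exact: Ht0.
by apply: (HtS sM ML IH) => t; apply: nt; exact: tors_sub_E.
Qed.

(** When E is the whole ring, being killed by E means being zero, and the torsion
    modules left are torsion for every E; so this case bounds all others. *)
Lemma bounded_R (E : set R) : bounded regN E [set (0 : @regm R)] setT.
Proof.
apply: nil_filtration => [|L sL|L'' L' L sL'' sL' sL L''L' L'L|M y sM _ yN].
- exact: submod0.
- by apply/bounded_tors/tors_id => //; exact: regN1.
- exact: bounded_cat.
- apply: bounded_step => //; have [b Hb] := bounded_RN; exists b => n.
  by move/ht_sub_E/Hb.
Qed.

Definition rkN (E : set R) : rankfun R := length_rank regN1 (bounded_R E).

Lemma rkNE (E : set R) (V : rmod R) (L' L : set V) : rf (rkN E) L' L = rk regN E L' L.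
Proof. by []. Qed.

(** ** Rank functions vanish on torsion modules *)

(** Multiplication by c embeds R / N into (c R + N) / N, so that nothing is left
    for the quotient. *)
Lemma rf_princ (r : rankfun R) c : regN c -> rf r (princ c) setT = 0%N.
Proof.
move=> Cc; have fR := fg_regm R; have sP := submod_princ c.
have NP : N `<=` princ c by exact/addmr/submod_cyc.
have E : (rf r N setT <= rf r N (princ c))%N.
  apply: (@rf_inj _ r _ _ (fun a : regm => (c : regm) ** a)) => //; try exact: submodT.
    exact: rlinear_ract.
    by move=> _ [x _ <-]; apply: addml => //; exists x.
  by move=> x _; exact: Cc.
move: E; rewrite (rf_add r fR sN sP (submodT _) NP (fun _ _ => I)).
by rewrite -[leqRHS]addn0 leq_add2l leqn0 => /eqP.
Qed.

Lemma rf_dense (r : rankfun R) I : submod I -> dense I -> rf r I setT = 0%N.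
Proof.
move=> sI dI; have fR := fg_regm R.
apply: (nil_filtration (P := fun L' L => rf r L' L = 0%N)) => //.
- by move=> L sL; exact: rf_id.
- by move=> L'' L' L sL'' sL' sL L''L' L'L E1 E2; rewrite (rf_add r fR sL'' sL') // E1 E2.
- move=> M y sM IM yN; have [c Cc Iyc] := dI y.
  have scM := submod_colon y sM; have sP := submod_princ c.
  have Pc : princ c `<=` colon M y.
    apply: addm_sub => // _ [a _ <-]; rewrite /colon /= mulrA.
    by case: sM => _ _ Mm; apply: Mm; exact: IM.
  apply/eqP; rewrite -leqn0 -(rf_princ r Cc).
  apply: (@rf_surj _ r _ _ (fun a : regm => (y : regm) ** a)) => //; try exact: submodT.
  + exact: rlinear_ract.
  + exact: submod_addm (submod_cyc _) sM.
  + exact/addmr/submod_cyc.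
  + by move=> _ [a /Pc Ma <-].
Qed.

(** The Ore condition along a twist. It says that the twist of a torsion module
    is torsion, and follows from the vanishing on R / I of every rank function,
    in particular of the rank composed with the twist. *)
Lemma tws_tors (t : twist R) I : submod I -> dense I ->
  forall v : twm t regm, exists2 c, regN c & tws I (v ** c).
Proof.
move=> sI dI v; have fR := fg_regm R.
suff t0 : tors regN setT (tws (t := t) I) (tws setT) by exact: (torsT_elt t0).
apply: tors_rk; first exact: submod_tws.
- by [].
- apply: (bounded_in regN1 (bounded_R setT)); first exact: fg_twm.
  exact: submod_tws.
- by rewrite -rkNE; exact: (rf_dense (rf_tw t (rkN setT))).
Qed.

End Nilpotent.

End Goldie.

(** * Elements regular modulo the radical *)

Section RegularModuloN.
Variable R : pzRingType.
Hypothesis noeth : right_noetherian R.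
Implicit Types (I J L M U W Z Y : set (@regm R)).

Variable N : set (@regm R).
Hypothesis idN : two_sided_ideal N.
Hypothesis spN : forall a, (forall b, N (a * b * a)) -> N a.
Hypothesis nilN : nilpotent_ideal N.
Notation regN := (regN N).
Notation rkN := (rkN noeth idN spN nilN).

Let fR := fg_regm R.
Let sN : submod N. Proof. by case: idN. Qed.

(** The quantification over a makes this a right ideal without appeal to the Ore
    condition: x R, and not only x, is torsion modulo M. *)
Definition sat M : set (@regm R) :=
  [set x | forall a : R, exists2 c, regN c & M (x * a * c)].

Lemma submod_sat M : submod M -> submod (sat M).
Proof.
move=> [M0 MD Mm]; split=> [a|x y Sx Sy a|x b Sx a].
- by exists 1; [exact: regN1 | rewrite !mul0r].
- have [c Cc Mc] := Sx a; have [c' Cc' Mc'] := Sy (a * c).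
  exists (c * c'); first exact: regNM.
  rewrite !mulrDl; apply: (MD); first by rewrite mulrA; exact: Mm.
  by move: Mc'; rewrite !mulrA.
- by have [c Cc Mc] := Sx (b * a); exists c; rewrite //= -!mulrA in Mc *.
Qed.

Lemma sub_sat M : submod M -> M `<=` sat M.
Proof.
move=> [_ _ Mm] x Mx a; exists 1; first exact: regN1.
by rewrite mulr1; exact: Mm.
Qed.

Lemma satS M L : M `<=` L -> sat M `<=` sat L.
Proof. by move=> ML x Sx a; have [c Cc /ML Lc] := Sx a; exists c. Qed.

Lemma sat_sat M : sat (sat M) `<=` sat M.
Proof.
move=> x Sx a; have [c Cc /(_ 1)[c' Cc' Mc']] := Sx a.
by exists (c * c'); [exact: regNM | move: Mc'; rewrite mulr1 !mulrA].
Qed.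

Lemma rk0_sat M L : submod M -> submod L -> M `<=` L ->
  rf (rkN setT) M L = 0%N -> L `<=` sat M.
Proof.
move=> sM sL ML r0 x Lx a; have bR := bounded_R noeth idN spN nilN setT.
have t := tors_rk sM ML (bounded_in (@regN1 R N) bR L fR sM) r0.
have Lxa : L ((x : regm) ** a) by case: sL => _ _; apply.
by have [c Cc Mc] := torsT_elt t Lxa; exists c.
Qed.

Lemma rk_sat M L : submod M -> L `<=` sat M -> rf (rkN setT) M L = 0%N.
Proof.
move=> sM LS; apply: rk_tors; apply: TorsC => x /LS/(_ 1)[c Cc Mc].
by exists c; rewrite // mulr1 in Mc.
Qed.

Definition saturated Z : Prop := sat Z `<=` Z.

Lemma saturated_N : saturated N.
Proof.
move=> x /(_ 1)[c Cc]; rewrite mulr1.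
exact: (N_cancel noeth idN spN Cc).
Qed.

(** ** Good and bad layers *)

(** For c in C, left multiplication by c is injective on good layers; on bad
    layers some c in C acts as zero, and even a whole two-sided ideal
    containing c does. *)
Definition good Z' Z : Prop := forall c x, regN c -> Z x -> Z' (c * x) -> Z' x.

Definition bad Z' Z : Prop := exists I, [/\ two_sided_ideal I,
  exists2 c, regN c & I c & forall a x, I a -> Z x -> Z' (a * x)].

Section Layer.
Variables Z' Z : set (@regm R).
Hypotheses (idZ' : two_sided_ideal Z') (idZ : two_sided_ideal Z).
Hypotheses (satZ' : saturated Z') (satZ : saturated Z).
Hypotheses (Z'Z : Z' `<=` Z) (ZZ' : Z <> Z').
Hypothesis simple : forall Y, two_sided_ideal Y -> saturated Y -> Z' `<=` Y ->
  Y `<=` Z -> Y = Z \/ Y = Z'.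

Let sZ' : submod Z'. Proof. by case: idZ'. Qed.
Let sZ : submod Z. Proof. by case: idZ. Qed.

(** Nakayama: the saturation of N Z + Z' is Z or Z'. If it were Z, so would be
    those of N^k Z + Z' for all k, and N is nilpotent. *)
Lemma layer_N n z : N n -> Z z -> Z' (n * z).
Proof.
pose T k := addm (iter k (mulI N) Z) Z'.
have sT k : submod (T k).
  by apply: submod_addm => //; elim: k => [|k IHk]; [exact: sZ | exact: submod_mulI].
have sP k : submod (iter k (mulI N) Z).
  by elim: k => [|k IHk]; [exact: sZ | exact: submod_mulI].
have lT1 a x : T 1%N x -> T 1%N (a * x).
  move=> [_ [z' [[s Hs ->] Zz' ->]]]; rewrite mulrDr; case: (sT 1%N) => _ TD _; apply: TD.
    apply: addml => //; rewrite mulr_sumr big_seq; apply: (submod_sum (V := regm)) => //.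
    move=> p /Hs[Np Zp]; rewrite mulrA; apply: mem_mulI => //.
    by case: idN => _; apply.
  by apply: addmr => //; case: idZ' => _; apply.
have TZ : T 1%N `<=` Z.
  by apply: addm_sub => //; apply: mulI_sub => // m x _; case: idZ => _; apply.
have idS : two_sided_ideal (sat (T 1%N)).
  split; first exact: submod_sat.
  by move=> a x Sx b; have [c Cc Tc] := Sx b; exists c => //; have := lT1 a _ Tc; rewrite !mulrA.
have [] := simple idS (@sat_sat _).
- by apply: subset_trans (sub_sat (sT 1%N)); exact/addmr/(sP 1%N).
- by apply: subset_trans satZ; exact: satS.
- move=> ES; exfalso; apply: ZZ'; apply/seteqP; split=> // x Zx.
  have key k : Z `<=` sat (T k).
    elim: k => [|k IHk]; first by apply: subset_trans (sub_sat (sT 0%N)); exact: addml.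
    rewrite -{1}ES; apply: subset_trans (@sat_sat _); apply: satS.
    apply: addm_sub; first exact: submod_sat.
      apply: mulI_sub; first exact: submod_sat.
      move=> m y Nm /IHk Sy a; have [c Cc [w [z' [Pw Zz' E]]]] := Sy a.
      exists c => //; have -> : m * y * a * c = m * (y * a * c) by rewrite !mulrA.
      rewrite E mulrDr; case: (sT k.+1) => _ TD _; apply: TD.
        by apply: addml => //; exact: mem_mulI.
      by apply: addmr => //; case: idZ' => _; apply.
    by apply: subset_trans (sub_sat (sT k.+1)); exact: addmr.
  have [p Np] := nilN; apply: satZ'; apply: satS (key p x Zx).
  apply: addm_sub => // y Py; suff : (ideal_exp N p : set (@regm R)) y.
    by rewrite Np => ->; case: sZ'.
  elim: p {Np} y Py => [//|p IHp] _ [s Hs ->]; exists s => // q /Hs[Nq /IHp].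
  by [].
- move=> ES Nn Zz; rewrite -ES; apply: sub_sat => //; apply: addml => //.
  exact: mem_mulI.
Qed.

Let M c := addm (cmul c Z) Z'.
Let sM c : submod (M c).
Proof. by apply: submod_addm => //; exact: submod_cmul. Qed.
Let Z'M c : Z' `<=` M c. Proof. exact/addmr/submod_cmul. Qed.
Let MZ c : M c `<=` Z.
Proof. by apply: addm_sub => // _ [x Zx ->]; case: idZ => _; apply. Qed.
Let rho := rkN setT.

(** The right ideals c Z + Z' are directed downwards, as N kills the layer and C
    satisfies the Ore condition modulo N. *)
Lemma layer_ore c c' : regN c -> regN c' -> exists2 t, regN t & M (c * t) `<=` M c'.
Proof.
move=> Cc Cc'; have [t [a [Ct Nt]]] := ore_mod noeth idN spN c Cc'; exists t => //.
apply: addm_sub => // _ [z Zz ->].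
rewrite -(subrK (c' * a) (c * t)) mulrDl; case: (sM c') => _ MD _; apply: (MD).
  by apply: Z'M; exact: layer_N.
by apply: addml => //; exists (a * z); rewrite ?mulrA //; case: idZ => _; apply.
Qed.

(** Let c Z + Z' have minimal rank over Z'. By directedness its saturation is the
    smallest one among all choices of c, hence a two-sided ideal, hence Z or Z'.
    In the first case every c' Z + Z' has full rank in Z, so the kernel of c' has
    rank zero and the layer is good; in the second one c kills the layer. *)
Lemma layer_good_or_bad : good Z' Z \/ bad Z' Z.
Proof.
have exP : exists n, `[< exists2 c, regN c & rf rho Z' (M c) = n >].
  by exists (rf rho Z' (M 1)); apply/asboolP; exists 1 => //; exact: regN1.
case: (ex_minnP exP) => m /asboolP[c Cc rc] min_m.
have sat_min c' : regN c' -> M c `<=` sat (M c').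
  move=> Cc'; have [t Ct sub] := layer_ore Cc Cc'.
  apply: subset_trans (satS sub).
  have Mct : M (c * t) `<=` M c.
    apply: addm_sub => // _ [z Zz ->]; apply: addml => //.
    by exists (t * z); rewrite ?mulrA //; case: idZ => _; apply.
  apply: rk0_sat => //; apply/eqP; rewrite -leqn0 -(leq_add2l (rf rho Z' (M (c * t)))).
  rewrite addn0 -rf_add // rc; apply: min_m; apply/asboolP; exists (c * t) => //.
  exact: regNM.
have idY : two_sided_ideal (sat (M c)).
  split; first exact: submod_sat.
  move=> a y Sy b; have [t [a' [Ct Nt]]] := ore_mod noeth idN spN a Cc.
  have [u Cu [_ [z' [[z Zz ->] Zz' E]]]] := sat_sat (satS (sat_min t Ct) Sy) b.
  exists u => //; have -> : a * y * b * u = a * (y * b * u) by rewrite !mulrA.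
  rewrite E mulrDr.
  case: (sM c) => _ MD _; apply: (MD); last by apply: Z'M; case: idZ' => _; apply.
  rewrite mulrA -(subrK (c * a') (a * t)) mulrDl; apply: (MD).
    by apply: Z'M; exact: layer_N.
  by apply: addml => //; exists (a' * z); rewrite ?mulrA //; case: idZ => _; apply.
have [] := simple idY (@sat_sat _).
- exact: subset_trans (sub_sat (sM c)).
- by apply: subset_trans satZ; exact: satS.
- move=> EY; left=> c' x Cc' Zx Z'x.
  have r1 : rf rho (M c') Z = 0%N.
    apply: rk_sat => //; rewrite -{1}EY; apply: subset_trans (@sat_sat _).
    exact/satS/sat_min.
  pose K := Z `&` [set y : @regm R | Z' (c' * y)].
  have sK : submod K.
    apply: submodI => //; case: sZ' => Z0 ZD Zm.
    split=> [|u v|u a]; rewrite /= ?mulr0 // ?mulrDr ?mulrA; [exact: ZD | exact: Zm].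
  have Z'K : Z' `<=` K by move=> y Zy; split; [exact: Z'Z | case: idZ' => _; apply].
  have KZ : K `<=` Z by move=> y [].
  suff : K `<=` sat Z' by move=> KS; apply/satZ'/KS.
  apply: rk0_sat => //; apply/eqP; rewrite -leqn0 -(leq_add2r (rf rho K Z)).
  rewrite -rf_add // add0n (rf_add rho fR sZ' (sM c')) // r1 addn0.
  apply: (@rf_surj _ rho _ _ (fun y : regm => (c' : regm) ** y)) => //.
  + exact: rlinear_ract.
  + by move=> _ [y [_ Zy] <-].
  + by move=> _ [_ [z' [[y Zy ->] Zz' ->]]]; exists (c' * y), z'; split=> //; exists y.
- move=> EY; right; exists [set a | forall z, Z z -> Z' (a * z)]; split.
  + case: sZ' => Z0 ZD _; split; first split.
    * by move=> z _; rewrite mul0r.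
    * by move=> a b Ha Hb z Zz; rewrite mulrDl; apply: ZD; [exact: Ha | exact: Hb].
    * by move=> a b Ha z Zz; rewrite -mulrA; apply: Ha; case: idZ => _; apply.
    * by move=> a b Hb z Zz; rewrite -mulrA; case: idZ' => _; apply; exact: Hb.
  + exists c => // z Zz; rewrite -EY; apply: sub_sat => //; apply: addml => //.
    by exists z.
  + by move=> a x Ia Zx; exact: Ia.
Qed.

End Layer.

(** ** Chains of ideals *)

(** The boolean marks the bad layers. *)
Fixpoint chain Z (s : seq (bool * set (@regm R))) : Prop :=
  if s is (b, Z') :: s' then
    [/\ two_sided_ideal Z', Z' `<=` Z, (if b then bad Z' Z else good Z' Z) & chain Z' s']
  else Z = [set 0].

Hypothesis torsion_free : saturated [set 0].

(** Below Z take a largest proper saturated ideal; saturation makes the rank drop,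
    which ensures termination. *)
Lemma exists_chain Z : two_sided_ideal Z -> saturated Z -> exists s, chain Z s.
Proof.
have id0 : two_sided_ideal ([set 0] : set (@regm R)).
  by split; [exact: (submod0 (@regm R)) | move=> a x ->; rewrite mulr0].
pose rho := rkN setT.
move: {2}(rf rho [set 0] Z).+1 (ltnSn (rf rho [set 0] Z)) => n.
elim: n Z => [//|n IHn] Z rZ idZ satZ.
have [->|Z0] := pselect (Z = [set 0]); first by exists [::].
have sZ : submod Z by case: idZ.
pose P M := [/\ two_sided_ideal M, saturated M, M `<=` Z & M <> Z].
have [|Z' [sZ' [idZ' satZ' Z'Z Z'n] mZ']] := noeth_max noeth (P := P).
  exists [set 0]; split; first exact: submod0.
  by split=> //; [by move=> _ ->; case: sZ | exact: nesym].
have [|s Hs] := IHn Z' _ idZ' satZ'.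
  rewrite -ltnS; apply: leq_trans rZ; rewrite ltnS.
  have z'Z' : [set 0] `<=` Z' by move=> _ ->; case: sZ'.
  rewrite (rf_add rho fR (submod0 _) sZ' sZ) // -[leqLHS]addn0 ltn_add2l lt0n.
  apply/eqP => /rk0_sat-/(_ sZ' sZ Z'Z) ZS; apply: Z'n; apply/seteqP; split=> //.
  exact: subset_trans satZ'.
have [|H|H] := @layer_good_or_bad Z' Z idZ' idZ satZ' satZ Z'Z (nesym Z'n).
- move=> Y idY satY Z'Y YZ.
  have [->|YnZ] := pselect (Y = Z); [by left | right].
  by apply: mZ' => //; case: idY.
- by exists ((false, Z') :: s).
- by exists ((true, Z') :: s).
Qed.

(** The top layer R / N is good by the definition of C. *)
Lemma exists_chain_N : exists s, chain setT ((false, N) :: s).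
Proof.
have [s Hs] := exists_chain idN saturated_N.
by exists s; split=> // c x Cc _; exact: Cc.
Qed.

(** ** Counting bad layers *)

Section Count.
Variables (t : twist R) (r : rankfun R).
Notation d := (td t).
Notation V := (twm t (@regm R)).
Let fV : fg V. Proof. exact: fg_twm. Qed.

Fixpoint badsum (r' : rankfun R) Z (s : seq (bool * set (@regm R))) : nat :=
  if s is (b, Z') :: s' then ((if b then rf r' Z' Z else 0) + badsum r' Z' s')%N else 0%N.

Lemma badsum_le (r' : rankfun R) Z s : two_sided_ideal Z -> chain Z s ->
  (badsum r' Z s <= rf r' [set 0%R] Z)%N.
Proof.
elim: s Z => [//|[b Z'] s IHs] Z [sZ _] [idZ' Z'Z _ Cs]; have sZ' : submod Z' by case: idZ'.
have z'Z' : [set 0] `<=` Z' by move=> _ ->; case: sZ'.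
rewrite (rf_add r' fR (submod0 _) sZ' sZ) // [leqRHS]addnC /=; apply: leq_add.
  by case: b.
exact: IHs.
Qed.

(** The same count, for the filtration which the chain induces on a submodule of
    the twist and for the layers chosen by [sel]. *)
Fixpoint layersum (sel : bool -> bool) Z (s : seq (bool * set (@regm R))) (W : set V) : nat :=
  if s is (b, Z') :: s' then
    ((if sel b then rf r (W `&` tws Z') (W `&` tws Z) else 0) + layersum sel Z' s' W)%N
  else 0%N.

Let sWt (W : set V) Z : submod W -> two_sided_ideal Z -> submod (W `&` tws Z).
Proof. by move=> sW [sZ _]; apply: submodI => //; exact: submod_tws. Qed.

Lemma layersum_total Z s (W : set V) : submod W -> two_sided_ideal Z -> chain Z s ->
  rf r (W `&` tws [set 0]) (W `&` tws Z) = (layersum id Z s W + layersum negb Z s W)%N.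
Proof.
move=> sW; elim: s Z => [|[b Z'] s IHs] Z idZ /=.
  by move=> E; rewrite E in idZ *; rewrite rf_id //; exact: sWt.
move=> [idZ' Z'Z _ Cs]; have sZ' : submod Z' by case: idZ'.
have s0 : submod (W `&` tws [set 0]).
  by apply: submodI => //; apply: submod_tws; exact: submod0.
rewrite (rf_add r fV s0 (sWt sW idZ') (sWt sW idZ)).
- by rewrite IHs // addnACA addnC; congr (_ + _)%N; case: b; rewrite ?addn0 ?add0n.
- by move=> x [Wx x0]; split=> // i; rewrite (x0 i); case: sZ'.
- by move=> x [Wx Z'x]; split=> // i; exact: Z'Z.
Qed.

Lemma layersum_mono Z s (W' W : set V) : submod W' -> submod W -> W' `<=` W ->
  two_sided_ideal Z -> chain Z s -> (layersum id Z s W' <= layersum id Z s W)%N.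
Proof.
move=> sW' sW W'W; elim: s Z => [//|[b Z'] s IHs] Z idZ [idZ' Z'Z _ Cs] /=.
apply: leq_add; last exact: IHs.
case: b => //; apply: rf_le => //; do ?exact: sWt.
- by move=> x [Wx Z'x]; split=> // i; exact: Z'Z.
- by move=> x [Wx Z'x]; split=> // i; exact: Z'Z.
- by move=> x [/W'W Wx Zx].
- by move=> x [W'x _] [_ Z'x].
Qed.

(** On good layers multiplication by c embeds W into W'. *)
Lemma layersum_good Z s (W' W : set V) c : regN c -> submod W' -> submod W ->
  W' `<=` W -> (forall m, W m -> W' (lmul (t := t) c m)) ->
  two_sided_ideal Z -> chain Z s -> (layersum negb Z s W <= layersum negb Z s W')%N.
Proof.
move=> Cc sW' sW W'W cW; elim: s Z => [//|[b Z'] s IHs] Z idZ [idZ' Z'Z gb Cs] /=.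
apply: leq_add; last exact: IHs.
case: b gb => // gd; apply: (@rf_inj _ r _ _ (lmul (t := t) c)) => //; do ?exact: sWt.
- exact: rlinear_lmul.
- by move=> x [Wx Z'x]; split=> // i; exact: Z'Z.
- by move=> x [Wx Z'x]; split=> // i; exact: Z'Z.
- move=> _ [x [Wx Zx] <-]; split; first exact: cW.
  by move=> i; rewrite ffunE; case: idZ => _; apply; exact: Zx.
- move=> x [Wx Zx] [_ Z'cx]; split=> // i; apply: (gd c) => //.
  by have := Z'cx i; rewrite ffunE.
Qed.

(** The crucial inequality. The total rank of W is that of W' plus that of W / W',
    and the good layers contribute no more to W than to W'; therefore W / W' is
    paid for by the bad layers. *)
Lemma layersum_bad s (W' W : set V) c : regN c -> submod W' -> submod W ->
  W' `<=` W -> (forall m, W m -> W' (lmul (t := t) c m)) -> chain setT s ->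
  (layersum id setT s W' + rf r W' W <= layersum id setT s W)%N.
Proof.
move=> Cc sW' sW W'W cW Cs; have idT : two_sided_ideal ([set: @regm R] : set (@regm R)) by [].
have := layersum_total sW idT Cs; have := layersum_total sW' idT Cs.
have tT (X : set V) : X `&` tws setT = X by apply/seteqP; split=> // x [].
have t0 (X : set V) : submod X -> X `&` tws [set 0] = [set 0].
  move=> [X0 _ _]; apply/seteqP; split=> [x [_ x0]|_ ->].
    by apply/ffunP => i; rewrite ffunE; exact: x0.
  by split=> // i; rewrite ffunE.
rewrite !tT !t0 // => E' E.
have z (W0 : set V) : submod W0 -> [set (0 : V)] `<=` W0 by move=> [? _ _] _ ->.
have := rf_add r fV (submod0 V) sW' sW (z _ sW') W'W; rewrite E' E => {E E'} E.
have := layersum_good Cc sW' sW W'W cW idT Cs.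
rewrite -(leq_add2l (layersum id setT s W)) E.
by rewrite addnAC leq_add2r.
Qed.

Lemma layersum_top s : chain setT s ->
  layersum id setT s setT = badsum (rf_tw t r) setT s.
Proof.
move: [set: @regm R] => Z; elim: s Z => [//|[b Z'] s IHs] Z [_ _ _ Cs] /=.
by rewrite IHs // !setTI.
Qed.

(** A cancellable element whose images under all the operators [itw] lie in a
    given dense right ideal: the Ore condition for the coordinates. *)
Hypothesis itw_reg : forall I, submod I -> dense N I ->
  exists2 c, regN c & forall i j : 'I_d, I (itw i j c).

(** In coordinates left multiplication by c is given by the entries itw_ij(c), and
    for a suitable c they all lie in the ideal killing the layer. *)
Lemma cub_bad Z' Z : two_sided_ideal Z' -> two_sided_ideal Z -> bad Z' Z ->
  exists2 c, regN c & forall m, cub (t := t) Z m -> cub Z' (lmul (t := t) c m).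
Proof.
move=> [sZ' _] [sZ _] [I [idI [c0 Cc0 Ic0] IZ]]; have [sI lI] := idI.
have [|c Cc Hc] := itw_reg sI; first by move=> x; exists c0 => //; exact: lI.
by exists c => // m; apply: cub_tws => // j k x Zx; exact: IZ.
Qed.

(** Each bad layer of R gives d copies of itself in coordinates, each of which is
    again charged to the bad layers of the twist. *)
Lemma badsum_cub s0 Z s : chain setT s0 -> two_sided_ideal Z -> chain Z s ->
  (d * badsum r Z s <= layersum id setT s0 (cub (t := t) Z))%N.
Proof.
move=> Cs0; elim: s Z => [|[b Z'] s IHs] Z idZ; first by rewrite muln0.
move=> [idZ' Z'Z gb Cs] /=; have [sZ' _] := idZ'; have [sZ _] := idZ.
have sc' := @submod_cub R t _ sZ'; have sc := @submod_cub R t _ sZ.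
have cc : cub (t := t) Z' `<=` cub Z by exact: cubS.
case: b gb => [bd|_]; last first.
  rewrite add0n; apply: leq_trans (IHs _ idZ' Cs) _; exact: layersum_mono.
have [c Cc Hc] := cub_bad idZ' idZ bd.
apply: leq_trans (layersum_bad Cc sc' sc cc Hc Cs0).
rewrite mulnDr addnC leq_add //; first exact: IHs.
by rewrite cub_rank.
Qed.

(** The copies of the bad layers below N count d times the bad rank; the part
    coming from J lies above [cub N], and c0 kills it modulo [cub N]. *)
Lemma badsum_step s J c0 : regN c0 -> submod J -> (forall x, J x -> c0 * x = 0) ->
  chain setT ((false, N) :: s) ->
  (d * badsum r setT ((false, N) :: s) +
     rf r (cub (t := t) N) (addm (tws J) (cub (t := t) N))
   <= badsum (rf_tw t r) setT ((false, N) :: s))%N.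
Proof.
move=> Cc0 sJ cJ Cs; rewrite -layersum_top //.
have scN := @submod_cub R t _ sN; have stJ := @submod_tws R t _ _ sJ.
have sW := submod_addm stJ scN.
apply: leq_trans (layersum_mono sW (submodT _) _ _ Cs) => //.
apply: leq_trans (layersum_bad Cc0 scN sW _ _ Cs); last 2 first.
- exact: addmr.
- move=> _ [m [z [Jm Nz ->]]]; rewrite (rlinear_lmul t c0).1.
  have -> : lmul (t := t) c0 m = 0.
    by apply/ffunP => i; rewrite !ffunE; apply: cJ; exact: Jm.
  rewrite add0r; apply: (cub_tws (A := N)) => // j k x Nx; by case: idN => _; apply.
rewrite leq_add2r; have [_ _ _ CN] := Cs.
exact: (badsum_cub Cs idN CN).
Qed.

End Count.

(** ** The growth argument *)

Section Growth.
Variables (t : twist R) (E J : set (@regm R)) (c0 : R).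
Notation d := (td t).
Hypothesis itw_reg : forall I, submod I -> dense N I ->
  exists2 c, regN c & forall i j : 'I_d, I (itw i j c).
Hypotheses (sE : submod E) (sJ : submod J).
Hypothesis twE : forall (i j : 'I_d) e, E e -> E (tw i j e).
Hypotheses (Cc0 : regN c0) (cJ : forall x, J x -> c0 * x = 0).
Hypothesis EJ : forall e, E e -> exists m : 'I_d -> twm t (@regm R),
  (forall j, tws J (m j)) /\ e = \sum_j twcoord j (m j).

(** The rank for which modules killed by E are negligible, on n-fold twists. *)
Let alpha n := iter n (rf_tw t) (rkN E).
Let sEN : submod (addm E N). Proof. exact: submod_addm. Qed.
Let NEN : N `<=` addm E N. Proof. exact: addmr. Qed.
Let z0 L : submod L -> [set (0 : @regm R)] `<=` L. Proof. by case=> ? _ _ _ ->. Qed.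

Lemma alpha_free n :
  rf (alpha n) [set (0%R : @regm R)] setT = (d ^ n * rf (alpha 0) [set (0%R : @regm R)] setT)%N.
Proof.
elim: n => [|n IHn]; first by rewrite mul1n.
by rewrite /alpha iterS rank_twm_regm -/(alpha n) IHn mulnA expnS.
Qed.

(** E is stable under [tw], so twists of modules killed by E are killed by E. *)
Lemma alpha_killed n (V : rmod R) (L' L : set V) : submod L' -> submod L ->
  (forall x e, L x -> E e -> L' (x ** e)) -> rf (alpha n) L' L = 0%N.
Proof.
elim: n V L' L => [|n IHn] V L' L sL' sL H.
  by apply: rk_tors; apply: TorsE => x a e Lx Ee; apply: H => //; case: sL => _ _; apply.
apply: (IHn (twm t V)); [exact: submod_tws | exact: submod_tws |].
move=> x e Lx Ee i; rewrite ffunE; apply: submod_sum => // j _.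
by apply: H; [exact: Lx | exact: twE].
Qed.

Lemma rf_cmul (r : rankfun R) M L y : submod M -> submod L -> N `<=` L ->
  (forall n, N n -> M (y * n)) -> (rf r M (addm (cmul y L) M) <= rf r N L)%N.
Proof.
move=> sM sL NL yN; have sy := submod_cmul y sL.
apply: (@rf_surj _ r _ _ (fun a : regm => (y : regm) ** a)) => //.
- exact: rlinear_ract.
- exact: submod_addm.
- exact: addmr.
- by move=> _ [n Nn <-]; exact: yN.
- by move=> _ [_ [m [[x Lx ->] Mm ->]]]; exists (y * x), m; split=> //; exists x.
Qed.

(** A right ideal L, as large as possible, whose rank is bounded by a multiple of
    that of E + N contains a E for every a, since adding a E costs at most one
    more copy. *)
Lemma E_two_sided_bound : exists L, [/\ submod L, N `<=` L, (forall a e, E e -> L (a * e)) &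
  exists K, forall n, (rf (alpha n) N L <= K * rf (alpha n) N (addm E N))%N].
Proof.
pose P L := N `<=` L /\
  exists K, forall n, (rf (alpha n) N L <= K * rf (alpha n) N (addm E N))%N.
have [|L [sL [NL [K HK]] mL]] := noeth_max noeth (P := P).
  by exists N; split=> //; split=> //; exists 0%N => n; rewrite rf_id.
exists L; split=> //; last by exists K.
move=> a e Ee; have sa := submod_cmul a sE; have saL := submod_addm sa sL.
have LaL : L `<=` addm (cmul a E) L by exact: addmr.
suff <- : addm (cmul a E) L = L by apply: addml => //; exists e.
apply: mL => //; split; first exact: subset_trans LaL.
exists K.+1 => n; rewrite (rf_add _ fR sN sL saL) // mulSn addnC leq_add //.
apply: leq_trans (rf_cmul (alpha n) (y := a) sN sEN NEN _); last first.
  by move=> m Nm; case: idN => _; apply.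
have saN : submod (addm (cmul a (addm E N)) N) by apply: submod_addm => //; exact: submod_cmul.
apply: rf_ge => //; first exact/addmr/submod_cmul.
move=> _ [_ [l [[x Ex ->] Ll ->]]]; exists (a * x), l; split=> //.
by apply: addml => //; exists x => //; exact: addml.
Qed.

(** In a cyclic module y R killed by N, the part y L has rank at most that of
    L / N, and the rest is killed by E; R is made of finitely many of these. *)
Lemma alpha_bound : exists K, forall n,
  (rf (alpha n) [set (0%R : @regm R)] setT <= K * rf (alpha n) N (addm E N))%N.
Proof.
have [L [sL NL EL [K0 HK0]]] := E_two_sided_bound.
apply: (nil_filtration noeth idN nilN (P := fun L' L => exists K, forall n,
  (rf (alpha n) L' L <= K * rf (alpha n) N (addm E N))%N)).
- exact: submod0.
- by move=> M sM; exists 0%N => n; rewrite rf_id.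
- move=> M'' M' M sM'' sM' sM M''M' M'M [K HK] [K' HK']; exists (K + K')%N => n.
  by rewrite (rf_add _ fR sM'' sM' sM) // mulnDl leq_add.
- move=> M y sM _ yN; exists K0 => n; apply: leq_trans (HK0 n).
  have sy := submod_cmul y sL; have syM := submod_addm sy sM.
  have syR := submod_addm (submod_cyc (y : regm)) sM.
  have sub : addm (cmul y L) M `<=` addm (cyc (y : regm)) M.
    by apply: addmS => // _ [x _ ->]; exists x.
  rewrite (rf_add _ fR sM syM syR (addmr sy) sub).
  rewrite (@alpha_killed n _ (addm (cmul y L) M)) ?addn0 //; first exact: rf_cmul.
  move=> _ e [_ [m [[a _ <-] Mm ->]]] Ee; rewrite ractDl.
  case: (syM) => _ yD _; apply: yD.
    by apply: addml => //; exists (a * e); [exact: EL | rewrite mulrA].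
  by apply: addmr => //; case: sM => _ _; apply.
Qed.

(** The contribution of the twist of J modulo the copies of N. *)
Let y n := rf (alpha n) (cub (t := t) N) (addm (tws J) (cub (t := t) N)).

(** E is the sum of d images of the twist of J by coordinate maps, each of rank
    at most y n modulo N. *)
Lemma alpha_coord n : (rf (alpha n) N (addm E N) <= d * y n)%N.
Proof.
have fV : fg (twm t (@regm R)) by exact: fg_twm.
pose Ej j : set (@regm R) := @twcoord R t j @` tws J.
have stJ := @submod_tws R t _ _ sJ.
have sEj j : submod (Ej j) by exact: submod_image (rlinear_twcoord j) stJ.
pose S js := foldr (fun j L => addm (Ej j) L) N js.
have sS js : submod (S js) by elim: js => [//|j js IH]; exact: submod_addm.
have NS js : N `<=` S js.
  by elim: js => [//|j js IH]; apply: subset_trans IH _; exact: addmr.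
have bound js : (rf (alpha n) N (S js) <= size js * y n)%N.
  elim: js => [|j js IH]; first by rewrite rf_id.
  have SS : S js `<=` S (j :: js) by exact: addmr.
  rewrite (rf_add _ fR sN (sS js) (sS (j :: js))) // mulSn addnC leq_add //.
  have scN := @submod_cub R t _ sN.
  apply: (@rf_surj _ (alpha n) _ _ (@twcoord R t j)) => //.
  - exact: rlinear_twcoord.
  - exact: submod_addm.
  - exact: addmr.
  - by move=> _ [m Nm <-]; apply: NS; exact: Nm.
  - move=> _ [_ [x [[m Jm <-] Sx ->]]]; exists (twcoord j m), x; split=> //.
    by exists m => //; exact: addml.
have := bound (enum 'I_d); rewrite size_enum_ord; apply: leq_trans.
apply: rf_le => //; apply: addm_sub => // e /EJ[m [Jm ->]].
apply: submod_sum => // j _.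
have : j \in enum 'I_d by rewrite mem_enum.
elim: (enum 'I_d) => [//|k js IH]; rewrite inE => /orP[/eqP <-|/IH H].
  by apply: addml => //; exists (m j).
exact: addmr.
Qed.

(** Torsion cannot be seen on (E + N) / N: there C acts injectively, and x R E in N
    with x in E + N implies that x R x lies in N, so that x lies in N. *)
Lemma torsE_N L' L : tors regN E L' L ->
  (forall x, L' x -> addm E N x -> N x) -> forall x, L x -> addm E N x -> N x.
Proof.
have [_ END ENm] := sEN.
elim=> {L' L} [L' L H|L' L H|L' M L _ IH1 _ IH2] HN x Lx ENx.
- have [c Cc L'xc] := H x Lx; apply: (N_cancel noeth idN spN Cc).
  by apply: HN => //; exact: ENm.
- apply: spN => b; have [e [n [Ee Nn Ex]]] := ENx.
  rewrite {2}Ex mulrDr; case: (sN) => _ ND _; apply: ND; last by case: idN => _; apply.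
  by apply: HN; [exact: H | do 2 apply: (ENm)].
- by apply: IH2 => //; exact: IH1.
Qed.

(** If a = alpha_0(R) is not zero, b_(n+1) >= d b_n + y_n and d^n a <= K d y_n
    give n d^n a <= K d^2 b_n by induction, which contradicts b_n <= d^n a for
    large n. Hence R is torsion, and [torsE_N] applies. *)
Lemma coordinates_sub_N : E `<=` N.
Proof.
have [d0|d_gt0] := posnP d.
  move=> e /EJ[m [_ ->]]; rewrite big1; first by case: sN.
  by move=> j; have := ltn_ord j; rewrite {2}d0.
have [s Cs] := exists_chain_N; have [K HK] := alpha_bound.
set a := rf (alpha 0) [set (0%R : @regm R)] setT.
pose b n := badsum (alpha n) setT ((false, N) :: s).
have b_step n : (d * b n + y n <= b n.+1)%N.
  by rewrite /b {2}/alpha iterS; exact: badsum_step Cc0 sJ cJ Cs.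
have b_le n : (b n <= d ^ n * a)%N.
  by rewrite -alpha_free; exact: badsum_le.
have a_le n : (d ^ n * a <= K * (d * y n))%N.
  by rewrite -alpha_free; apply: leq_trans (HK n) _; rewrite leq_mul2l alpha_coord orbT.
have grow n : (n * (d ^ n * a) <= K * d * d * b n)%N.
  elim: n => [//|n IHn].
  apply: leq_trans (_ : K * d * d * (d * b n + y n) <= _)%N; last by rewrite leq_mul2l b_step orbT.
  rewrite mulnDr mulSn addnC expnS -mulnA leq_add //.
    by rewrite mulnCA [leqRHS]mulnCA leq_mul2l IHn orbT.
  have -> : (K * d * d * y n = d * (K * (d * y n)))%N by rewrite -!mulnA mulnCA.
  by rewrite leq_mul2l a_le orbT.
have a0 : a = 0%N.
  apply/eqP; rewrite -leqn0 leqNgt; apply/negP => a_gt0.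
  have := leq_trans (grow (K * d * d).+1) (leq_mul (leqnn _) (b_le _)).
  by rewrite leq_pmul2r ?ltnn // muln_gt0 expn_gt0 d_gt0.
have bR := bounded_R noeth idN spN nilN E.
have sub0 : [set (0 : @regm R)] `<=` setT by [].
have t0 := tors_rk (submod0 _) sub0 (bounded_in (@regN1 R N) bR setT fR (submod0 _)) a0.
move=> e Ee; apply: (torsE_N t0) => //; first by move=> _ -> _; case: sN.
exact: addml.
Qed.

End Growth.

End RegularModuloN.

(** * Localization at a right Ore set of regular elements *)

Record oreSet (R : pzRingType) := OreSet {
  oset : set R;
  oset1 : oset 1;
  osetM : forall s t, oset s -> oset t -> oset (s * t);
  oset_regl : forall s x, oset s -> s * x = 0 -> x = 0;
  oset_regr : forall s x, oset s -> x * s = 0 -> x = 0;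
  oset_ore : forall a s, oset s -> exists t b, oset t /\ a * t = s * b
}.

Section OreLocalization.
Variables (R : pzRingType) (O : oreSet R).
Notation S := (oset O).
Implicit Types (a b c s t x y z : R).

Lemma oset_injl s x y : S s -> s * x = s * y -> x = y.
Proof.
move=> Ss E; apply/eqP; rewrite -subr_eq0; apply/eqP/(oset_regl Ss).
by rewrite mulrBr E subrr.
Qed.

Lemma oset_injr s x y : S s -> x * s = y * s -> x = y.
Proof.
move=> Ss E; apply/eqP; rewrite -subr_eq0; apply/eqP/(oset_regr Ss).
by rewrite mulrBl E subrr.
Qed.

(** The fraction a s^-1 is encoded by its graph, the set of pairs (x, y) such that
    a s^-1 x = y. Equality of fractions becomes equality of sets, and sums and
    products can be computed on any common element of the domains. *)
Definition frac s a : set (R * R) :=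
  [set p | exists c b, [/\ S c, p.1 * c = s * b & p.2 * c = a * b]].

Definition ore_quot : Type := {G : set (R * R) | exists s a, S s /\ G = frac s a}.

HB.instance Definition _ := gen_eqMixin ore_quot.
HB.instance Definition _ := gen_choiceMixin ore_quot.

Implicit Types (q : ore_quot).

Definition qmem q x y : Prop := sval q (x, y).

Definition mkfrac s a (Ss : S s) : ore_quot :=
  exist _ (frac s a) (ex_intro _ s (ex_intro _ a (conj Ss erefl))).

Lemma frac_self s a : frac s a (s, a).
Proof. by exists 1, 1; split; rewrite ?mulr1 //; exact: oset1. Qed.

Lemma frac_eq s a s' a' : S s -> S s' -> frac s' a' (s, a) -> frac s a = frac s' a'.
Proof.
move=> Ss Ss' [c [b /= [Sc Es Ea]]]; apply/seteqP; split=> -[x y] [e [f /= [Se Ex Ey]]].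
  have [g [h [Sg E]]] := oset_ore f Sc.
  exists (e * g), (b * h); split=> /=; first exact: osetM.
    by rewrite mulrA Ex -mulrA E mulrA Es mulrA.
  by rewrite mulrA Ey -mulrA E mulrA Ea mulrA.
have [t [g [St E]]] := oset_ore (s' * f) (osetM Ss Sc).
have E' : f * t = b * g by apply: (oset_injl Ss'); rewrite !mulrA -Es E.
exists (e * t), (c * g); split=> /=; first exact: osetM.
  by rewrite mulrA Ex E mulrA.
by rewrite mulrA Ey -mulrA E' !mulrA Ea.
Qed.

Lemma qfrac q : exists s a, [/\ S s & sval q = frac s a].
Proof. by case: q => G [s [a [Ss E]]]; exists s, a. Qed.

(** The graph is that of a function on a right ideal meeting S. *)
Lemma qmem_fun q x y y' : qmem q x y -> qmem q x y' -> y = y'.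
Proof.
rewrite /qmem; have [s [a [Ss ->]]] := qfrac q.
move=> [c [b /= [Sc Ex Ey]]] [c' [b' /= [Sc' Ex' Ey']]].
have [t [u [St E]]] := oset_ore c Sc'.
have E' : b * t = b' * u by apply: (oset_injl Ss); rewrite !mulrA -Ex -Ex' -!mulrA E.
apply: (oset_injr (osetM Sc St)).
by rewrite mulrA Ey -mulrA E' mulrA -Ey' -mulrA -E.
Qed.

Lemma qmemM q x y a : qmem q x y -> qmem q (x * a) (y * a).
Proof.
rewrite /qmem; have [s [a' [Ss ->]]] := qfrac q.
move=> [c [b /= [Sc Ex Ey]]]; have [t [u [St E]]] := oset_ore a Sc.
by exists t, (b * u); split=> //=; rewrite -mulrA E mulrA ?Ex ?Ey mulrA.
Qed.

Lemma qmemD q x y x' y' : qmem q x y -> qmem q x' y' -> qmem q (x + x') (y + y').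
Proof.
rewrite /qmem; have [s [a [Ss ->]]] := qfrac q.
move=> [c [b /= [Sc Ex Ey]]] [c' [b' /= [Sc' Ex' Ey']]].
have [t [u [St E]]] := oset_ore c Sc'.
exists (c * t), (b * t + b' * u); split=> /=; first exact: osetM.
  by rewrite mulrDl {2}E !mulrA Ex Ex' -!mulrA -mulrDr.
by rewrite mulrDl {2}E !mulrA Ey Ey' -!mulrA -mulrDr.
Qed.

Lemma qmem_dom q x : exists c y, S c /\ qmem q (x * c) y.
Proof.
rewrite /qmem; have [s [a [Ss ->]]] := qfrac q.
have [t [b [St E]]] := oset_ore x Ss; exists t, (a * b); split=> //.
by exists 1, b; rewrite !mulr1; split=> //; exact: oset1.
Qed.

Lemma qmem_rep q : exists s a, S s /\ qmem q s a.
Proof.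
by have [s [a [Ss E]]] := qfrac q; exists s, a; rewrite /qmem E; split=> //; exact: frac_self.
Qed.

(** A fraction is determined by its value at one element of S. *)
Lemma ore_quot_eq q q' x y : S x -> qmem q x y -> qmem q' x y -> q = q'.
Proof.
have [[s [a [Ss E]]] [s' [a' [Ss' E']]]] := (qfrac q, qfrac q').
rewrite /qmem E E' => Sx H H'.
case: q q' E E' => G p [G' p'] /= E E'; apply: eq_exist; rewrite E E'.
by rewrite -(frac_eq Sx Ss H) -(frac_eq Sx Ss' H').
Qed.

Lemma mkfrac_self s a (Ss : S s) : qmem (mkfrac a Ss) s a.
Proof. exact: frac_self. Qed.

Lemma common q q' : exists w : R * R * R,
  [/\ S w.1.1, qmem q w.1.1 w.1.2 & qmem q' w.1.1 w.2].
Proof.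
have [s [a [Ss Hs]]] := qmem_rep q; have [c [y [Sc Hc]]] := qmem_dom q' s.
by exists (s * c, a * c, y); split=> //=; [exact: osetM | exact: qmemM].
Qed.

Lemma composable q q' : exists w : R * R * R,
  [/\ S w.1.1, qmem q' w.1.1 w.1.2 & qmem q w.1.2 w.2].
Proof.
have [s [a [Ss Hs]]] := qmem_rep q'; have [c [y [Sc Hc]]] := qmem_dom q a.
by exists (s * c, a * c, y); split=> //=; [exact: osetM | exact: qmemM].
Qed.

Definition ore_add q q' : ore_quot :=
  let: exist w (And3 Sw _ _) := cid (common q q') in mkfrac (w.1.2 + w.2) Sw.
Definition ore_mul q q' : ore_quot :=
  let: exist w (And3 Sw _ _) := cid (composable q q') in mkfrac w.2 Sw.
Definition ore_in a : ore_quot := mkfrac a (oset1 O).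

Lemma ore_addP q q' x y y' : qmem q x y -> qmem q' x y' -> qmem (ore_add q q') x (y + y').
Proof.
rewrite /ore_add; case: cid => -[[x0 y0] y0'] /= [Sx0 H0 H0'] H H'.
have [t [b [St E]]] := oset_ore x Sx0; exists t, b; split=> //=.
rewrite !mulrDl (qmem_fun (qmemM t H) _ (y' := y0 * b)) 1?E; last exact: qmemM.
by rewrite (qmem_fun (qmemM t H') _ (y' := y0' * b)) // E; exact: qmemM.
Qed.

Lemma ore_mulP q q' x y z : qmem q' x y -> qmem q y z -> qmem (ore_mul q q') x z.
Proof.
rewrite /ore_mul; case: cid => -[[x0 y0] z0] /= [Sx0 H0' H0] H' H.
have [t [b [St E]]] := oset_ore x Sx0; exists t, b; split=> //=.
have Ey : y * t = y0 * b by apply: (qmem_fun (qmemM t H')); rewrite E; exact: qmemM.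
by apply: (qmem_fun (qmemM t H)); rewrite Ey; exact: qmemM.
Qed.

Lemma ore_inP a x : qmem (ore_in a) x (a * x).
Proof. by exists 1, x; rewrite !mulr1 mul1r; split=> //; exact: oset1. Qed.

Lemma common3 q q' q'' : exists x y y' y'',
  [/\ S x, qmem q x y, qmem q' x y' & qmem q'' x y''].
Proof.
have [[[x y] y'] /= [Sx H H']] := common q q'; have [c [z [Sc Hc]]] := qmem_dom q'' x.
by exists (x * c), (y * c), (y' * c), z; split; [exact: osetM|exact: qmemM|exact: qmemM|].
Qed.

Lemma ore_addA : associative ore_add.
Proof.
move=> q q' q''; have [x [y [y' [y'' [Sx H H' H'']]]]] := common3 q q' q''.
apply: (ore_quot_eq Sx (ore_addP H (ore_addP H' H''))).
by rewrite addrA; exact: ore_addP (ore_addP H H') H''.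
Qed.

Lemma ore_addC : commutative ore_add.
Proof.
move=> q q'; have [[[x y] y'] /= [Sx H H']] := common q q'.
by apply: (ore_quot_eq Sx (ore_addP H H')); rewrite addrC; exact: ore_addP.
Qed.

Lemma ore_add0 : left_id (ore_in 0) ore_add.
Proof.
move=> q; have [x [y [Sx H]]] := qmem_rep q.
by apply: (ore_quot_eq Sx _ H); have := ore_addP (ore_inP 0 x) H; rewrite mul0r add0r.
Qed.

Definition ore_opp q : ore_quot := ore_mul (ore_in (-1)) q.

Lemma ore_addN : left_inverse (ore_in 0) ore_opp ore_add.
Proof.
move=> q; have [x [y [Sx H]]] := qmem_rep q.
apply: (ore_quot_eq Sx (ore_addP (ore_mulP H (ore_inP (-1) y)) H)).
by rewrite mulN1r addNr; have := ore_inP 0 x; rewrite mul0r.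
Qed.

HB.instance Definition _ := GRing.isZmodule.Build ore_quot ore_addA ore_addC ore_add0 ore_addN.

Lemma ore_mulA : associative ore_mul.
Proof.
move=> q q' q''; have [[[x y] z] /= [Sx H'' H']] := composable q' q''.
have [c [w [Sc Hw]]] := qmem_dom q z.
have [{}H'' {}H'] := (qmemM c H'', qmemM c H').
apply: (ore_quot_eq (osetM Sx Sc) (ore_mulP (ore_mulP H'' H') Hw)).
exact: ore_mulP H'' (ore_mulP H' Hw).
Qed.

Lemma ore_1mul : left_id (ore_in 1) ore_mul.
Proof.
move=> q; have [x [y [Sx H]]] := qmem_rep q.
by apply: (ore_quot_eq Sx _ H); have := ore_mulP H (ore_inP 1 y); rewrite mul1r.
Qed.

Lemma ore_mul1 : right_id (ore_in 1) ore_mul.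
Proof.
move=> q; have [x [y [Sx H]]] := qmem_rep q.
by apply: (ore_quot_eq Sx _ H); apply: ore_mulP H; have := ore_inP 1 x; rewrite mul1r.
Qed.

Lemma ore_mulDl : left_distributive ore_mul ore_add.
Proof.
move=> q q' q''; have [[[x y] z] /= [Sx H'' H]] := composable q q''.
have [c [w [Sc Hw]]] := qmem_dom q' y.
have [{}H'' {}H] := (qmemM c H'', qmemM c H).
apply: (ore_quot_eq (osetM Sx Sc) (ore_mulP H'' (ore_addP H Hw))).
exact: ore_addP (ore_mulP H'' H) (ore_mulP H'' Hw).
Qed.

Lemma ore_mulDr : right_distributive ore_mul ore_add.
Proof.
move=> q q' q''; have [[[x y] y'] /= [Sx H' H'']] := common q' q''.
have [c [z [Sc Hz]]] := qmem_dom q y; have [{}H' {}H''] := (qmemM c H', qmemM c H'').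
have [e [z' [Se Hz']]] := qmem_dom q (y' * c).
have [{}H' {}H'' {}Hz] := And3 (qmemM e H') (qmemM e H'') (qmemM e Hz).
apply: (ore_quot_eq (osetM (osetM Sx Sc) Se) (ore_mulP (ore_addP H' H'') (qmemD Hz Hz'))).
exact: ore_addP (ore_mulP H' Hz) (ore_mulP H'' Hz').
Qed.

HB.instance Definition _ := GRing.Zmodule_isPzRing.Build ore_quot
  ore_mulA ore_1mul ore_mul1 ore_mulDl ore_mulDr.

Lemma ore_in_is_zmod_morphism : zmod_morphism ore_in.
Proof.
move=> a b; rewrite -[RHS]/(ore_add _ (ore_opp _)).
apply: (ore_quot_eq (oset1 O) (ore_inP _ 1)); rewrite mulrBl -mulN1r.
apply: ore_addP (ore_inP _ _) _; exact: ore_mulP (ore_inP _ _) (ore_inP _ _).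
Qed.

Lemma ore_in_is_monoid_morphism : monoid_morphism ore_in.
Proof.
split=> // a b; rewrite -[RHS]/(ore_mul _ _).
apply: (ore_quot_eq (oset1 O) (ore_inP _ 1)); rewrite -mulrA.
exact: ore_mulP (ore_inP _ _) (ore_inP _ _).
Qed.

HB.instance Definition _ := GRing.isZmodMorphism.Build R ore_quot ore_in
  ore_in_is_zmod_morphism.
HB.instance Definition _ := GRing.isMonoidMorphism.Build R ore_quot ore_in
  ore_in_is_monoid_morphism.

Lemma ore_in_inj : injective ore_in.
Proof.
move=> a b E; have := ore_inP b 1; rewrite -E => /(qmem_fun (ore_inP a 1)).
by rewrite !mulr1.
Qed.

Definition ore_inv s (Ss : S s) : ore_quot := mkfrac 1 Ss.

Lemma ore_invP s (Ss : S s) : two_sided_inverse (ore_in s : ore_quot) (ore_inv Ss).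
Proof.
have H := mkfrac_self 1 Ss; split.
  apply: (ore_quot_eq Ss (ore_mulP H (ore_inP s 1))).
  by have := ore_inP 1 s; rewrite mul1r mulr1.
apply: (ore_quot_eq (oset1 O)); last exact: ore_inP.
by apply: (ore_mulP (ore_inP s 1)); rewrite !mulr1.
Qed.

Lemma ore_quot_frac q : exists s a (Ss : S s), q = ore_in a * ore_inv Ss.
Proof.
have [s [a [Ss H]]] := qmem_rep q; exists s, a, Ss; apply: (ore_quot_eq Ss H).
by have := ore_mulP (mkfrac_self 1 Ss) (ore_inP a 1); rewrite mulr1.
Qed.

End OreLocalization.

(** * The artinian quotient ring *)

Section Small.
Variable R : pzRingType.
Hypothesis noeth : right_noetherian R.
Implicit Types (I J L M U W Z Y : set (@regm R)).

Variable N : set (@regm R).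
Hypothesis idN : two_sided_ideal N.
Hypothesis spN : forall a, (forall b, N (a * b * a)) -> N a.
Hypothesis nilN : nilpotent_ideal N.
Notation regN := (regN N).
Notation rho := (rkN noeth idN spN nilN setT).
Hypothesis torsion_free : saturated N [set 0].
Hypothesis reg_inj : forall c x, regN c -> c * x = 0 -> x = 0.

Let fR := fg_regm R.
Let sN : submod N. Proof. by case: idN. Qed.
Let z : set (@regm R) := [set 0].
Let s0 : submod z := submod0 (@regm R).

(** An injective left multiplication by s embeds R into s R, so that R / s R has
    rank zero and is torsion. This is the Ore condition in R itself. *)
Lemma inj_dense s : (forall x, s * x = 0 -> x = 0) ->
  forall a, exists2 c, regN c & exists b, a * c = s * b.
Proof.
move=> inj a; have ss := submod_cyc (s : @regm R).
have z0 : z `<=` cyc (s : @regm R) by move=> _ ->; case: ss.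
have le : (rf rho z setT <= rf rho z (cyc (s : @regm R)))%N.
  apply: (@rf_inj _ rho _ _ (fun x : regm => (s : regm) ** x)) => //.
  - exact: rlinear_ract.
  - by move=> x _ E; exact: inj E.
have r0 : rf rho (cyc (s : @regm R)) setT = 0%N.
  apply/eqP; rewrite -leqn0 -(leq_add2l (rf rho z (cyc (s : @regm R)))).
  by rewrite addn0 -rf_add.
have dS := rk0_sat ss (submodT _) (fun _ _ => I) r0.
have [c Cc [b _ E]] := dS a I 1.
by exists c => //; exists b; rewrite -[a]mulr1 -E.
Qed.

Lemma reg_injr c x : regN c -> x * c = 0 -> x = 0.
Proof.
move=> Cc xc0; apply: torsion_free => a.
have [t Ct [b E]] := inj_dense (fun y => @reg_inj c y Cc) a.
by exists t => //=; rewrite -mulrA E mulrA xc0 mul0r.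
Qed.

(** R / (s R + N) has rank zero. Multiplication by s maps R / K onto
    (s R + N) / N, where K is the annihilator of s modulo N; comparing ranks,
    K / N has rank zero, whereas R / N is torsion-free. *)
Lemma regular_regN s : regular s -> regN s.
Proof.
move=> [_ inj]; pose K : set (@regm R) := [set x | N (s * x)].
have sK : submod K := submod_ann idN s.
have NK : N `<=` K by move=> x Nx; case: idN => _; apply.
suff KN : K `<=` N by move=> x Nx; exact: KN.
have sP := submod_princ idN s; have NP : N `<=` princ N s by exact/addmr/submod_cyc.
have rP : rf rho (princ N s) setT = 0%N.
  apply: (rf_dense noeth idN nilN rho sP) => a; have [c Cc [b E]] := inj_dense inj a.
  by exists c => //; rewrite E; apply: addml => //; exists b.
have le : (rf rho N (princ N s) <= rf rho K setT)%N.
  apply: (@rf_surj _ rho _ _ (fun x : regm => (s : regm) ** x)) => //.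
  - exact: rlinear_ract.
  - by move=> _ [x Kx <-].
apply: (subset_trans _ (saturated_N noeth idN spN)); apply: rk0_sat => //.
apply/eqP; rewrite -leqn0 -(leq_add2r (rf rho K setT)) add0n -rf_add //.
by rewrite (rf_add rho fR sN sP) // rP addn0.
Qed.

Definition reg_ore : oreSet R.
Proof.
apply: (@OreSet R regN).
- exact: regN1.
- exact: regNM.
- exact: reg_inj.
- by move=> s x; exact: reg_injr.
- move=> a s Cs; have [c Cc [b E]] := inj_dense (fun y => @reg_inj s y Cs) a.
  by exists c, b.
Defined.

(** A right ideal I of the quotient ring is determined by its trace on R, and a
    strict inclusion changes the rank of the trace. *)
Lemma ore_artinian : right_artinian (ore_quot reg_ore).
Proof.
move=> I idI decI; pose L n : set (@regm R) := [set x | I n (ore_in reg_ore x : ore_quot _)].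
have sL n : submod (L n).
  have [I0 ID Im] := idI n; split; first by rewrite /L /= raddf0.
    by move=> x y; rewrite /L /= raddfD; exact: ID.
  by move=> x a; rewrite /L /= rmorphM; exact: Im.
have LS m n : (m <= n)%N -> L n `<=` L m.
  move=> /subnK <-; elim: (n - m)%N => [//|k IHk] x; rewrite addSn => Lx.
  by apply: IHk; exact: decI.
have IS m n : (m <= n)%N -> I n `<=` I m.
  move=> /subnK <-; elim: (n - m)%N => [//|k IHk] x; rewrite addSn => Lx.
  by apply: IHk; exact: decI.
pose P m := `[< exists n, rf rho (L n) setT = m >].
have exP : exists m, P m by exists (rf rho (L 0%N) setT); apply/asboolP; exists 0%N.
have bR := bounded_R noeth idN spN nilN setT.
have z0 n : z `<=` L n by move=> _ ->; case: (sL n).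
have ubP m : P m -> (m <= rf rho z setT)%N.
  move=> /asboolP[n <-]; rewrite (rf_add rho fR s0 (sL n) (submodT _) (z0 n)) //.
  exact: leq_addl.
case: (ex_maxnP exP ubP) => m /asboolP[k rk] max_m; exists k => n kn.
apply/seteqP; split; first exact: IS.
have LL : L k `<=` sat N (L n).
  apply: rk0_sat => //; first exact: LS.
  apply/eqP; rewrite -leqn0 -(leq_add2r (rf rho (L k) setT)) add0n.
  rewrite -rf_add //; last exact: LS.
  by rewrite rk; apply: max_m; apply/asboolP; exists n.
move=> q Iq; have [s [a [Ss Eq]]] := ore_quot_frac q; subst q.
have [Ei Ei'] := ore_invP Ss; have [_ _ Im] := idI k; have [_ _ Im'] := idI n.
have La : L k a.
  by have := Im _ (ore_in reg_ore s : ore_quot _) Iq; rewrite -mulrA Ei' mulr1.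
have [c Cc Lac] := LL a La 1; apply: (Im').
have [Ec Ec'] := @ore_invP R reg_ore c Cc.
have Iac : I n (ore_in reg_ore (a * 1 * c) : ore_quot _) := Lac.
have := Im' _ (@ore_inv R reg_ore c Cc) Iac.
by rewrite mulr1 rmorphM -mulrA Ec mulr1.
Qed.

(** Small's theorem in the form needed here: the elements of C are the regular
    elements, they form an Ore set, and ranks bound chains of right ideals. *)
Theorem artinian_quotient_ring : exists (Q : pzRingType) (i : {rmorphism R -> Q}),
  classical_right_quotient_ring i /\ right_artinian Q.
Proof.
exists (ore_quot reg_ore), (ore_in reg_ore : {rmorphism R -> ore_quot reg_ore}).
split; last exact: ore_artinian.
split.
- exact: ore_in_inj.
- by move=> s /regular_regN Cs; exists (@ore_inv R reg_ore s Cs); exact: ore_invP.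
- move=> q; have [s [a [Ss ->]]] := ore_quot_frac q; exists a, s, (ore_inv Ss).
  split=> //; last exact: ore_invP.
  by split=> x; [exact: reg_injr | exact: reg_inj].
Qed.

End Small.

(** * Comatrices in a Hopf algebra *)

(** In a space of arbitrary dimension a finite free family has dual functionals:
    by Zorn's lemma its span has a complement. *)
Lemma dual_functionals (k : fieldType) (V : lmodType k) d (v : 'I_d -> V) :
  (forall c : 'I_d -> k, \sum_i c i *: v i = 0 -> forall i, c i = 0) ->
  exists f : 'I_d -> V -> k,
    (forall i a x y, f i (a *: x + y) = a * f i x + f i y) /\
    (forall i j, f i (v j) = (i == j)%:R).
Proof.
move=> free_v.
pose P (X : set V) := (forall (a : k) x y, X x -> X y -> X (a *: x + y)) /\
  forall c : 'I_d -> k, X (\sum_i c i *: v i) -> forall i, c i = 0.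
have [F FP totF|A [[clA fA] maxA]] := @Zorn_bigcup V P.
  split=> [a x y [X FX Xx] [Y FY Yy]|c [X FX Xc]]; last by case: (FP X FX) => _; apply.
  have [XY|YX] := totF X Y FX FY.
    by exists Y => //; case: (FP Y FY) => cl _; apply: cl => //; exact: XY.
  by exists X => //; case: (FP X FX) => cl _; apply: cl => //; exact: YX.
have A0 : A 0.
  have [[x Ax]|noA] := pselect (exists x, A x).
    by have := clA (-1) x x Ax Ax; rewrite scaleN1r addNr.
  exfalso; apply: (maxA [set 0]).
    by split=> [x Ax|/(_ 0 erefl) A0]; case: noA; [exists x | exists 0].
  split=> [a x y -> ->|c E]; first by rewrite scaler0 addr0.
  exact: free_v.
have AZ a x : A x -> A (a *: x) by move=> Ax; rewrite -[a *: x]addr0; exact: clA.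
have AD x y : A x -> A y -> A (x + y) by move=> Ax Ay; rewrite -[x]scale1r; exact: clA.
have split_A x : exists c : 'I_d -> k, A (x - \sum_i c i *: v i).
  apply: contrapT => nox.
  apply: (maxA [set y | exists a l, A a /\ y = a + l *: x]).
    split=> [a Aa|H]; first by exists a, 0; rewrite scale0r addr0.
    apply: nox; exists (fun=> 0); rewrite big1 => [|i _]; last by rewrite scale0r.
    by rewrite subr0; apply: H; exists 0, 1; rewrite scale1r add0r.
  split=> [a _ _ [y [l [Ay ->]]] [z [m [Az ->]]]|c [a [l [Aa E]]]].
    exists (a *: y + z), (a * l + m); split; first exact: clA.
    by rewrite scalerDr scalerDl scalerA addrACA.
  have [l0|l0] := eqVneq l 0.
    by apply: fA; rewrite E l0 scale0r addr0.
  exfalso; apply: nox; exists (fun i => l^-1 * c i).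
  have -> : \sum_i (l^-1 * c i) *: v i = l^-1 *: a + x.
    under eq_bigr => i _ do rewrite -scalerA.
    by rewrite -scaler_sumr E scalerDr scalerA mulVf // scale1r.
  by rewrite opprD addrCA subrr addr0 -scaleN1r; exact/AZ/AZ.
have [f Hf] := choice split_A.
have f_uniq x c : A (x - \sum_i c i *: v i) -> f x = c.
  move=> Ac; apply/funext => i; apply/eqP; rewrite -subr_eq0; apply/eqP.
  apply: (fA (fun i => f x i - c i)).
  under eq_bigr => j _ do rewrite scalerBl.
  rewrite sumrB -[X in A X](subrKA x) -opprB.
  by rewrite addrC; apply: AD => //; rewrite -scaleN1r; exact: AZ.
exists (fun i x => f x i); split=> [i a x y|i j].
  rewrite (f_uniq _ (fun i => a * f x i + f y i)) //.
  under eq_bigr => j _ do rewrite scalerDl -scalerA.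
  rewrite big_split -scaler_sumr /= opprD addrACA -scalerBr.
  exact: clA.
rewrite (f_uniq _ (fun i => (i == j)%:R)) // (bigD1 j) //= eqxx scale1r.
rewrite big1 ?addr0 ?subrr // => l /negbTE ->; exact: scale0r.
Qed.

Section TensorFunctional.
Variables (k : fieldType).

Lemma tlift_fun_bilin (V W : lmodType k) (f : V -> k) :
  (forall a x y, f (a *: x + y) = a * f x + f y) ->
  bilinear_for *:%R *:%R (fun (x : V) (w : W) => f x *: w).
Proof.
move=> fl; split=> [w a x y|x a w w'] /=; first by rewrite fl scalerDl scalerA.
by rewrite scalerDr !scalerA mulrC.
Qed.

Lemma tlift_fun_bilinr (V W : lmodType k) (f : W -> k) :
  (forall a x y, f (a *: x + y) = a * f x + f y) ->
  bilinear_for *:%R *:%R (fun (x : V) (w : W) => f w *: x).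
Proof.
move=> fl; split=> [w a x y|x a w w'] /=; first by rewrite scalerDr !scalerA mulrC.
by rewrite fl scalerDl scalerA.
Qed.

Lemma tlift_linear_sum (U V W : lmodType k) (f : U -> V -> W) (I : finType)
    (z : I -> U \ox V) : bilinear_for *:%R *:%R f ->
  tlift f (\sum_i z i) = \sum_i tlift f (z i).
Proof.
move=> fb; apply: (big_morph (tlift f)) => [x y|].
  by have := tlift_linear fb 1 x y; rewrite /= !scale1r.
by have := tlift_linear fb (-1) 0 0; rewrite /= !scaleN1r !addNr.
Qed.

End TensorFunctional.

Section Comatrix.
Variables (k : fieldType) (H : hopfAlgType k).

(** The coefficients of a finite-dimensional comodule in a basis. *)
Definition comatrix (I : finType) (t : I -> I -> H) : Prop :=
  (forall i j, comul (t i j) = \sum_l t i l \ot t l j) /\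
  (forall i j, counit (t i j) = (i == j)%:R).

Lemma counitP a (x y : H) : counit (a *: x + y) = a * counit x + counit y.
Proof. by rewrite linearP. Qed.

Lemma assoc_inner_bilin (w : H) :
  bilinear_for *:%R *:%R (fun u v : H => u \ot (v \ot w) : H \ox (H \ox H)).
Proof.
split=> [v a u u'|u a v v'] /=; first by rewrite linearPl.
by rewrite linearPl linearPr.
Qed.

Lemma assoc_bilin : bilinear_for *:%R *:%R
  (fun (x : H \ox H) (w : H) => tlift (fun u v : H => u \ot (v \ot w)) x : H \ox (H \ox H)).
Proof.
split=> [w a x y|x a w w'] /=; first exact: tlift_linear (assoc_inner_bilin w) _ _ _.
rewrite /tlift scaler_sumr -big_split /=; apply: eq_bigr => p _.
by rewrite linearPr linearPr.
Qed.

Lemma assoc_pure (a b w : H) : tensor_assoc ((a \ot b) \ot w) = a \ot (b \ot w).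
Proof.
rewrite /tensor_assoc tlift_pure; last exact: assoc_bilin.
by rewrite tlift_pure //; exact: assoc_inner_bilin.
Qed.

Lemma assoc_sum (I : finType) (y : I -> H \ox H) (w : I -> H) :
  tensor_assoc (\sum_i y i \ot w i) = \sum_i tensor_assoc (y i \ot w i).
Proof.
rewrite /tensor_assoc tlift_sum; last exact: assoc_bilin.
by apply: eq_bigr => i _; rewrite tlift_pure //; exact: assoc_bilin.
Qed.

Lemma assoc_linearl (w : H) : linear (fun y : H \ox H => tensor_assoc (y \ot w)).
Proof.
by move=> a y z /=; rewrite linearPl /tensor_assoc tlift_linear //; exact: assoc_bilin.
Qed.

(** Coassociativity, for an explicit expression of the coproduct. *)
Lemma coassoc (I : finType) (g : H) (x u : I -> H) :
  comul g = \sum_i x i \ot u i ->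
  \sum_i x i \ot comul (u i) = \sum_i tensor_assoc (comul (x i) \ot u i).
Proof.
move=> Eg; have := comulA g; rewrite Eg /tensor_map tlift_sum; last first.
  by split=> [v a y z|v a y z] /=; rewrite ?linearP ?linearPl ?linearPr.
rewrite tlift_sum; last first.
  by split=> [v a y z|v a y z] /=; rewrite ?linearP ?linearPl ?linearPr.
by rewrite assoc_sum => ->.
Qed.

Lemma assoc_funl (f : H -> k) (y : H \ox H) (w : H) :
  (forall a x z, f (a *: x + z) = a * f x + f z) ->
  tlift (fun (a : H) (z : H \ox H) => f a *: z) (tensor_assoc (y \ot w))
    = tlift (fun a b : H => f a *: b) y \ot w.
Proof.
move=> fl; move: y; apply: tensor_ext => [a y z|a y z|a b].
- rewrite /= assoc_linearl tlift_linear //; exact: tlift_fun_bilin.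
- by rewrite /= tlift_linear ?linearPl //; exact: tlift_fun_bilin.
rewrite assoc_pure !tlift_pure; try exact: tlift_fun_bilin.
by rewrite linearZl_LR.
Qed.

(** Applying a functional to the third factor. Together with a functional on the
    first factor this extracts coefficients from coassociativity. *)
Definition contract3 (e : H -> k) : H \ox (H \ox H) -> H \ox H :=
  tlift (fun (a : H) (z : H \ox H) => a \ot tlift (fun b w : H => e w *: b) z).

Lemma contract3_bilin (e : H -> k) : (forall a x z, e (a *: x + z) = a * e x + e z) ->
  bilinear_for *:%R *:%R
    (fun (a : H) (z : H \ox H) => a \ot tlift (fun b w : H => e w *: b) z).
Proof.
move=> el; split=> [z a x y|x a y z] /=; first by rewrite linearPl.
by rewrite tlift_linear ?linearPr //; exact: tlift_fun_bilinr.
Qed.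

Lemma contract3_assoc (e : H -> k) (y : H \ox H) (w : H) :
  (forall a x z, e (a *: x + z) = a * e x + e z) ->
  contract3 e (tensor_assoc (y \ot w)) = e w *: y.
Proof.
move=> el; move: y; apply: tensor_ext => [a y z|a y z|a b].
- by rewrite /= assoc_linearl /contract3 tlift_linear //; exact: contract3_bilin.
- by rewrite /= scalerDr !scalerA mulrC.
rewrite assoc_pure /contract3 tlift_pure; last exact: contract3_bilin.
by rewrite tlift_pure ?linearZr_LR //; exact: tlift_fun_bilinr.
Qed.

Lemma dependent_lift (V : lmodType k) d (v : 'I_d.+1 -> V) (c : 'I_d.+1 -> k) i :
  \sum_j c j *: v j = 0 -> c i != 0 ->
  exists a : 'I_d -> k, v i = \sum_j a j *: v (lift i j).
Proof.
rewrite (bigD1_ord i) //= => E ci; exists (fun j => - (c i)^-1 * c (lift i j)).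
under eq_bigr => j _ do rewrite -scalerA.
rewrite -scaler_sumr; move/eqP: E; rewrite addr_eq0 => /eqP E.
by rewrite scaleNr -scalerN -E scalerA mulVf // scale1r.
Qed.

Section Representation.
Variables (m : nat) (g : 'I_m -> H).

Definition represents d (x : 'I_m -> 'I_d -> H) (u : 'I_d -> H) : Prop :=
  forall l, comul (g l) = \sum_i x l i \ot u i.

Lemma exists_represents : exists d x u, @represents d x u.
Proof.
pose L := flatten [seq [seq (l, p) | p <- repr (comul (g l))] | l <- enum 'I_m].
pose x l (i : 'I_(size L)) := let q := tnth (in_tuple L) i in if q.1 == l then q.2.1 else 0.
pose u (i : 'I_(size L)) := (tnth (in_tuple L) i).2.2.
exists (size L), x, u => l.
rewrite /x /u /=.
rewrite -(big_tnth _ _ _ xpredT (fun q : 'I_m * (H * H) =>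
  (if q.1 == l then q.2.1 else 0) \ot q.2.2)).
rewrite big_flatten big_map big_enum /= (bigD1 l) //= big_map /= eqxx -tensor_sumE.
rewrite big1 ?addr0 // => l' /negbTE ll'; rewrite big_map /= ll' big1 // => p _.
by rewrite linear0l.
Qed.

(** In a simultaneous expression of the coproducts of the g_l of minimal length
    the left and the right factors are free, the left ones as vectors indexed by l: a
    dependency on either side would shorten it. *)
Lemma exists_free_represents : exists d x u, [/\ @represents d x u,
  (forall c : 'I_d -> k, \sum_i c i *: u i = 0 -> forall i, c i = 0) &
  (forall c : 'I_d -> k, \sum_i c i *: [ffun l => x l i] = 0 -> forall i, c i = 0)].
Proof.
have exP : exists d, `[< exists x u, @represents d x u >].
  by have [d [x [u Hr]]] := exists_represents; exists d; apply/asboolP; exists x, u.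
case: (ex_minnP exP) => d /asboolP[x [u Hr]] min_d; exists d, x, u.
have less d' : d = d'.+1 -> ~ exists x u, @represents d' x u.
  by move=> Ed H'; have := min_d d' (introT (asboolP _) H'); rewrite Ed ltnn.
split=> // c E i; apply/eqP; apply: contraT => ci; exfalso.
  case: d x u Hr c E i ci {min_d} less => [|d] x u Hr c E i ci less; first by case: i ci.
  have [a Ea] := dependent_lift E ci; apply: (less d) => //.
  exists (fun l j => x l (lift i j) + a j *: x l i), (fun j => u (lift i j)) => l.
  rewrite (Hr l) (bigD1_ord i) //= Ea linear_sumr -big_split; apply: eq_bigr => j _ /=.
  by rewrite linearDl linearZl_LR linearZr_LR addrC.
case: d x u Hr c E i ci {min_d} less => [|d] x u Hr c E i ci less; first by case: i ci.
have [a Ea] := dependent_lift E ci; apply: (less d) => //.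
exists (fun l j => x l (lift i j)), (fun j => u (lift i j) + a j *: u i) => l.
rewrite (Hr l) (bigD1_ord i) //=.
have -> : x l i = \sum_j a j *: x l (lift i j).
  have := congr1 (fun z : {ffun 'I_m -> H} => z l) Ea; rewrite /= ffunE sum_ffunE => ->.
  by apply: eq_bigr => j _; rewrite !ffunE.
rewrite linear_sumlz -big_split; apply: eq_bigr => j _ /=.
by rewrite linearDr linearZl_LR linearZr_LR addrC.
Qed.

(** The fundamental theorem of coalgebras. With dual functionals on the left
    factors of a minimal expression, coassociativity shows that the right factors
    u_i span a left coideal, comul u_i = sum_j t_ij \ot u_j. The coefficients t_ij
    form a comatrix because the u_j are free, and the counit expresses the g_l as
    combinations of them. *)
Lemma exists_comatrix : exists d (t : 'I_d -> 'I_d -> H), comatrix t /\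
  forall l, exists c : 'I_d -> 'I_d -> k, g l = \sum_i \sum_j c i j *: t i j.
Proof.
have [d [x [u [Hr free_u free_x]]]] := exists_free_represents.
have [F [Fl Fx]] := dual_functionals free_x; have [e [el eu]] := dual_functionals free_u.
pose f i l (h : H) := F i [ffun l' => if l' == l then h else 0].
have fl i l a y z : f i l (a *: y + z) = a * f i l y + f i l z.
  rewrite /f -Fl; congr (F i _); apply/ffunP => l'; rewrite !ffunE.
  by case: eqP => //; rewrite scaler0 addr0.
have Fsum i (s : seq 'I_m) (G : 'I_m -> {ffun 'I_m -> H}) :
    F i (\sum_(l <- s) G l) = \sum_(l <- s) F i (G l).
  apply: (big_morph (F i)) => [y z|]; first by rewrite -[y]scale1r Fl mul1r scale1r.
  by have := Fl i (-1) 0 0; rewrite scaler0 addr0 mulN1r addNr.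
have fx i j : \sum_l f i l (x l j) = (i == j)%:R.
  rewrite -Fx -Fsum; congr (F i _); apply/ffunP => l; rewrite ffunE sum_ffunE.
  rewrite (bigD1 l) //= ffunE eqxx big1 ?addr0 // => l' /negbTE.
  by rewrite ffunE eq_sym => ->.
pose t i j := \sum_l tlift (fun a b : H => f i l a *: b) (comul (x l j)).
have comul_u i : comul (u i) = \sum_j t i j \ot u j.
  transitivity (\sum_l \sum_j f i l (x l j) *: comul (u j)).
    rewrite exchange_big /= (bigD1 i) //= -scaler_suml fx eqxx scale1r.
    rewrite big1 ?addr0 // => j /negbTE ij; rewrite -scaler_suml fx eq_sym ij.
    exact: scale0r.
  rewrite [RHS](eq_bigr (fun j => \sum_l
      tlift (fun a b : H => f i l a *: b) (comul (x l j)) \ot u j)); last first.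
    by move=> j _; rewrite /t linear_sumlz.
  rewrite [RHS]exchange_big; apply: eq_bigr => l _.
  have := congr1 (tlift (fun (a : H) (z : H \ox H) => f i l a *: z)) (coassoc (Hr l)).
  rewrite tlift_sum; last exact: tlift_fun_bilin.
  move=> ->; rewrite tlift_linear_sum; last exact: tlift_fun_bilin.
  by apply: eq_bigr => j _; rewrite assoc_funl.
have eps a b : counit (t a b) = (a == b)%:R.
  apply/eqP; rewrite -subr_eq0; apply/eqP.
  apply: (free_u (fun b => counit (t a b) - (a == b)%:R)).
  under eq_bigr => j _ do rewrite scalerBl.
  rewrite sumrB (bigD1 (P := xpredT) (F := fun j => (a == j)%:R *: u j) a) //= eqxx scale1r.
  rewrite [X in _ - (_ + X)]big1 ?addr0 => [|j /negbTE]; last first.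
    by rewrite eq_sym => ->; rewrite scale0r.
  rewrite -[X in _ - X]counit_comull comul_u tlift_sum ?subrr //.
  exact: tlift_fun_bilin counitP.
exists d, t; split.
  split=> // i j; have := congr1 (contract3 (e j)) (coassoc (comul_u i)).
  rewrite [RHS]tlift_linear_sum; last exact: contract3_bilin.
  rewrite (eq_bigr (fun l => e j (u l) *: comul (t i l))); last first.
    by move=> l _; exact: contract3_assoc.
  rewrite (bigD1 (F := fun l => e j (u l) *: comul (t i l)) j) //= eu eqxx scale1r [X in comul _ + X]big1 ?addr0 => [<-|l /negbTE]; last first.
    by rewrite eu eq_sym => ->; rewrite scale0r.
  rewrite /contract3 tlift_sum; last exact: contract3_bilin.
  apply: eq_bigr => l _; rewrite comul_u tlift_sum; last exact: tlift_fun_bilinr.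
  rewrite (bigD1 j) //= eu eqxx scale1r big1 ?addr0 // => l' /negbTE.
  by rewrite eu eq_sym => ->; rewrite scale0r.
move=> l; exists (fun i j => counit (x l i) * counit (u j)).
rewrite -[LHS]counit_comull (Hr l) tlift_sum; last exact: tlift_fun_bilin counitP.
apply: eq_bigr => i _.
rewrite -[u i in LHS]counit_comulr comul_u tlift_sum; last exact: tlift_fun_bilinr counitP.
by rewrite scaler_sumr; apply: eq_bigr => j _; rewrite scalerA.
Qed.

End Representation.
End Comatrix.

(** * The antipode *)

Section Antipode.
Variables (k : fieldType) (H : hopfAlgType k).
Implicit Types (g h : H).

Notation S := (@antipode k H).

Lemma natZ (b : bool) (x : H) : (b%:R : k) *: x = x *+ b.
Proof. by case: b; rewrite ?scale1r ?scale0r. Qed.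

(** The antipode of a comatrix is its inverse matrix. *)
Lemma comatrix_antipodel (I : finType) (t : I -> I -> H) i j : comatrix t ->
  \sum_l S (t i l) * t l j = 1 *+ (i == j).
Proof.
move=> [Dt et]; have := antipode_comull (t i j); rewrite Dt et natZ => <-.
rewrite tlift_sum //; split=> [v a x y|x a v w] /=.
  by rewrite linearP mulrDl scalerAl.
by rewrite mulrDr scalerAr.
Qed.

Lemma comatrix_antipoder (I : finType) (t : I -> I -> H) i j : comatrix t ->
  \sum_l t i l * S (t l j) = 1 *+ (i == j).
Proof.
move=> [Dt et]; have := antipode_comulr (t i j); rewrite Dt et natZ => <-.
rewrite tlift_sum //; split=> [v a x y|x a v w] /=.
  by rewrite mulrDl scalerAl.
by rewrite linearP mulrDr scalerAr.
Qed.

Lemma span_comatrix1 g : exists d (t : 'I_d -> 'I_d -> H) (c : 'I_d -> 'I_d -> k),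
  comatrix t /\ g = \sum_i \sum_j c i j *: t i j.
Proof.
have [d [t [tc Ht]]] := exists_comatrix (fun _ : 'I_1 => g).
by have [c Hc] := Ht ord0; exists d, t, c.
Qed.

Lemma comatrix_mul (I J : finType) (t : I -> I -> H) (u : J -> J -> H) :
  comatrix t -> comatrix u ->
  comatrix (fun p q : I * J => t p.1 q.1 * u p.2 q.2).
Proof.
move=> [Dt et] [Du eu]; split=> [[i i'] [j j']|[i i'] [j j']] /=.
  rewrite rmorphM /= Dt Du big_distrlr pair_bigA /=.
  by apply: eq_bigr => -[l l'] _; exact: mul_pure_tensor.
by rewrite rmorphM /= et eu -natrM mulnb -xpair_eqE.
Qed.

Lemma antipode1 : S 1 = 1.
Proof.
have t1 : comatrix (fun _ _ : 'I_1 => 1 : H).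
  split=> i j; last by rewrite rmorph1 !ord1.
  by rewrite rmorph1 big_ord1.
by have := comatrix_antipodel ord0 ord0 t1; rewrite big_ord1 mulr1.
Qed.

(** On comatrix entries both sides are inverse to the product comatrix, and
    inverse matrices are unique. *)
Lemma antipodeM g h : S (g * h) = S h * S g.
Proof.
have [d [t [c [tc ->]]]] := span_comatrix1 g; have [e [u [b [uc ->]]]] := span_comatrix1 h.
have key i j i' j' : S (t i j * u i' j') = S (u i' j') * S (t i j).
  pose v := fun p q : 'I_d * 'I_e => t p.1 q.1 * u p.2 q.2.
  pose Y := fun p q : 'I_d * 'I_e => S (u p.2 q.2) * S (t p.1 q.1).
  have vc : comatrix v := comatrix_mul tc uc.
  have vY p q : \sum_l v p l * Y l q = 1 *+ (p == q).
    case: p q => [p p'] [q q']; rewrite -(pair_bigA _ (fun l l' => v (p, p') (l, l') * Y (l, l') (q, q'))) /=.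
    transitivity (\sum_l t p l * S (t l q) *+ (p' == q')).
      apply: eq_bigr => l _; rewrite /v /Y /=.
      transitivity (t p l * (\sum_l' u p' l' * S (u l' q')) * S (t l q)).
        by rewrite mulr_sumr mulr_suml; apply: eq_bigr => l' _; rewrite !mulrA.
      rewrite (comatrix_antipoder _ _ uc); case: (p' == q'); rewrite ?mulr1 //.
      by rewrite mulr0 mul0r.
    rewrite sumrMnl (comatrix_antipoder _ _ tc) xpair_eqE -mulrnA; congr (_ *+ _).
    by rewrite mulnb.
  have E p q : S (v p q) = Y p q.
    transitivity (\sum_m \sum_l S (v p l) * v l m * Y m q).
      rewrite exchange_big /= [LHS](_ : _ = \sum_l S (v p l) * (1 *+ (l == q))).
        by apply: eq_bigr => l _; rewrite -vY mulr_sumr; apply: eq_bigr => m _; rewrite mulrA.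
      rewrite (bigD1 q) //= eqxx mulr1 big1 ?addr0 // => l /negbTE ->.
      by rewrite mulr0.
    under eq_bigr => m _ do rewrite -mulr_suml (comatrix_antipodel _ _ vc).
    rewrite (bigD1 p) //= eqxx mul1r big1 ?addr0 // => l /negbTE.
    by rewrite eq_sym => ->; rewrite mul0r.
  exact: (E (i, i') (j, j')).
rewrite mulr_suml !linear_sum /= mulr_sumr; apply: eq_bigr => i _.
rewrite mulr_suml !linear_sum /= mulr_sumr; apply: eq_bigr => j _.
rewrite mulr_sumr !linear_sum /= mulr_suml; apply: eq_bigr => i' _.
rewrite mulr_sumr !linear_sum /= mulr_suml; apply: eq_bigr => j' _.
by rewrite !linearZ /= -!scalerAl -!scalerAr !linearZ /= key.
Qed.

End Antipode.

(** * Twists from inverse matrices of operators *)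

Section MakeTwist.
Variables (R : pzRingType) (d : nat) (f g : 'I_d -> 'I_d -> R -> R).
Hypothesis fD : forall i j a b, f i j (a + b) = f i j a + f i j b.
Hypothesis gD : forall i j a b, g i j (a + b) = g i j a + g i j b.
Hypothesis f1 : forall i j, f i j 1 = 1 *+ (i == j).
Hypothesis fM : forall i j a b, f i j (a * b) = \sum_l f i l a * f l j b.
Hypothesis fg : forall i j a, \sum_l f i l (g l j a) = a *+ (i == j).
Hypothesis gf : forall i j a, \sum_l g i l (f l j a) = a *+ (i == j).

Let f_sum i j (I : finType) (F : I -> R) : f i j (\sum_x F x) = \sum_x f i j (F x).
Proof.
apply: (big_morph _ (fD i j)).
by apply: (addIr (f i j 0)); rewrite -fD !add0r.
Qed.

Let g_sum i j (I : finType) (F : I -> R) : g i j (\sum_x F x) = \sum_x g i j (F x).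
Proof.
apply: (big_morph _ (gD i j)).
by apply: (addIr (g i j 0)); rewrite -gD !add0r.
Qed.

Let g_delta i j a : g i j a = \sum_l g i l (a *+ (l == j)).
Proof.
rewrite (bigD1 j) //= eqxx big1 ?addr0 // => l /negbTE ->.
by apply: (addIr (g i l 0)); rewrite -gD !add0r.
Qed.

Let g1 i j : g i j 1 = 1 *+ (i == j).
Proof. by rewrite g_delta -gf; apply: eq_bigr => l _; rewrite f1. Qed.

Let gM l j a b : g l j (a * b) = \sum_i g i j a * g l i b.
Proof.
have E m : \sum_n f m n (\sum_i g i j a * g n i b) = (a * b) *+ (m == j).
  transitivity (\sum_i \sum_p f m p (g i j a) * (b *+ (p == i))).
    transitivity (\sum_n \sum_i \sum_p f m p (g i j a) * f p n (g n i b)).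
      by apply: eq_bigr => n _; rewrite f_sum; apply: eq_bigr => i _; rewrite fM.
    rewrite exchange_big; apply: eq_bigr => i _; rewrite exchange_big.
    by apply: eq_bigr => p _; rewrite -mulr_sumr fg.
  rewrite -mulrnAl -fg mulr_suml; apply: eq_bigr => i _.
  rewrite (bigD1 i) //= eqxx big1 ?addr0 // => p /negbTE ->.
  by rewrite mulr0.
rewrite g_delta; transitivity (\sum_m \sum_n g l m (f m n (\sum_i g i j a * g n i b))).
  by apply: eq_bigr => m _; rewrite -E g_sum.
rewrite exchange_big /= (bigD1 l) //= gf eqxx [X in _ + X]big1 ?addr0 // => n /negbTE.
by rewrite gf eq_sym => ->.
Qed.

(** Multiplicativity has to be checked for one of two inverse matrices only: the
    other one inherits it. *)
Definition mk_twist : twist R := Twist gD fD g1 gM fM fg gf.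

End MakeTwist.

(** * Linear dependence *)

Section LinearDependence.
Variables (k : fieldType) (V : lmodType k).

Lemma dependent_family (I : finType) (e : I -> V) m (u : 'I_m -> V) : (#|I| < m)%N ->
  (forall l, exists c : I -> k, u l = \sum_i c i *: e i) ->
  exists2 a : 'I_m -> k, (exists l, a l != 0) & \sum_l a l *: u l = 0.
Proof.
move=> lt_m /choice[c Hc].
pose C : 'M[k]_(m, #|I|) := \matrix_(l, i) c l (enum_val i).
have : kermx C != 0.
  by rewrite -mxrank_eq0 mxrank_ker subn_eq0 -ltnNge (leq_ltn_trans (rank_leq_col C)).
case/rowV0Pn=> a /sub_kermxP aC a0; exists (fun l => a 0 l).
  apply: contrapT => no; case/eqP: a0; apply/rowP => l; rewrite mxE.
  by apply/eqP; apply: contraT => alpha; case: no; exists l.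
under eq_bigr => l _ do rewrite Hc scaler_sumr.
rewrite exchange_big big1 // => i _.
transitivity ((a *m C) 0 (enum_rank i) *: e i); last by rewrite aC mxE scale0r.
rewrite mxE scaler_suml; apply: eq_bigr => l _.
by rewrite scalerA mxE enum_rankK.
Qed.

Lemma first_dependent (I : finType) (e : I -> V) (u : nat -> V) :
  (forall n, exists c : I -> k, u n = \sum_i c i *: e i) ->
  exists n (b : 'I_n -> k), u n = \sum_(l < n) b l *: u l.
Proof.
move=> Hu; pose m := #|I|.+1.
have [a [l0 al0] E] := @dependent_family I e m (fun l => u l) (ltnSn _) (fun l => Hu l).
case: (arg_maxnP (fun l : 'I_m => l : nat) (P := fun l => a l != 0) al0) => n an max_n.
exists n, (fun l => - ((a n)^-1 * a (widen_ord (ltnW (ltn_ord n)) l))).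
pose F l := if insub l is Some l' then a l' *: u l else 0.
have FE (l : 'I_m) : F l = a l *: u l by rewrite /F valK.
have : \sum_(l < m) F l = 0 by rewrite -[RHS]E; apply: eq_bigr => l _; exact: FE.
rewrite -(big_mkord xpredT F) (big_cat_nat (n := n.+1)) //=.
rewrite [X in _ + X](_ : _ = 0) ?addr0; last first.
  rewrite big_nat big1 // => l /andP[nl lm].
  rewrite (FE (Ordinal lm)); have [/eqP->|/max_n /=] := boolP (a (Ordinal lm) == 0).
    exact: scale0r.
  by rewrite leqNgt nl.
rewrite big_nat_recr //= FE addrC => /eqP; rewrite addr_eq0 => /eqP En.
rewrite -[LHS](scalerK an) En big_mkord -sumrN scaler_sumr; apply: eq_bigr => l _.
by rewrite (FE (widen_ord (ltnW (ltn_ord n)) l)) scalerN scalerA scaleNr.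
Qed.

(** Let Psi be a left inverse of T and P a Psi-stable subspace containing v. When
    the orbit of v under T has finite dimension, some T^(n+1) v is a combination
    of the T^l v with l <= n; applying Psi^n turns this into an expression of T v
    by the Psi^m v. *)
Lemma stable_left_inverse (T Psi : V -> V) (I : finType) (e : I -> V) (P : set V) v :
  T 0 = 0 -> cancel T Psi ->
  (forall a x y, Psi (a *: x + y) = a *: Psi x + Psi y) ->
  P 0 -> (forall (a : k) x y, P x -> P y -> P (a *: x + y)) ->
  (forall x, P x -> P (Psi x)) -> P v ->
  (forall n, exists c : I -> k, iter n T v = \sum_i c i *: e i) -> P (T v).
Proof.
move=> T0 PsiK PsiL P0 PL PPsi Pv /first_dependent[[|n] [b En]].
  by have -> : v = 0 by [move: En; rewrite /= big_ord0]; rewrite T0.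
have Psi0 : Psi 0 = 0 by have := PsiK 0; rewrite T0.
have PsiD x y : Psi (x + y) = Psi x + Psi y by rewrite -[x]scale1r PsiL !scale1r.
have PsiZ a x : Psi (a *: x) = a *: Psi x by rewrite -[a *: x]addr0 PsiL Psi0 addr0.
have iterK m x : iter m Psi (iter m T x) = x.
  by elim: m x => [//|m IHm] x; rewrite iterS iterSr IHm.
have iter_sum m p (a : 'I_p -> k) (w : 'I_p -> V) :
    iter m Psi (\sum_l a l *: w l) = \sum_l a l *: iter m Psi (w l).
  elim: m => [//|m IHm]; rewrite iterS IHm (big_morph _ PsiD Psi0).
  by apply: eq_bigr => l _; rewrite PsiZ.
have := congr1 (iter n Psi) En; rewrite iterSr iterK iter_sum => ->.
elim/big_ind: _ => [//|x y Px Py|l _]; first by rewrite -[x]scale1r; exact: PL.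
rewrite -[X in P X]addr0; apply: PL => //.
rewrite -[in iter n](subnK (ltnSE (ltn_ord l))) iterD iterK.
by elim: (n - l)%N => [//|m IHm]; exact: PPsi.
Qed.

End LinearDependence.

(** * Twists by comatrices acting on an algebra *)

Section ActionTwists.
Variables (k : fieldType) (H : hopfAlgType k) (A : unitalAlgebra k).
Variable act : moduleAlgebra H A.
Notation S := (@antipode k H).

Lemma act_suml (I : Type) (r : seq I) (F : I -> H) a :
  act (\sum_(i <- r) F i) a = \sum_(i <- r) act (F i) a.
Proof. exact: linear_sumlz. Qed.

Lemma act_delta (b : bool) a : act (1 *+ b) a = a *+ b.
Proof. by case: b; [exact: hact1 | rewrite !mulr0n linear0l]. Qed.

Section Comatrix.
Variables (d : nat) (t : 'I_d -> 'I_d -> H).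
Hypothesis tc : comatrix t.

Lemma act_comatrix i j a b :
  act (t i j) (a * b) = \sum_l act (t i l) a * act (t l j) b.
Proof.
rewrite hact_mul tc.1 tlift_sum //; split=> [v c x y|x c v w] /=.
  by rewrite linearPl mulrDl ua_scalerAl.
by rewrite linearPl mulrDr ua_scalerAr.
Qed.

Lemma act_antipoder i j a : \sum_l act (t i l) (act (S (t l j)) a) = a *+ (i == j).
Proof.
under eq_bigr => l _ do rewrite -hactM.
by rewrite -act_suml comatrix_antipoder // act_delta.
Qed.

Lemma act_antipodel i j a : \sum_l act (S (t i l)) (act (t l j) a) = a *+ (i == j).
Proof.
under eq_bigr => l _ do rewrite -hactM.
by rewrite -act_suml comatrix_antipodel // act_delta.
Qed.

(** Expand sum_k t_ik (1 * S(t_kj) 1) by the product rule: the factor t_ij 1 comes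
    out, while without expanding the sum is the entry of the identity matrix. *)
Lemma act_comatrix1 i j : act (t i j) 1 = 1 *+ (i == j).
Proof.
rewrite -(act_antipoder i j 1).
transitivity (\sum_k \sum_l act (t i l) 1 * act (t l k) (act (S (t k j)) 1)).
  rewrite exchange_big /= (bigD1 j) //= -mulr_sumr act_antipoder eqxx mulr1.
  rewrite big1 ?addr0 // => l /negbTE lj.
  by rewrite -mulr_sumr act_antipoder lj mulr0.
by apply: eq_bigr => l _; rewrite -act_comatrix mul1r.
Qed.

Let actD h a b : act h (a + b) = act h a + act h b.
Proof. exact: linearDr. Qed.

(** Here [itw] is the action of t itself; this twist moves the action past right
    multiplications and provides the Ore condition. *)
Definition left_twist : twist A :=
  mk_twist (fun i j => actD (t i j)) (fun i j => actD (S (t i j)))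
    act_comatrix1 act_comatrix act_antipoder act_antipodel.

Let f1 i j : act (S (t j i)) 1 = 1 *+ (i == j).
Proof. by rewrite eq_sym; exact: (@tw1 _ left_twist). Qed.

Let fM i j a b :
  act (S (t j i)) (a * b) = \sum_l act (S (t l i)) a * act (S (t j l)) b.
Proof. exact: (@twM _ left_twist). Qed.

Let antipode2 (b : bool) : S (1 *+ b) = 1 *+ b.
Proof. by case: b; rewrite ?linear0 ?antipode1. Qed.

Let fg i j a : \sum_l act (S (t l i)) (act (S (S (t j l))) a) = a *+ (i == j).
Proof.
under eq_bigr => l _ do rewrite -hactM -antipodeM.
rewrite -act_suml -linear_sum comatrix_antipodel //= antipode2.
by rewrite act_delta eq_sym.
Qed.

Let gf i j a : \sum_l act (S (S (t l i))) (act (S (t j l)) a) = a *+ (i == j).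
Proof.
under eq_bigr => l _ do rewrite -hactM -antipodeM.
rewrite -act_suml -linear_sum comatrix_antipoder //= antipode2.
by rewrite act_delta eq_sym.
Qed.

(** The twist with [itw i j = S(t_ji)] and [tw i j = S(S(t_ji))]; the transposition
    compensates that S reverses products. Its coordinates are the operators
    occurring in [tw] for [left_twist], whence the Ore condition of the latter
    controls [itw] for the former. *)
Definition right_twist : twist A :=
  mk_twist (fun i j => actD (S (t j i))) (fun i j => actD (S (S (t j i))))
    f1 fM fg gf.

End Comatrix.

(** Locally finite actions satisfy H x = S(H) x. The comatrix t acts on the
    vectors of length d over A, and S(t) is inverse to it. Starting from a vector
    with the single nonzero entry x, the iterates of t stay in the
    finite-dimensional space of vectors over H x, while the vectors over S(H) x
    are stable under S(t). So the entries t_ij x lie in S(H) x. *)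
Lemma antipode_surj (locfin : locally_finite_action act) h x :
  exists g, act h x = act (S g) x.
Proof.
have [d [t [c [tc ->]]]] := span_comatrix1 h.
pose Z : set A := [set act (S g) x | g in setT].
have Z0 : Z 0 by exists 0 => //; rewrite linear0 linear0l.
have ZL (a : k) y z : Z y -> Z z -> Z (a *: y + z).
  move=> [g _ <-] [g' _ <-]; exists (a *: g + g') => //.
  by rewrite linearP linearPl.
suff tZ i j : Z (act (t i j) x).
  suff : Z (act (\sum_i \sum_j c i j *: t i j) x) by case=> g _ <-; exists g.
  rewrite act_suml; elim/big_ind: _ => [//|y z Zy Zz|i _].
    by rewrite -[y]scale1r; exact: ZL.
  rewrite act_suml; elim/big_ind: _ => [//|y z Zy Zz|j _].
    by rewrite -[y]scale1r; exact: ZL.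
  by rewrite linearZl_LR -[X in Z X]addr0; exact: ZL.
have [n [e]] := locfin x => We.
pose V := {ffun 'I_d -> A}.
pose T (v : V) : V := [ffun i => \sum_j act (t i j) (v j)].
pose Psi (v : V) : V := [ffun i => \sum_j act (S (t i j)) (v j)].
pose eV (p : 'I_d * 'I_n) : V := [ffun i => e p.2 *+ (i == p.1)].
pose v : V := [ffun i => x *+ (i == j)].
have EZ i' : T v i' = act (t i' j) x.
  rewrite ffunE (bigD1 j) //= ffunE eqxx big1 ?addr0 // => l /negbTE.
  by rewrite ffunE => ->; exact: linear0r.
suff : forall i, Z (T v i) by move/(_ i); rewrite EZ.
apply: (@stable_left_inverse _ _ T Psi _ eV [set w : V | forall i, Z (w i)]).
- by apply/ffunP => i'; rewrite !ffunE big1 // => l _; rewrite ffunE linear0r.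
- move=> w; apply/ffunP => i'; rewrite ffunE.
  under eq_bigr => l _ do rewrite ffunE linear_sumr.
  rewrite exchange_big /= (bigD1 i') //= act_antipodel // eqxx big1 ?addr0 // => l /negbTE il.
  by rewrite act_antipodel // eq_sym il.
- move=> a w w'; apply/ffunP => i'; rewrite !ffunE scaler_sumr -big_split /=.
  by apply: eq_bigr => l _; rewrite !ffunE linearPr.
- by move=> i'; rewrite ffunE.
- by move=> a w w' Zw Zw' i'; rewrite !ffunE; exact: ZL.
- move=> w Zw i'; rewrite ffunE; elim/big_ind: _ => [//|y z Zy Zz|l _].
    by rewrite -[y]scale1r; exact: ZL.
  by have [g _ <-] := Zw l; exists (g * t i' l) => //; rewrite antipodeM hactM.
- move=> i'; rewrite ffunE; case: (i' == j) => //.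
  by exists 1 => //; rewrite antipode1 hact1.
move=> m; suff : forall i, exists g, iter m T v i = act g x.
  move=> /choice[g Hg].
  have /choice[b Hb] i' : exists b : 'I_n -> k, act (g i') x = \sum_l b l *: e l.
    have : [set act h x | h in setT] (act (g i') x) by exists (g i').
    by rewrite We.
  exists (fun p => b p.1 p.2); apply/ffunP => i'; rewrite Hg Hb sum_ffunE.
  rewrite -(pair_bigA _ (fun p q => (b p q *: eV (p, q)) i')) /= (bigD1 i') //=.
  rewrite [X in _ + X]big1 ?addr0 => [|l /negbTE il].
    by apply: eq_bigr => l _; rewrite !ffunE eqxx.
  by rewrite big1 // => q _; rewrite !ffunE eq_sym il scaler0.
elim: m => [|m IHm] i'.
  rewrite /= ffunE; case: (i' == j); first by exists 1; rewrite hact1.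
  by exists 0; rewrite linear0l.
rewrite iterS ffunE; elim/big_ind: _ => [|y z [g ->] [g' ->]|l _].
- by exists 0; rewrite linear0l.
- by exists (g + g'); rewrite linearDl.
- by have [g ->] := IHm l; exists (t i' l * g); rewrite hactM.
Qed.

End ActionTwists.

(** * Stable ideals and the theorem *)

Lemma itw_mulr (R : pzRingType) (t : twist R) i j x a :
  itw (t := t) i j x * a = \sum_l itw i l (x * tw l j a).
Proof.
under eq_bigr => l _ do rewrite itwM.
rewrite exchange_big (bigD1 j) //= -mulr_sumr twK eqxx big1 ?addr0 // => l /negbTE lj.
by rewrite -mulr_sumr twK lj mulr0.
Qed.

Section Main.
Variables (k : fieldType) (H : hopfAlgType k) (A : unitalAlgebra k).
Variable act : moduleAlgebra H A.
Hypothesis noethA : right_noetherian A.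
Hypothesis semiprimeA : H_semiprime act.
Notation S := (@antipode k H).

Lemma submodZ (P : set (@regm A)) (c : k) (x : A) : submod P -> P x -> P (c *: x).
Proof.
case=> _ _ Pm Px; have -> : c *: x = x * (c *: (1 : A)) by rewrite -ua_scalerAr mulr1.
exact: Pm.
Qed.

Lemma act_closed (P : set (@regm A)) x : submod P ->
  (forall d (t : 'I_d -> 'I_d -> H), comatrix t -> forall i j, P (act (t i j) x)) ->
  forall h, P (act h x).
Proof.
move=> sP Pt h; have [d [t [c [tc ->]]]] := span_comatrix1 h.
rewrite act_suml; apply: (@submod_sum _ (@regm A)) => // i _.
rewrite act_suml; apply: (@submod_sum _ (@regm A)) => // j _.
by rewrite linearZl_LR; apply: submodZ => //; exact: Pt.
Qed.

Variable N : set (@regm A).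
Hypothesis idN : two_sided_ideal N.
Hypothesis spN : forall a, (forall b, N (a * b * a)) -> N a.
Hypothesis nilN : nilpotent_ideal N.
Notation regN := (regN N).

Let sN : submod N. Proof. by case: idN. Qed.

(** The elements with H-orbit in N form an H-stable two-sided ideal, by the
    product rule, and it is nilpotent as a part of N. *)
Lemma core0 x : (forall h, N (act h x)) -> x = 0.
Proof.
pose K : set A := [set x | forall h, N (act h x)].
have [N0 ND Nm] := sN; have [_ Nl] := idN.
have idK : two_sided_ideal K.
  split; first split=> [h|y z Ky Kz h|y a Ky h].
  - by rewrite linear0r.
  - by rewrite linearDr; exact: ND.
  - by rewrite hact_mul /tlift; apply: (@submod_sum _ (@regm A)) => // p _; exact: Nm.
  by move=> a y Ky h; rewrite hact_mul /tlift; apply: (@submod_sum _ (@regm A)) => // p _; exact: Nl.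
suff K0 : K = [set 0] by move=> Kx; suff: K x by rewrite K0.

apply: semiprimeA => //.
  by move=> h y Ky g; rewrite -hactM; exact: Ky.
apply: (nilpotent_sub (N := N)) => //; first by case: idK.
by move=> y Ky; rewrite -[y](hact1 act); exact: Ky.
Qed.

(** Actions move through right multiplications, at the cost of twisting them. *)
Lemma comatrix_mulr d (t : 'I_d -> 'I_d -> H) i j x a : comatrix t ->
  act (t i j) x * a = \sum_l act (t i l) (x * act (S (t l j)) a).
Proof. by move=> tc; exact: (@itw_mulr _ (left_twist act tc)). Qed.

(** Let T be the torsion right ideal. If x lies in T, the set of b with x b = 0 is
    dense, so the Ore condition along [left_twist] yields c in C with
    x (S(t_lj)(a c)) = 0 for all l, and then (t_ij x) a c = 0 by [comatrix_mulr].
    Hence T is H-stable; it lies in N because R / N is torsion-free. *)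
Lemma act_torsion_free : saturated N [set (0 : @regm A)].
Proof.
have s0 := submod0 (@regm A); have sT := submod_sat N s0.
suff TN : sat N [set (0 : @regm A)] `<=` N.
  move=> x Tx; apply: core0 => h; apply: TN; apply: act_closed h => // d t tc i j a.
  pose I : set (@regm A) := [set b | x * b = 0].
  have sI : submod I.
    split=> [|y z Iy Iz|y b Iy]; rewrite /I /= ?mulr0 //.
      by rewrite mulrDr Iy Iz addr0.
    by rewrite mulrA Iy mul0r.
  have dI : dense N I by move=> y; have [c Cc E] := Tx y; exists c; rewrite /I //= mulrA.
  have [c Cc Hc] := tws_tors noethA idN spN nilN sI dI (twfrom (t := left_twist act tc) j a).
  exists c => //; rewrite /= -mulrA (comatrix_mulr _ _ _ _ tc) big1 // => l _.
  have := Hc l; rewrite -(rlinear_twfrom _).2 ffunE /I /= => ->.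
  exact: linear0r.
move=> x /(_ 1)[c Cc]; rewrite /= mulr1 => xc; apply: (N_cancel noethA idN spN Cc).
by rewrite xc; case: sN.
Qed.

(** The Ore condition along [left_twist] puts one column of S(t)(c) into I at a
    time; right multiples of c keep the columns already treated. *)
Lemma right_twist_reg d (t : 'I_d -> 'I_d -> H) (tc : comatrix t) I :
  submod I -> dense N I ->
  exists2 c, regN c & forall i j, I (itw (t := right_twist act tc) i j c).
Proof.
move=> sI dI; pose t0 := left_twist act tc.
suff [c Cc Hc] : exists2 c, regN c & forall j, j \in enum 'I_d -> forall i, I (tw (t := t0) i j c).
  by exists c => // i j; exact: (Hc i (mem_enum _ _) j).
elim: (enum 'I_d) => [|j s [c Cc Hc]]; first by exists 1; first exact: regN1.
have [c' Cc' Hc'] := tws_tors noethA idN spN nilN sI dI (twfrom (t := t0) j c).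
exists (c * c') => [|j']; first exact: regNM.
rewrite inE => /orP[/eqP-> i|/Hc Hj i].
  by have := Hc' i; rewrite -(rlinear_twfrom _).2 ffunE.
by rewrite twM; apply: (@submod_sum _ (@regm A)) => // l _; case: sI => _ _; apply.
Qed.

Hypothesis locfinA : locally_finite_action act.

Section Annihilator.
Variable c0 : A.
Hypothesis Cc0 : regN c0.

Let J : set (@regm A) := [set x | c0 * x = 0].

Let sJ : submod J.
Proof.
split=> [|x y Jx Jy|x a Jx]; rewrite /J /= ?mulr0 //.
  by rewrite mulrDr Jx Jy addr0.
by rewrite mulrA Jx mul0r.
Qed.

(** The right ideal HJ. *)
Let E : set (@regm A) := [set e | exists2 s : seq (H * A),
  forall p, p \in s -> J p.2 & e = \sum_(p <- s) act p.1 p.2].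

Let E0 : E 0. Proof. by exists [::]; rewrite ?big_nil. Qed.

Let ED x y : E x -> E y -> E (x + y).
Proof.
move=> [s Hs ->] [s' Hs' ->]; exists (s ++ s'); last by rewrite big_cat.
by move=> p; rewrite mem_cat => /orP[/Hs|/Hs'].
Qed.

Let Eact h x : J x -> E (act h x).
Proof.
by move=> Jx; exists [:: (h, x)]; rewrite ?big_seq1 // => p; rewrite inE => /eqP->.
Qed.

Let Esum (I : eqType) (s : seq I) (F : I -> A) :
  (forall p, p \in s -> E (F p)) -> E (\sum_(p <- s) F p).
Proof. by move=> HF; rewrite big_seq; apply: big_ind. Qed.

Let sE : submod E.
Proof.
split=> // _ a [s Hs ->]; rewrite regmE mulr_suml; apply: Esum => p /Hs Jp.
have sP : submod [set y : @regm A | forall a, E (y * a)].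
  split=> [b|y z Ey Ez b|y b Ey b'] /=; first by rewrite mul0r.
    by rewrite mulrDl; exact: ED.
  by rewrite -mulrA.
move: p.1 a; apply: (act_closed sP) => d t tc i j a.
rewrite (comatrix_mulr _ _ _ _ tc); apply: Esum => l _; apply: Eact.
by case: sJ => _ _; apply.
Qed.

Let Estable h x : E x -> E (act h x).
Proof.
move=> [s Hs ->]; rewrite linear_sumr; apply: Esum => p /Hs Jp.
by rewrite -hactM; exact: Eact.
Qed.

(** E is also the span of the S(H)-orbits of J, by local finiteness. *)
Lemma annihilator_antipode e : E e -> exists2 s : seq (H * A),
  forall p, p \in s -> J p.2 & e = \sum_(p <- s) act (S p.1) p.2.
Proof.
move=> [s Hs ->]; have [f Hf] := choice (fun p : H * A => antipode_surj locfinA p.1 p.2).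
exists [seq (f p, p.2) | p <- s]; first by move=> _ /mapP[p /Hs Jp ->].
by rewrite big_map; apply: eq_bigr => p _; exact: Hf.
Qed.

(** E is finitely generated, so finitely many elements S(g) x with x in J generate
    it as a right ideal. A comatrix spanning the elements g expresses them by
    coordinates of the twist of J, and such sums of coordinates form a right
    ideal. *)
Lemma annihilator_twist : exists d (t : 'I_d -> 'I_d -> H) (tc : comatrix t),
  let t1 := right_twist act tc in
  forall e, E e -> exists m : 'I_(td t1) -> twm t1 (@regm A),
    (forall j, tws J (m j)) /\ e = \sum_j twcoord j (m j).
Proof.
have [s [sE' spE]] := noeth_fg noethA sE.
have [L [JL HL]] : exists L : seq (H * A), (forall p, p \in L -> J p.2) /\
    forall P : set (@regm A), submod P ->
      (forall p, p \in L -> P (act (S p.1) p.2)) -> forall e, e \in s -> P e.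
  elim: s sE' {spE} => [|e s IHs] sE'; first by exists [::].
  have [|L [JL HL]] := IHs; first by move=> x xs; apply: sE'; rewrite inE xs orbT.
  have [r Jr Er] := annihilator_antipode (sE' e (mem_head _ _)).
  exists (r ++ L); split=> [p|P sP HP x].
    by rewrite mem_cat => /orP[/Jr|/JL].
  rewrite inE => /orP[/eqP->|]; last first.
    by apply: HL => // p pL; apply: HP; rewrite mem_cat pL orbT.
  rewrite Er big_seq; apply: (@submod_sum _ (@regm A)) => // p pr.
  by apply: HP; rewrite mem_cat pr.
have [d [t [tc Ht]]] := exists_comatrix (fun l : 'I_(size L) => (tnth (in_tuple L) l).1).
exists d, t, tc; set t1 := right_twist act tc.
pose P : set (@regm A) := [set e | exists m : 'I_(td t1) -> twm t1 (@regm A),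
    (forall j, tws J (m j)) /\ e = \sum_j twcoord j (m j)].
suff EP : E `<=` P by [].
have sJt : submod (tws J : set (twm t1 regm)) := submod_tws t1 sJ.
have sP : submod P.
  have [J0 JD Jm] := sJt; split.
  - exists (fun=> 0); split=> //; rewrite big1 // => j _.
    exact: rlinear0 (rlinear_twcoord _).
  - move=> _ _ [m [Jmm ->]] [m' [Jm' ->]]; exists (fun j => m j + m' j); split.
      by move=> j; exact: JD.
    by rewrite -big_split; apply: eq_bigr => j _; rewrite (rlinear_twcoord j).1.
  - move=> _ a [m [Jmm ->]]; exists (fun j => m j ** a); split=> [j|]; first exact: Jm.
    by rewrite ract_suml; apply: eq_bigr => j _; rewrite (rlinear_twcoord j).2.
rewrite -spE; apply: spn_sub => //; apply: HL => // p pL.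
have Jp := JL p pL; have pE : tnth (in_tuple L) (Ordinal (etrans (index_mem p L) pL)) = p.
  by rewrite (tnth_nth p) /= nth_index.
have [c] := Ht (Ordinal (etrans (index_mem p L) pL)); rewrite pE => ->.
rewrite linear_sum act_suml; apply: (@submod_sum _ (@regm A)) => // i _.
rewrite linear_sum act_suml; apply: (@submod_sum _ (@regm A)) => // j _.
rewrite linearZ linearZl_LR; apply: submodZ => //.
exists (fun j' : 'I_(td t1) =>
  @twdelta _ t1 (@regm A) i p.2 *+ (j' == j :> 'I_(td t1))); split.
  move=> j' l; case: (j' == j); rewrite ?mulr1n ?mulr0n ffunE; last by case: sJ.
  by case: (i == l :> 'I_d) => //; case: sJ.
rewrite (bigD1 j) //= eqxx big1 ?addr0 => [|j' /negbTE ->]; last first.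
  exact: rlinear0 (rlinear_twcoord _).
rewrite /twcoord (bigD1 i) //= ffunE eqxx big1 ?addr0 // => l /negbTE.
by rewrite ffunE eq_sym => ->; exact: linear0r.
Qed.

(** E is contained in N and H-stable, so the H-orbit of x stays in N. *)
Lemma regN_inj x : c0 * x = 0 -> x = 0.
Proof.
move=> Jx; apply: core0 => h.
have [d [t [tc EJ]]] := annihilator_twist.
apply: (coordinates_sub_N noethA idN spN nilN act_torsion_free (@right_twist_reg _ _ tc) sE sJ _ Cc0 _ EJ) => //.
- by move=> i j e; exact: Estable.
- exact: Eact.
Qed.

End Annihilator.
End Main.

Theorem theorem4p1 (k : fieldType) (H : hopfAlgType k) (A : unitalAlgebra k)
    (act : moduleAlgebra H A)
    (noethA : right_noetherian A)
    (semiprimeA : H_semiprime act)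
    (locfinA : locally_finite_action act) :
  exists (Q : pzRingType) (i : {rmorphism A -> Q}),
    classical_right_quotient_ring i /\ right_artinian Q.
Proof.
have [N [idN spN nilN]] := exists_radical noethA.
apply: (artinian_quotient_ring noethA idN spN nilN); first exact: (act_torsion_free noethA semiprimeA).
by move=> c x Cc; exact: (regN_inj noethA semiprimeA idN spN nilN locfinA Cc).
Qed.
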